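(* Let $Q=Q^1\sqcup Q^2$ be a deconcatenation at the sink $v$. Assume that there are regular exact Borel subalgebras $B^1\subset A^1$ and $B^2\subset A^2$ and that the vertex $v$ is minimal with respect to the essential order $\trianglelefteq^e$ on $Q_0$. Then there exists a regular exact Borel subalgebra $B\subset A$.
   Context: $K$ is an algebraically closed field, $Q$ a finite connected quiver, $I\subset KQ$ an admissible ideal, $A=KQ/I$; modules are finite-dimensional left modules. $L(i),P(i)$ are the simple and its projective cover at $i\in Q_0$. For a partial order $\trianglelefteq$ on $Q_0$, the standard module $\Delta(i)$ is the largest quotient of $P(i)$ with all composition factors $L(j)$ satisfying $j\trianglelefteq i$. $(A,\trianglelefteq)$ is quasi-hereditary if for each $i$ the kernel of $P(i)\twoheadrightarrow\Delta(i)$ has a filtration with subquotients $\Delta(j)$, $j\triangleright i$, and the kernel of $\Delta(i)\twoheadrightarrow L(i)$ has a filtration with subquotients $L(j)$, $j\triangleleft i$. The essential order $\trianglelefteq^e$ is the partial order on $Q_0$ transitively generated by $i\trianglelefteq^e j$ whenever $[\Delta(j):L(i)]>0$ (Jordan–Hölder multiplicity) or $(P(i):\Delta(j))>0$ (multiplicity in a standard filtration). A deconcatenation $Q=Q^1\sqcup Q^2$ at a sink or source $v$: $Q^1,Q^2$ are connected full subquivers of $Q$ with $Q_0=Q^1_0\cup Q^2_0$, $Q^1_0\cap Q^2_0=\{v\}$, and no arrows in $Q$ between vertices of $Q^1_0\setminus\{v\}$ and of $Q^2_0\setminus\{v\}$. Put $A^\ell=A/\langle e_u\mid u\in Q_0\setminus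 Q_0^\ell\rangle$ for $\ell=1,2$. A partial order $\trianglelefteq$ on $Q_0$ is fixed with $(A,\trianglelefteq)$ quasi-hereditary; $\trianglelefteq^\ell$ is its restriction to $Q_0^\ell$, for which $A^\ell$ is quasi-hereditary. Regular exact Borel subalgebras of $A$, $A^\ell$ are with respect to $\trianglelefteq$, $\trianglelefteq^\ell$. Regular exact Borel subalgebra: let $(\Lambda,\trianglelefteq)$ be quasi-hereditary with $n$ simple modules up to isomorphism. A subalgebra $B\subset\Lambda$ is an exact Borel subalgebra if (i) $B$ also has $n$ simple modules $L_B(i)$ up to isomorphism, indexed by the same set, and $(B,\trianglelefteq)$ is quasi-hereditary with simple standard modules; (ii) $\Lambda\otimes_B-$ is exact; (iii) $\Lambda\otimes_B L_B(i)\cong\Delta_\Lambda(i)$ for all $i$. It is regular if moreover the maps $\operatorname{Ext}_B^k(L_B(i),L_B(j))\to\operatorname{Ext}_\Lambda^k(\Lambda\otimes_BL_B(i),\Lambda\otimes_BL_B(j))$ induced by $\Lambda\otimes_B-$ are isomorphisms for all $k\ge 1$ and all $i,j$. *)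

(* Defs.v *)
From HB Require Import structures.
From mathcomp Require Import all_boot all_order all_algebra all_field.
From mathcomp Require Import finmap.
From mathcomp Require Import monalg.
From Stdlib Require Import Relation_Operators.

Set Implicit Arguments.
Unset Strict Implicit.
Unset Printing Implicit Defensive.

Import GRing.Theory.
Local Open Scope ring_scope.

(* Connected quivers are nonempty, so nonemptiness is built in. *)
Record quiver := Quiver {
  vert : finType;
  arr : finType;
  src : arr -> vert;
  tgt : arr -> vert;
  vert_gt0 : (0 < #|vert|)%N
}.
Arguments src {q} _.
Arguments tgt {q} _.

Section Paths.
Variable Q : quiver.

Definition adj (x y : vert Q) : bool :=
  [exists a : arr Q, ((src a == x) && (tgt a == y))
                  || ((src a == y) && (tgt a == x))].

(* The full subquiver on the vertex set S is connected (and nonempty). *)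
Definition connected_on (S : {set vert Q}) : Prop :=
  S != set0 /\
  {in S &, forall x y, connect (fun a b => [&& a \in S, b \in S & adj a b]) x y}.

Definition sink (v : vert Q) : Prop := forall a : arr Q, src a != v.

Definition deconcatenation (V1 V2 : {set vert Q}) (v : vert Q) : Prop :=
  [/\ connected_on V1, connected_on V2, V1 :|: V2 = [set: vert Q],
      V1 :&: V2 = [set v]
    & forall x y, x \in V1 :\ v -> y \in V2 :\ v -> ~~ adj x y].

(* The list of arrows is in order of traversal. *)
Fixpoint walk (x : vert Q) (s : seq (arr Q)) : bool :=
  if s is a :: s' then (src a == x) && walk (tgt a) s' else true.

Definition walk_end (x : vert Q) (s : seq (arr Q)) : vert Q :=
  last x (map tgt s).

Record qpath := QPath {
  path_data : vert Q * seq (arr Q);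
  path_dataP : walk path_data.1 path_data.2
}.

HB.instance Definition _ := [isSub for path_data].
HB.instance Definition _ := [Choice of qpath by <:].

Definition psrc (p : qpath) : vert Q := (path_data p).1.
Definition ptgt (p : qpath) : vert Q := walk_end (psrc p) (path_data p).2.
Definition plen (p : qpath) : nat := size (path_data p).2.

Definition pvert (x : vert Q) : qpath := @QPath (x, [::]) isT.

Lemma walk_cat x s t : walk x (s ++ t) = walk x s && walk (walk_end x s) t.
Proof. by elim: s x => //= a s IH x; rewrite IH andbA. Qed.

(* Paths compose from right to left, like maps: p q runs through q first. Thus
   the left module generated by the trivial path at x has as basis the paths
   that start at x, and the indecomposable projective at a sink is simple. *)
Definition pcomp (p q : qpath) : option qpath :=
  if psrc p == ptgt q
  then insub (psrc q, (path_data q).2 ++ (path_data p).2) else None.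

Variant pcomp_spec (p q : qpath) : option qpath -> Type :=
| PcompSome r of psrc p = ptgt q & psrc r = psrc q & ptgt r = ptgt p
    & (path_data r).2 = (path_data q).2 ++ (path_data p).2
    : pcomp_spec p q (Some r)
| PcompNone of psrc p <> ptgt q : pcomp_spec p q None.

Lemma pcompP p q : pcomp_spec p q (pcomp p q).
Proof.
rewrite /pcomp; case: eqP => [e|]; last by constructor.
have w : walk (psrc q, (path_data q).2 ++ (path_data p).2).1
              (psrc q, (path_data q).2 ++ (path_data p).2).2.
  rewrite /= walk_cat (path_dataP q) /=.
  by rewrite -[walk_end _ _]/(ptgt q) -e (path_dataP p).
rewrite (insubT (fun d : vert Q * seq (arr Q) => walk d.1 d.2) w).
constructor=> //=; rewrite /ptgt /psrc /= /walk_end map_cat last_cat.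
by rewrite -[last _ (map _ (path_data q).2)]/(ptgt q) -e.
Qed.

Lemma qpath_eq (p q : qpath) :
  psrc p = psrc q -> (path_data p).2 = (path_data q).2 -> p = q.
Proof.
move=> h1 h2; apply: val_inj => /=; move: h1 h2; rewrite /psrc.
by case: (path_data p) => a b; case: (path_data q) => c d /= -> ->.
Qed.

Lemma pcompA p q r :
  obind (pcomp p) (pcomp q r) = obind (fun t => pcomp t r) (pcomp p q).
Proof.
case: (pcompP q r) => [s e1 e2 e3 e4|ne]; case: (pcompP p q) => [t f1 f2 f3 f4|nf] //=.
- case: (pcompP p s) => [u g1 g2 g3 g4|]; last by rewrite e3 f1.
  case: (pcompP t r) => [w h1 h2 h3 h4|]; last by rewrite f2 e1.
  congr Some; apply: qpath_eq; first by rewrite g2 h2 e2.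
  by rewrite g4 h4 e4 f4 catA.
- by case: (pcompP p s) => [u g1|//]; case: nf; rewrite g1 e3.
- by case: (pcompP t r) => [w h1|//]; case: ne; rewrite -h1 f2.
Qed.

Lemma pcomp1p x p : pcomp (pvert x) p = if x == ptgt p then Some p else None.
Proof.
case: pcompP => [r /= e1 e2 e3 e4|/eqP/negbTE ne].
  have e : x = ptgt p by rewrite -e1.
  by rewrite e eqxx; congr Some; apply: qpath_eq; rewrite // e4 cats0.
by rewrite -[x]/(psrc (pvert x)) ne.
Qed.

Lemma pcompp1 x p : pcomp p (pvert x) = if x == psrc p then Some p else None.
Proof.
case: pcompP => [r /= e1 e2 e3 e4|/= /eqP/negbTE ne].
  have e : psrc p = x by rewrite e1.
  by rewrite e eqxx; congr Some; apply: qpath_eq; rewrite // e2 e.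
by rewrite eq_sym ne.
Qed.

End Paths.

Lemma malgUZ (K : fieldType) (T : choiceType) (a c : K) (k : T) :
  << a * c *g k >> = a *: << c *g k >> :> {malg K[T]}.
Proof. by apply/malgP => q; rewrite mcoeffZ !mcoeffU mulrnAr. Qed.

Section PathAlgebra.
Variables (K : fieldType) (Q : quiver).
Local Notation KQ := {malg K[qpath Q]}.

Definition pmono (c : K) (p : option (qpath Q)) : KQ :=
  if p is Some r then << c *g r >> else 0.

Fact pamul_key : unit. Proof. by []. Qed.
Definition pamul_def (f g : KQ) : KQ :=
  \sum_(p <- msupp f) \sum_(q <- msupp g) pmono (f@_p * g@_q) (pcomp p q).
Definition pamul := locked_with pamul_key pamul_def.
Canonical pamul_unlockable := [unlockable fun pamul].

Definition paone : KQ := \sum_(x : vert Q) << pvert x >>.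

Local Open Scope fset_scope.
Local Open Scope ring_scope.

Lemma pmono0 p : pmono 0 p = 0.
Proof. by case: p => //= p; rewrite monalgU0. Qed.

Lemma pmonoD c d p : pmono (c + d) p = pmono c p + pmono d p.
Proof. by case: p => [p|] /=; rewrite ?addr0 // monalgUD. Qed.

Lemma pmonoZ a c p : pmono (a * c) p = a *: pmono c p.
Proof.
case: p => [p|] /=; last by rewrite scaler0.
exact: malgUZ.
Qed.

Lemma pamulw (d1 d2 : {fset qpath Q}) (f g : KQ) :
    msupp f `<=` d1 -> msupp g `<=` d2 ->
  pamul f g = \sum_(p <- d1) \sum_(q <- d2) pmono (f@_p * g@_q) (pcomp p q).
Proof.
move=> le1 le2; rewrite unlock /pamul_def (big_fset_incl _ le1) /=.
  apply/eq_bigr=> p _; apply/big_fset_incl => // q _ /mcoeff_outdom ->.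
  by rewrite mulr0 pmono0.
move=> p _ /mcoeff_outdom fp; rewrite big1 // => q _.
by rewrite fp mul0r pmono0.
Qed.

Lemma pamulDl : left_distributive pamul +%R.
Proof.
move=> f1 f2 g.
rewrite (pamulw (msuppD_le f1 f2) (fsubset_refl (msupp g))).
rewrite (pamulw (fsubsetUl _ (msupp f2)) (fsubset_refl (msupp g))).
rewrite (pamulw (fsubsetUr (msupp f1) _) (fsubset_refl (msupp g))).
rewrite -big_split /=; apply: eq_bigr => p _.
rewrite -big_split /=; apply: eq_bigr => q _.
by rewrite mcoeffD mulrDl pmonoD.
Qed.

Lemma pamulDr : right_distributive pamul +%R.
Proof.
move=> g f1 f2.
rewrite (pamulw (fsubset_refl (msupp g)) (msuppD_le f1 f2)).
rewrite (pamulw (fsubset_refl (msupp g)) (fsubsetUl _ (msupp f2))).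
rewrite (pamulw (fsubset_refl (msupp g)) (fsubsetUr (msupp f1) _)).
rewrite -big_split /=; apply: eq_bigr => p _.
rewrite -big_split /=; apply: eq_bigr => q _.
by rewrite mcoeffD mulrDr pmonoD.
Qed.

Lemma pamulZl a (f g : KQ) : pamul (a *: f) g = a *: pamul f g.
Proof.
rewrite (pamulw (msuppZ_le a f) (fsubset_refl (msupp g))).
rewrite (pamulw (fsubset_refl (msupp f)) (fsubset_refl (msupp g))) scaler_sumr.
apply: eq_bigr => p _; rewrite scaler_sumr; apply: eq_bigr => q _.
by rewrite mcoeffZ -mulrA pmonoZ.
Qed.

Lemma pamulZr a (f g : KQ) : pamul f (a *: g) = a *: pamul f g.
Proof.
rewrite (pamulw (fsubset_refl (msupp f)) (msuppZ_le a g)).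
rewrite (pamulw (fsubset_refl (msupp f)) (fsubset_refl (msupp g))) scaler_sumr.
apply: eq_bigr => p _; rewrite scaler_sumr; apply: eq_bigr => q _.
by rewrite -pmonoZ mcoeffZ mulrCA.
Qed.

Lemma pamul0l g : pamul 0 g = 0.
Proof. by have := pamulZl 0 0 g; rewrite !scale0r. Qed.

Lemma pamul0r g : pamul g 0 = 0.
Proof. by have := pamulZr 0 g 0; rewrite !scale0r. Qed.

Lemma pamulUU c d p q :
  pamul << c *g p >> << d *g q >> = pmono (c * d) (pcomp p q).
Proof. by rewrite (pamulw msuppU_le msuppU_le) !big_seq_fset1 !mcoeffUU. Qed.

Lemma pamul_suml (J : Type) (s : seq J) (F : J -> KQ) g :
  pamul (\sum_(i <- s) F i) g = \sum_(i <- s) pamul (F i) g.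
Proof.
exact: (big_morph (pamul^~ g) (fun _ _ => pamulDl _ _ _) (pamul0l g)).
Qed.

Lemma pamul_sumr (J : Type) (s : seq J) (F : J -> KQ) g :
  pamul g (\sum_(i <- s) F i) = \sum_(i <- s) pamul g (F i).
Proof.
exact: (big_morph (pamul g) (fun _ _ => pamulDr _ _ _) (pamul0r g)).
Qed.

Lemma pamul_pmono c p d q :
  pamul (pmono c p) (pmono d q) = pmono (c * d) (obind (fun a => obind (pcomp a) q) p).
Proof.
case: p => [p|]; last exact: pamul0l.
by case: q => [q|]; [exact: pamulUU | exact: pamul0r].
Qed.

Lemma pmono_expand (f : KQ) :
  exists s : seq (K * qpath Q), f = \sum_(x <- s) pmono x.1 (Some x.2).
Proof.
exists [seq (f@_p, p) | p <- msupp f].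
by rewrite big_map; exact: monalgE.
Qed.

(* pamul and pmono are generalized to keep unification from unfolding them. *)
Lemma pamulA : associative pamul.
Proof.
move=> f g h; have [[sf ->] [sg ->] [sh ->]] :=
  And3 (pmono_expand f) (pmono_expand g) (pmono_expand h).
move: pamul_suml pamul_sumr pamul_pmono; move: pamul pmono => m mo ml mr mm.
rewrite !ml; apply: eq_bigr => -[c p] _; rewrite !(mr _ sg) ml.
apply: eq_bigr => -[d q] _; rewrite !(mr _ sh).
apply: eq_bigr => -[e r] _; rewrite !mm mulrA; congr mo => /=.
by rewrite pcompA; case: (pcomp p q).
Qed.

Lemma paoneE : paone = \sum_(x : vert Q) pmono 1 (Some (pvert x)).
Proof. by []. Qed.

Lemma pamul1l : left_id paone pamul.
Proof.
move=> f; have [s ->] := pmono_expand f.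
rewrite paoneE; move: pamul_suml pamul_sumr pamul_pmono.
have : forall c, pmono c None = 0 by [].
move: pamul pmono => m mo mo0 ml mr mm.
rewrite mr; apply: eq_bigr => -[c p] _; rewrite ml (bigD1 (ptgt p)) //=.
rewrite mm /= pcomp1p eqxx mul1r big1 ?addr0 // => x /negbTE ne.
by rewrite mm /= pcomp1p ne mo0.
Qed.

Lemma pamul1r : right_id paone pamul.
Proof.
move=> f; have [s ->] := pmono_expand f.
rewrite paoneE; move: pamul_suml pamul_sumr pamul_pmono.
have : forall c, pmono c None = 0 by [].
move: pamul pmono => m mo mo0 ml mr mm.
rewrite ml; apply: eq_bigr => -[c p] _; rewrite mr (bigD1 (psrc p)) //=.
rewrite mm /= pcompp1 eqxx mulr1 big1 ?addr0 // => x /negbTE ne.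
by rewrite mm /= pcompp1 ne mo0.
Qed.

Lemma paone_neq0 : paone != 0.
Proof.
have /card_gt0P[x _] := vert_gt0 Q.
apply/eqP => /malgP/(_ (pvert x))/eqP.
rewrite /paone raddf_sum /= (bigD1 x) //= mcoeffUU mcoeff0 big1 ?addr0.
  by rewrite oner_eq0.
by move=> y ne; rewrite mcoeffU; case: eqP => // -[e]; rewrite e eqxx in ne.
Qed.

Definition path_algebra := KQ.

HB.instance Definition _ := GRing.Lmodule.copy path_algebra KQ.
HB.instance Definition _ := GRing.Zmodule_isNzRing.Build path_algebra
  pamulA pamul1l pamul1r pamulDl pamulDr paone_neq0.

Fact path_algebra_scaleAl (a : K) (f g : path_algebra) :
  a *: (f * g) = (a *: f) * g.
Proof. exact/esym/pamulZl. Qed.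

HB.instance Definition _ := GRing.Lmodule_isLalgebra.Build K path_algebra
  path_algebra_scaleAl.

Definition triv_path (x : vert Q) : path_algebra := << pvert x >>.

End PathAlgebra.

Arguments triv_path {K Q} x.

Definition two_sided_ideal (R : nzRingType) (J : R -> Prop) : Prop :=
  [/\ J 0, forall x y, J x -> J y -> J (x + y)
    & forall a b x, J x -> J (a * x * b)].

Definition ideal_generated (R : nzRingType) (S : R -> Prop) (x : R) : Prop :=
  forall J : R -> Prop,
    two_sided_ideal J -> (forall y, S y -> J y) -> J x.

(* The m-th power of the arrow ideal of KQ: it is spanned by the paths of
   length at least m. *)
Definition arrow_ideal_pow (K : fieldType) (Q : quiver) (m : nat)
    (f : path_algebra K Q) : Prop :=
  forall p : qpath Q, p \in msupp f -> (m <= plen p)%N.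

Definition admissible (K : fieldType) (Q : quiver)
    (J : path_algebra K Q -> Prop) : Prop :=
  [/\ two_sided_ideal J,
      exists2 m : nat, (2 <= m)%N & forall f, arrow_ideal_pow m f -> J f
    & forall f, J f -> arrow_ideal_pow 2 f].

Section Modules.
Variable K : fieldType.

Record fdmod (A : falgType K) := FDMod {
  fdcar :> vectType K;
  act : A -> 'End(fdcar);
  act_linear : linear act;
  act1 : act 1 = \1%VF;
  actM : forall a b, act (a * b) = (act a \o act b)%VF
}.

Section OneAlgebra.
Variable A : falgType K.
Implicit Types M N X D P : fdmod A.

Definition mhom M N (f : 'Hom(M, N)) : Prop :=
  forall (a : A) (x : M), f (act M a x) = act N a (f x).

Definition misom M N : Prop :=
  exists f : 'Hom(M, N), [/\ mhom f, lker f = 0%VS & limg f = fullv].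

Definition submod M (U : {vspace M}) : Prop :=
  forall a : A, (act M a @: U <= U)%VS.

Definition simple M : Prop :=
  (\dim {:M} > 0)%N /\
  forall U : {vspace M}, submod U -> U = 0%VS \/ U = fullv.

Definition projective P : Prop :=
  forall M N (g : 'Hom(M, N)) (f : 'Hom(P, N)),
    mhom g -> limg g = fullv -> mhom f ->
    exists2 h : 'Hom(P, M), mhom h & (g \o h)%VF = f.

Definition proj_cover P M (p : 'Hom(P, M)) : Prop :=
  [/\ projective P, mhom p, limg p = fullv
    & forall U : {vspace P}, submod U -> (U + lker p)%VS = fullv -> U = fullv].

(* For submodules U <= V of M: V / U is isomorphic to X. *)
Definition subquotient M (V U : {vspace M}) X : Prop :=
  exists f : 'Hom(M, X),
    [/\ forall a, {in V, forall x, f (act M a x) = act X a (f x)},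
        (f @: V)%VS = fullv & (lker f :&: V)%VS = U].

(* filtration C U s: U is a submodule of M with a filtration whose
   subquotients, from top to bottom, are modules of the classes C i for i
   running through s; the multiplicity of i is count_mem i s. *)
Inductive filtration (I : eqType) (C : I -> fdmod A -> Prop) M :
    {vspace M} -> seq I -> Prop :=
| filtration_nil : filtration C 0%VS [::]
| filtration_cons U V X i s :
    filtration C U s -> submod V -> subquotient V U X -> C i X ->
    filtration C V (i :: s).

Section Labelled.
Variables (I : finType) (L : I -> fdmod A) (le : rel I).

Definition complete_simples : Prop :=
  [/\ forall i, simple (L i), forall i j, misom (L i) (L j) -> i = j
    & forall S, simple S -> exists i, misom S (L i)].

Definition is_simple_at (i : I) X : Prop := misom X (L i).

Definition factors_below (i : I) D : Prop :=
  exists2 s, @filtration I is_simple_at D fullv s & all (fun j => le j i) s.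

(* q exhibits D as the largest quotient of P with all composition factors
   below i. *)
Definition largest_quotient (i : I) P D (q : 'Hom(P, D)) : Prop :=
  [/\ mhom q, limg q = fullv, factors_below i D
    & forall D' (q' : 'Hom(P, D')), mhom q' -> limg q' = fullv ->
        factors_below i D' -> (lker q <= lker q')%VS].

Definition is_proj_at (i : I) P : Prop :=
  exists p : 'Hom(P, L i), proj_cover p.

Definition is_standard (i : I) D : Prop :=
  exists P (q : 'Hom(P, D)), is_proj_at i P /\ largest_quotient i q.

Definition slt (i j : I) : bool := (i != j) && le i j.

Definition quasi_hereditary : Prop :=
  forall (i : I) P D (p : 'Hom(P, L i)) (q : 'Hom(P, D)) (r : 'Hom(D, L i)),
    proj_cover p -> largest_quotient i q -> mhom r -> p = (r \o q)%VF ->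
    (exists2 s, @filtration I is_standard P (lker q) s & all (slt i) s) /\
    (exists2 s, @filtration I is_simple_at D (lker r) s
              & all (fun j => slt j i) s).

(* simple_mult M i m means [M : L i] = m, standard_mult M i m means
   (M : Delta i) = m. *)
Definition simple_mult M (i : I) (m : nat) : Prop :=
  exists2 s, @filtration I is_simple_at M fullv s & count_mem i s = m.
Definition standard_mult M (i : I) (m : nat) : Prop :=
  exists2 s, @filtration I is_standard M fullv s & count_mem i s = m.

Definition essential_gen (i j : I) : Prop :=
  (exists D m, [/\ is_standard j D, simple_mult D i m & (0 < m)%N]) \/
  (exists P m, [/\ is_proj_at i P, standard_mult P j m & (0 < m)%N]).

Definition essential_le : I -> I -> Prop := clos_refl_trans I essential_gen.

End Labelled.

Record resolution M := Resolution {
  res : nat -> fdmod A;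
  res_d : forall k, 'Hom(res k.+1, res k);
  res_aug : 'Hom(res 0, M);
  res_projective : forall k, projective (res k);
  res_d_hom : forall k, mhom (res_d k);
  res_aug_hom : mhom res_aug;
  res_aug_onto : limg res_aug = fullv;
  res_exact0 : limg (res_d 0) = lker res_aug;
  res_exactS : forall k, limg (res_d k.+1) = lker (res_d k)
}.

(* Ext^k(M, N) is the space of k-cocycles modulo k-coboundaries; only k >= 1
   is considered, and k is written k'.+1 for the coboundaries. *)
Definition cocycle M (P : resolution M) N k (f : 'Hom(res P k, N)) : Prop :=
  mhom f /\ (f \o res_d P k)%VF = 0.

Definition coboundary M (P : resolution M) N k
    (f : 'Hom(res P k.+1, N)) : Prop :=
  exists2 g : 'Hom(res P k, N), mhom g & f = (g \o res_d P k)%VF.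

End OneAlgebra.

Section Quotient.
Variables (V : vectType K) (U : {vspace V}).

(* V / U, realized on a complement of U. *)
Definition quot : vectType K := subvs_of (U^C)%VS.
Fact qproj_key : unit. Proof. by []. Qed.
Definition qproj : 'Hom(V, quot) := locked_with qproj_key
  (linfun (@vsproj K V (U^C)%VS) \o (\1 - projv U))%VF.
Canonical qproj_unlockable := [unlockable of qproj].
Definition qlift : 'Hom(quot, V) := linfun (@vsval K V (U^C)%VS).

Lemma qprojE v : vsval (qproj v) = v - projv U v.
Proof.
by rewrite [qproj]unlock comp_lfunE lfunE /= vsprojK ?add_lfunE ?opp_lfunE ?id_lfunE ?memv_projC.
Qed.

Lemma lker_qproj : lker qproj = U.
Proof.
apply/vspaceP => v; rewrite memv_ker -(inj_eq val_inj) [X in _ == X]linear0.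
rewrite /= qprojE subr_eq0; apply/eqP/idP => [->|/projv_id //].
exact: memv_proj.
Qed.

Lemma qliftK : cancel qlift qproj.
Proof.
move=> x; apply: val_inj; rewrite /= qprojE lfunE /=.
have /eqP -> : projv U (vsval x) == 0 by rewrite -memv_ker lker_proj subvsP.
by rewrite subr0.
Qed.

Lemma qproj_onto : limg qproj = fullv.
Proof.
apply/vspaceP => x; rewrite memvf; apply/memv_imgP.
by exists (qlift x); rewrite ?memvf ?qliftK.
Qed.

Lemma qprojK v : qlift (qproj v) - v \in U.
Proof.
by rewrite -[in X in _ \in X]lker_qproj memv_ker linearB /= qliftK subrr.
Qed.

Lemma qproj_eq0 v : v \in U -> qproj v = 0.
Proof. by rewrite -[in X in _ \in X]lker_qproj memv_ker => /eqP. Qed.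

End Quotient.

Section Tensor.
Variables (A : falgType K) (B : {aspace A}).
Local Notation Bt := (subvs_of B).

Section OneModule.
Variable M : fdmod Bt.

Local Notation n := (\dim {:A}).
Local Notation e := (vbasis {:A}).

(* The tensor product of A and M over K, as coordinates on a basis of A. *)
Definition ktens : vectType K := {ffun 'I_n -> M}.

Definition kpure (a : A) (m : M) : ktens := [ffun i => coord e i a *: m].

Lemma kpure_linearl m : linear (kpure^~ m).
Proof. by move=> c a b; apply/ffunP => i; rewrite !ffunE linearP scalerDl scalerA. Qed.

Lemma kpure_linearr a : linear (kpure a).
Proof.
by move=> c x y; apply/ffunP => i; rewrite !ffunE scalerDr !scalerA mulrC.
Qed.

HB.instance Definition _ a :=
  GRing.isLinear.Build K M ktens *:%R (kpure a) (kpure_linearr a).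

Definition balance (a : A) (b : Bt) : 'Hom(M, ktens) :=
  (linfun (kpure (a * vsval b)) - (linfun (kpure a) \o act M b))%VF.

Lemma balanceE a b m :
  balance a b m = kpure (a * vsval b) m - kpure a (act M b m).
Proof. by rewrite /balance add_lfunE opp_lfunE comp_lfunE !lfunE. Qed.

(* The span of all (a b) (x) m - a (x) (b m); basis elements a, b suffice. *)
Definition tens_rel : {vspace ktens} :=
  (\sum_(i < n) \sum_(j < \dim {:Bt}) limg (balance e`_i (vbasis {:Bt})`_j))%VS.

Definition kmul_fun (c : A) (w : ktens) : ktens :=
  \sum_(i < n) kpure (c * e`_i) (w i).

Lemma kmul_linear c : linear (kmul_fun c).
Proof.
move=> k x y; rewrite /kmul_fun scaler_sumr -big_split /=.
by apply: eq_bigr => i _; rewrite !ffunE linearP.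
Qed.

HB.instance Definition _ c :=
  GRing.isLinear.Build K ktens ktens *:%R (kmul_fun c) (kmul_linear c).

Definition kmul (c : A) : 'End(ktens) := linfun (kmul_fun c).

Lemma coordA (a : A) : a = \sum_(i < n) coord e i a *: e`_i.
Proof. exact: coord_vbasis (memvf a). Qed.

Lemma kpure_suml (J : finType) (c : J -> K) (F : J -> A) m :
  kpure (\sum_j c j *: F j) m = \sum_j c j *: kpure (F j) m.
Proof.
have h0 : kpure 0 m = 0 by apply/ffunP=> i; rewrite !ffunE linear0 scale0r.
apply: (big_rec2 (fun x y => kpure x m = y)) => // j x y _ <-.
exact: kpure_linearl.
Qed.

Lemma kmul_pure c a m : kmul c (kpure a m) = kpure (c * a) m.
Proof.
rewrite lfunE /= /kmul_fun {2}[a]coordA mulr_sumr.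
rewrite (eq_bigr (fun i => coord e i a *: kpure (c * e`_i) m)); last first.
  by move=> i _; rewrite ffunE linearZ.
rewrite -kpure_suml; congr (kpure _ m); apply: eq_bigr => i _.
by rewrite scalerAr.
Qed.

Lemma ktensE (w : ktens) : w = \sum_(i < n) kpure e`_i (w i).
Proof.
apply/ffunP => i; rewrite sum_ffunE (bigD1 i) //= ffunE.
rewrite coord_free ?(basis_free (vbasisP _)) // eqxx scale1r big1 ?addr0 //.
move=> j ne; rewrite ffunE coord_free ?(basis_free (vbasisP _)) //.
by rewrite (negbTE ne) scale0r.
Qed.

Lemma ktens_ext (W : vectType K) (f g : 'Hom(ktens, W)) :
  (forall a m, f (kpure a m) = g (kpure a m)) -> f = g.
Proof.
move=> h; apply/lfunP => w; rewrite [w]ktensE !linear_sum /=.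
by apply: eq_bigr => i _; rewrite h.
Qed.

Lemma tens_relP a (b : Bt) m :
  kpure (a * vsval b) m - kpure a (act M b m) \in tens_rel.
Proof.
rewrite [a]coordA [b](coord_vbasis (memvf b)).
set eb := vbasis {:Bt}.
have -> : kpure ((\sum_i coord e i a *: e`_i) *
             vsval (\sum_j coord eb j b *: eb`_j)) m
        = \sum_i coord e i a *: \sum_j coord eb j b *: kpure (e`_i * vsval eb`_j) m.
  rewrite mulr_suml (eq_bigr (fun i => coord e i a *:
     (e`_i * vsval (\sum_j coord eb j b *: eb`_j)))); last first.
    by move=> i _; rewrite scalerAl.
  rewrite kpure_suml; apply: eq_bigr => i _; congr (_ *: _).
  rewrite linear_sum mulr_sumr -kpure_suml; congr (kpure _ m).
  by apply: eq_bigr => j _; rewrite linearZ /= scalerAr.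
have -> : act M (\sum_j coord eb j b *: eb`_j) m
        = \sum_j coord eb j b *: act M eb`_j m.
  have h0 : act M 0 m = 0.
    have := act_linear M 1 0 0; rewrite scaler0 addr0 scale1r => h.
    have /eqP := h; rewrite -subr_eq0 opprD addNKr oppr_eq0 => /eqP ->.
    by rewrite zero_lfunE.
  apply: (big_rec2 (fun x y => act M x m = y)) => // j x y _ <-.
  by rewrite act_linear add_lfunE scale_lfunE.
rewrite kpure_suml -sumrB rpred_sum // => i _; rewrite -scalerBr rpredZ //.
rewrite linear_sum /= -sumrB rpred_sum // => j _; rewrite linearZ /= -scalerBr.
rewrite rpredZ //.
apply: (subvP (sumv_sup i _ (sumv_sup j _ (subvv _)))) => //.
by rewrite -balanceE memv_img ?memvf.
Qed.

Lemma kmul_rel c w : w \in tens_rel -> kmul c w \in tens_rel.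
Proof.
suff h : (tens_rel <= kmul c @^-1: tens_rel)%VS.
  by move=> /(subvP h); rewrite -memv_preim.
apply/subv_sumP => i _; apply/subv_sumP => j _; apply/subvP => _ /memv_imgP[m _ ->].
by rewrite -memv_preim balanceE linearB /= !kmul_pure mulrA tens_relP.
Qed.

Definition tens_act (c : A) : 'End(quot tens_rel) :=
  (qproj tens_rel \o kmul c \o qlift tens_rel)%VF.

(* The elementary tensor a (x) m. *)
Definition pure (a : A) (m : M) : quot tens_rel := qproj tens_rel (kpure a m).

Lemma tens_act_proj c w :
  tens_act c (qproj tens_rel w) = qproj tens_rel (kmul c w).
Proof.
rewrite !comp_lfunE; apply/eqP; rewrite -subr_eq0 -!linearB.
by apply/eqP/qproj_eq0/kmul_rel/qprojK.
Qed.

Lemma tens_act_pure c a m : tens_act c (pure a m) = pure (c * a) m.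
Proof. by rewrite tens_act_proj kmul_pure. Qed.

Lemma tens_ext (W : vectType K) (f g : 'Hom(quot tens_rel, W)) :
  (forall a m, f (pure a m) = g (pure a m)) -> f = g.
Proof.
move=> h; have /lfunP E : (f \o qproj tens_rel = g \o qproj tens_rel)%VF.
  by apply: ktens_ext => a m; rewrite !comp_lfunE h.
by apply/lfunP => x; have := E (qlift _ x); rewrite !comp_lfunE qliftK.
Qed.

Lemma pure_linearl m : linear (pure^~ m).
Proof. by move=> c a b; rewrite /pure kpure_linearl linearP. Qed.

Fact tens_act_linear : linear tens_act.
Proof.
move=> k a b; apply: tens_ext => c m.
by rewrite add_lfunE scale_lfunE !tens_act_pure mulrDl -scalerAl pure_linearl.
Qed.

Fact tens_act1 : tens_act 1 = \1%VF.
Proof. by apply: tens_ext => a m; rewrite tens_act_pure mul1r id_lfunE. Qed.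

Fact tens_actM a b : tens_act (a * b) = (tens_act a \o tens_act b)%VF.
Proof. by apply: tens_ext => c m; rewrite comp_lfunE !tens_act_pure mulrA. Qed.

Definition tens : fdmod A := FDMod tens_act_linear tens_act1 tens_actM.

Lemma pure_balanced a (b : Bt) m : pure (a * vsval b) m = pure a (act M b m).
Proof.
by apply/eqP; rewrite -subr_eq0 -linearB; apply/eqP/qproj_eq0/tens_relP.
Qed.

Lemma tens_universal (W : vectType K) (g : A -> M -> W) :
    (forall m, linear (g^~ m)) -> (forall a, linear (g a)) ->
    (forall a (b : Bt) m, g (a * vsval b) m = g a (act M b m)) ->
  exists! h : 'Hom(tens, W), forall a m, h (pure a m) = g a m.
Proof.
move=> gl gr gb.
have gz a c x : g a (c *: x) = c *: g a x by exact: (scalable_linear (gr a)).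
pose gf (w : ktens) : W := \sum_(i < n) g e`_i (w i).
have gfl : linear gf.
  move=> k x y; rewrite /gf scaler_sumr -big_split /=.
  by apply: eq_bigr => i _; rewrite !ffunE (gr e`_i).
pose gL : {linear ktens -> W} :=
  HB.pack gf (GRing.isLinear.Build K ktens W *:%R gf gfl).
have gLE a m : gL (kpure a m) = g a m.
  rewrite /= /gf {2}[a]coordA.
  have g0 : g 0 m = 0.
    have := gl m 1 0 0; rewrite scaler0 addr0 scale1r => /eqP.
    by rewrite -subr_eq0 opprD addNKr oppr_eq0 => /eqP.
  have -> : g (\sum_i coord e i a *: e`_i) m = \sum_i coord e i a *: g e`_i m.
    apply: (big_rec2 (fun x y => g x m = y)) => // j x y _ <-.
    exact: gl.
  by apply: eq_bigr => i _; rewrite ffunE gz.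
have kill w : w \in tens_rel -> linfun gL w = 0.
  suff h : (tens_rel <= lker (linfun gL))%VS.
    by move=> /(subvP h); rewrite memv_ker => /eqP.
  apply/subv_sumP => i _; apply/subv_sumP => j _.
  apply/subvP => _ /memv_imgP[m _ ->]; rewrite memv_ker.
  by rewrite balanceE lfunE linearB !gLE gb subrr.
have liftE w : linfun gL (qlift tens_rel (qproj tens_rel w)) = gL w.
  have /eqP := kill _ (qprojK tens_rel w); rewrite linearB subr_eq0 => /eqP ->.
  exact: lfunE.
exists (linfun gL \o qlift tens_rel)%VF; split.
  by move=> a m; rewrite comp_lfunE liftE gLE.
by move=> h hE; apply: tens_ext => a m; rewrite hE comp_lfunE liftE gLE.
Qed.

End OneModule.

Section Functor.
Variables M N : fdmod Bt.

Definition ktens_map_fun (f : 'Hom(M, N)) (w : ktens M) : ktens N :=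
  [ffun i => f (w i)].

Lemma ktens_map_linear f : linear (ktens_map_fun f).
Proof. by move=> k x y; apply/ffunP => i; rewrite !ffunE linearP. Qed.

HB.instance Definition _ f :=
  GRing.isLinear.Build K (ktens M) (ktens N) *:%R _ (ktens_map_linear f).

(* The map id_A (x) f; meaningful when f is B-linear, see tens_map_pure. *)
Definition tens_map (f : 'Hom(M, N)) : 'Hom(tens M, tens N) :=
  (qproj (tens_rel N) \o linfun (ktens_map_fun f) \o qlift (tens_rel M))%VF.

Lemma tens_map_pure f a m : mhom f -> tens_map f (pure a m) = pure a (f m).
Proof.
move=> hf.
have kE b x : linfun (ktens_map_fun f) (kpure b x) = kpure b (f x).
  by rewrite lfunE; apply/ffunP => i; rewrite !ffunE linearZ.
have kill w : w \in tens_rel M -> linfun (ktens_map_fun f) w \in tens_rel N.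
  suff h : (tens_rel M <= linfun (ktens_map_fun f) @^-1: tens_rel N)%VS.
    by move=> /(subvP h); rewrite -memv_preim.
  apply/subv_sumP => i _; apply/subv_sumP => j _.
  apply/subvP => _ /memv_imgP[x _ ->]; rewrite -memv_preim.
  by rewrite balanceE linearB /= !kE hf tens_relP.
rewrite /tens_map /pure !comp_lfunE -kE; apply/eqP.
by rewrite -subr_eq0 -!linearB; apply/eqP/qproj_eq0/kill/qprojK.
Qed.

End Functor.

Definition tens_exact : Prop :=
  forall (M' M M'' : fdmod Bt) (f : 'Hom(M', M)) (g : 'Hom(M, M'')),
    mhom f -> mhom g -> lker f = 0%VS -> limg f = lker g -> limg g = fullv ->
    [/\ lker (tens_map f) = 0%VS, limg (tens_map f) = lker (tens_map g)
      & limg (tens_map g) = fullv].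

(* The map Ext_B^k(M, N) -> Ext_A^k(A (x) M, A (x) N) induced by A (x)_B - is
   bijective, for k = k'.+1. Computed with projective resolutions P of M and R
   of A (x) M, it sends the class of f to that of (A (x) f) c_k, for any chain
   map c from R to A (x) P that lifts the identity of A (x) M. *)
Definition ext_map_iso (k' : nat) (M N : fdmod Bt) : Prop :=
  forall (P : resolution M) (R : resolution (tens M))
         (c : forall k, 'Hom(res R k, tens (res P k))),
    (forall k, mhom (c k)) ->
    (tens_map (res_aug P) \o c 0)%VF = res_aug R ->
    (forall k, (tens_map (res_d P k) \o c k.+1)%VF = (c k \o res_d R k)%VF) ->
    (forall f : 'Hom(res P k'.+1, N), cocycle f ->
       coboundary (tens_map f \o c k'.+1)%VF -> coboundary f) /\
    (forall g : 'Hom(res R k'.+1, tens N), cocycle g ->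
       exists2 f : 'Hom(res P k'.+1, N), cocycle f
         & coboundary (g - (tens_map f \o c k'.+1))%VF).

End Tensor.

Section Borel.
Variables (A : falgType K) (I : finType) (L : I -> fdmod A) (le : rel I).

(* An {aspace A} may have a unit other than 1, hence the condition 1 \in B. *)
Definition exact_borel (B : {aspace A}) (LB : I -> fdmod (subvs_of B)) : Prop :=
  [/\ 1 \in B,
      [/\ complete_simples LB, quasi_hereditary LB le
        & forall i D, is_standard LB le i D -> simple D],
      tens_exact B
    & forall i, is_standard L le i (tens (LB i))].

Definition regular_exact_borel (B : {aspace A}) : Prop :=
  exists LB : I -> fdmod (subvs_of B),
    exact_borel LB /\ forall k i j, ext_map_iso k (LB i) (LB j).

End Borel.

(* pi : KQ -> A identifies A with KQ / J, where J is an admissible ideal. *)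
Definition bound_quiver_algebra (Q : quiver) (J : path_algebra K Q -> Prop)
    (A : falgType K) (pi : {lrmorphism path_algebra K Q -> A}) : Prop :=
  [/\ admissible J, forall a : A, exists f, pi f = a
    & forall f, pi f = 0 <-> J f].

(* L i is the simple module at the vertex i, where e i is the corresponding
   idempotent. *)
Definition vertex_simples (A : falgType K) (I : finType) (e : I -> A)
    (L : I -> fdmod A) : Prop :=
  forall i, simple (L i) /\ act (L i) (e i) != 0.

(* The vertices of the full subquiver on V. *)
Definition sub_vertex (Q : quiver) (V : {set vert Q}) : finType :=
  {x : vert Q | x \in V}.

(* pr : A -> A' is the quotient of A by the two-sided ideal generated by the
   idempotents e u with u not in V. *)
Definition vertex_quotient (Q : quiver) (A A' : falgType K)
    (e : vert Q -> A) (V : {set vert Q}) (pr : 'AHom(A, A')) : Prop :=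
  limg pr = fullv /\
  forall x, pr x = 0 <-> ideal_generated (fun y => exists2 u, u \notin V & y = e u) x.

End Modules.

Definition partial_order (I : eqType) (le : rel I) : Prop :=
  [/\ reflexive le, antisymmetric le & transitive le].

(* Main.v *)
(* Since v is a sink, A is the fibre product of A1 and A2 over K, along the
   characters of the simple modules at v.  As A is basic, the simple modules of an
   exact Borel subalgebra are the restrictions of those of the algebra.

   Since v is minimal in the essential order and Delta(v) = P(v) is simple, every
   extension of a simple B_l-module (l = 1, 2) by the simple module at v, or vice
   versa, splits: it suffices to see that the induced extension of standard modules
   splits, and this is so because P(v) is projective, respectively because the
   kernel of P(u) -> Delta(u) has no Delta(v) in its standard filtration.  Hence
   the vertex v is isolated in B_l: there is a central idempotent F_l of B_l
   with B_l F_l = K F_l, and moreover A_l F_l = K F_l.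

   Take for B the fibre product of B1 and B2.  The idempotents f1 = (1 - F1, 0)
   and f2 = (0, 1 - F2) are central in B, and on modules killed by f2 induction
   from B to A agrees with induction from B1 to A1, and symmetrically.  So A (x) - is a natural
   direct summand of the sum of two exact functors, the standard modules are
   inflated from A1 and A2, and Ext between simple modules on the same side is
   computed over B1 or B2; across the two sides it vanishes. *)
Require Import Defs.
From HB Require Import structures.
From mathcomp Require Import all_boot all_algebra all_field.
From mathcomp Require Import finmap monalg ring.
From Stdlib Require Import Classical ClassicalEpsilon Relation_Operators.

Set Implicit Arguments.
Unset Strict Implicit.
Unset Printing Implicit Defensive.

Import GRing.Theory.
Local Open Scope ring_scope.

(** * Linear maps and modules *)

(** [B_l] is given as a mere subspace of [A_l]: it need not contain any [e i], and no presentation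
    of it is known. Its structure is read off the characters [chi i] instead. Extensions between
    simple modules become functionals [delta] obeying a Leibniz rule, and a split one is a multiple
    of [chi q - chi p]. Every functional that vanishes on the square of the radical [RB] of [B_l]
    yields such a [delta]; splitting at [v] thus gives [RB f <= RB^2] and [f RB <= RB^2] for [f] in
    [B_l] dual to [v], and nilpotency makes a power of [f] the required [F_l]. That [A_l F_l], not
    only [B_l F_l], is a line makes [a (1 - f2)] depend on the first component of [a] alone.
    Regularity quantifies over all resolutions and chain maps. Adjunction removes those over [A]:
    the unit [N -> A (x) N] has to induce bijections on Ext over [B] in positive degrees. This form
    passes between [B] and [B_l] because restriction to [B_l] preserves projectives: on the part of
    a module belonging to the other side [B_l] acts through [chi v], and [B_l F_l] is a projective
    line. *)

Section LinearMaps.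
Variable K : fieldType.
Implicit Types U V W : vectType K.

Lemma limg_fullP U V (f : 'Hom(U, V)) :
  limg f = fullv <-> forall y, exists x, f x = y.
Proof.
split=> [h y|h]; last first.
  by apply/vspaceP => y; rewrite memvf; have [x <-] := h y; rewrite memv_img ?memvf.
by have /memv_imgP[x _ ->] : y \in limg f; [rewrite h memvf | exists x].
Qed.

Lemma lker_eq0P U V (f : 'Hom(U, V)) :
  lker f = 0%VS <-> forall x, f x = 0 -> x = 0.
Proof.
split=> [h x fx|h]; first by apply/eqP; rewrite -memv0 -h memv_ker fx.
apply/vspaceP => x; rewrite memv_ker memv0; apply/eqP/eqP => [/h //|->].
exact: linear0.
Qed.

Lemma exactP U V W (f : 'Hom(U, V)) (g : 'Hom(V, W)) :
  limg f = lker g <->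
  (forall x, g (f x) = 0) /\ (forall y, g y = 0 -> exists x, f x = y).
Proof.
split=> [h|[h1 h2]].
  split=> [x|y gy]; first by apply/eqP; rewrite -memv_ker -h memv_img ?memvf.
  by have /memv_imgP[x _ ->] : y \in limg f; [rewrite h memv_ker gy | exists x].
apply/vspaceP => y; rewrite memv_ker; apply/memv_imgP/eqP => [[x _ ->] //|/h2[x <-]].
by exists x; rewrite ?memvf.
Qed.

Lemma linear_hom U V (f : U -> V) : linear f -> exists F : 'Hom(U, V), F =1 f.
Proof.
move=> hf; pose fL : {linear U -> V} := HB.pack f (GRing.isLinear.Build K U V *:%R f hf).
by exists (linfun fL) => x; rewrite lfunE.
Qed.

Lemma scaler_neq0_inj U (w : U) : w != 0 -> forall a b : K, a *: w = b *: w -> a = b.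
Proof.
move=> wn0 a b /eqP; rewrite -subr_eq0 -scalerBl scaler_eq0 (negbTE wn0) orbF.
by rewrite subr_eq0 => /eqP.
Qed.

Lemma line_coord U (w : U) : w != 0 -> (forall y, exists k, y = k *: w) ->
  exists lam : 'Hom(U, K^o), forall y, y = (lam y : K) *: w.
Proof.
move=> wn0 line.
pose lam y := proj1_sig (constructive_indefinite_description _ (line y)).
have lamE y : y = lam y *: w.
  by rewrite /lam; case: (constructive_indefinite_description _ _).
have [|F FE] := @linear_hom U K^o lam; last by exists F => y; rewrite FE.
move=> k x y; suff E : lam (k *: x + y) = k * lam x + lam y by [].
apply: (scaler_neq0_inj wn0).
by rewrite -lamE scalerDl -!lamE -scalerA -lamE.
Qed.

Lemma line_iso U V (x0 : U) (y0 : V) : x0 != 0 -> y0 != 0 ->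
    (forall x, exists k, x = k *: x0) -> (forall y, exists k, y = k *: y0) ->
  exists u : 'Hom(U, V), lker u = 0%VS /\ limg u = fullv.
Proof.
move=> xn0 yn0 hx hy; have [lam lamE] := line_coord xn0 hx.
have [|u uE] := @linear_hom U V (fun x => (lam x : K) *: y0).
  by move=> k x y; rewrite linearP /= scalerDl scalerA.
exists u; split.
  apply/lker_eq0P => x; rewrite uE => /eqP; rewrite scaler_eq0 (negbTE yn0) orbF => /eqP l0.
  by rewrite [x]lamE l0 scale0r.
apply/limg_fullP => y; have [k ->] := hy y; exists (k *: x0); rewrite uE linearZ /=.
have -> : (lam x0 : K) = 1 by apply: (scaler_neq0_inj xn0); rewrite -lamE scale1r.
by rewrite /GRing.scale /= mulr1.
Qed.

Lemma lker_comp_inj U V W (f : 'Hom(U, V)) (g : 'Hom(V, W)) :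
  lker g = 0%VS -> lker (g \o f) = lker f.
Proof.
move=> /lker_eq0P g0; apply/vspaceP => x; rewrite !memv_ker comp_lfunE.
by apply/eqP/eqP => [/g0 //|->]; apply: linear0.
Qed.

Lemma factor_through U V W (q : 'Hom(U, V)) (p : 'Hom(U, W)) :
    limg q = fullv -> (lker q <= lker p)%VS ->
  exists r : 'Hom(V, W), p = (r \o q)%VF.
Proof.
move=> /limg_fullP hq hp; exists (p \o q^-1)%VF; apply/lfunP => x.
rewrite !comp_lfunE; apply/eqP; rewrite -subr_eq0 -linearB /= -memv_ker.
apply: (subvP hp); rewrite memv_ker linearB /= limg_lfunVK ?subrr //.
by rewrite memv_img ?memvf.
Qed.

(** A nonzero coordinate of the class of [x] modulo [V]; such functionals later detect elements
    outside the square of the radical. *)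
Lemma exists_functional U (V : {vspace U}) x : x \notin V ->
  exists mu : 'Hom(U, K^o), (forall y, y \in V -> mu y = 0) /\ mu x != 0.
Proof.
move=> xV; have qx : qproj V x != 0 by rewrite -memv_ker lker_qproj.
have : exists i, coord (vbasis {:quot V}) i (qproj V x) != 0.
  apply/existsP; apply: contraNT qx => /existsPn h.
  rewrite (coord_vbasis (memvf (qproj V x))) big1 // => i _.
  by have := h i; rewrite negbK => /eqP ->; rewrite scale0r.
case=> i hi; have [|mu muE] := @linear_hom U K^o
  (fun y => coord (vbasis {:quot V}) i (qproj V y)).
  by move=> k y z; rewrite !linearP.
exists mu; split=> [y yV|]; rewrite muE //.
by rewrite qproj_eq0 // linear0.
Qed.

End LinearMaps.

Section Action.
Variables (K : fieldType) (R : falgType K).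
Implicit Types M N X P : fdmod R.

Lemma actD M a b x : act M (a + b) x = act M a x + act M b x.
Proof.
by have := act_linear M 1 a b; rewrite !scale1r => ->; rewrite add_lfunE.
Qed.

Lemma act0 M x : act M 0 x = 0.
Proof. by have := actD 0 0 x; rewrite addr0 => /eqP; rewrite -subr_eq0 opprD addNKr oppr_eq0 => /eqP. Qed.

Lemma actZ M k a x : act M (k *: a) x = k *: act M a x.
Proof.
have := act_linear M k a 0; rewrite addr0 => ->.
by rewrite add_lfunE scale_lfunE act0 addr0.
Qed.

Lemma actN M a x : act M (- a) x = - act M a x.
Proof. by rewrite -scaleN1r actZ scaleN1r. Qed.

Lemma actB M a b x : act M (a - b) x = act M a x - act M b x.
Proof. by rewrite actD actN. Qed.

Lemma actME M a b x : act M (a * b) x = act M a (act M b x).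
Proof. by rewrite actM comp_lfunE. Qed.

Lemma act1E M x : act M 1 x = x.
Proof. by rewrite act1 id_lfunE. Qed.

Lemma act_sum M (I : Type) (r : seq I) (F : I -> R) x :
  act M (\sum_(i <- r) F i) x = \sum_(i <- r) act M (F i) x.
Proof. exact: (big_morph (fun a => act M a x) (fun a b => actD a b x) (act0 x)). Qed.

Lemma act_linear_fun M x : linear (fun a => act M a x).
Proof. by move=> k a b; rewrite actD actZ. Qed.

Lemma submodP M (U : {vspace M}) :
  submod U <-> forall a x, x \in U -> act M a x \in U.
Proof.
split=> [h a x xU|h a]; first by apply: (subvP (h a)); rewrite memv_img.
by apply/subvP => _ /memv_imgP[x xU ->]; apply: h.
Qed.

Lemma mhom_comp M N X (g : 'Hom(N, X)) (f : 'Hom(M, N)) :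
  mhom g -> mhom f -> mhom (g \o f)%VF.
Proof. by move=> hg hf a x; rewrite !comp_lfunE hf hg. Qed.

Lemma mhom_id M : @mhom _ _ M M \1%VF.
Proof. by move=> a x; rewrite !id_lfunE. Qed.

Lemma mhom0 M N : @mhom _ _ M N 0.
Proof. by move=> a x; rewrite !zero_lfunE linear0. Qed.

Lemma mhomB M N (f g : 'Hom(M, N)) : mhom f -> mhom g -> mhom (f - g).
Proof. by move=> hf hg a x; rewrite !add_lfunE !opp_lfunE hf hg linearB. Qed.

Lemma mhomD M N (f g : 'Hom(M, N)) : mhom f -> mhom g -> mhom (f + g).
Proof. by move=> hf hg a x; rewrite !add_lfunE hf hg linearD. Qed.

Lemma submod_ker M N (f : 'Hom(M, N)) : mhom f -> submod (lker f).
Proof.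
move=> hf; apply/submodP => a x; rewrite !memv_ker hf => /eqP ->.
by rewrite linear0.
Qed.

Lemma submod_img M N (f : 'Hom(M, N)) : mhom f -> submod (limg f).
Proof.
move=> hf; apply/submodP => a _ /memv_imgP[x _ ->].
by rewrite -hf memv_img ?memvf.
Qed.

Lemma mhom_inv M N (f : 'Hom(M, N)) : mhom f -> lker f = 0%VS ->
  limg f = fullv -> mhom (f^-1)%VF.
Proof.
move=> hf k0 ff a y; have fK z : f ((f^-1)%VF z) = z by rewrite limg_lfunVK // ff memvf.
by rewrite -{1}[y]fK -hf lker0_lfunK //; apply/eqP.
Qed.

Lemma misom_sym M N : misom M N -> misom N M.
Proof.
case=> f [hf k0 ff]; exists (f^-1)%VF; split; first exact: mhom_inv.
- apply/lker_eq0P => x fx; have <- : f ((f^-1)%VF x) = x by rewrite limg_lfunVK // ff memvf.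
  by rewrite fx linear0.
- apply/limg_fullP => x; exists (f x); rewrite lker0_lfunK //; exact/eqP.
Qed.

Lemma misom_trans M N X : misom M N -> misom N X -> misom M X.
Proof.
case=> f [hf /lker_eq0P kf /limg_fullP sf] [g [hg /lker_eq0P kg /limg_fullP sg]].
exists (g \o f)%VF; split; first exact: mhom_comp.
  by apply/lker_eq0P => x; rewrite comp_lfunE => /kg/kf.
apply/limg_fullP => z; have [y <-] := sg z; have [x <-] := sf y.
by exists x; rewrite comp_lfunE.
Qed.

Lemma misom_refl M : misom M M.
Proof.
exists \1%VF; split; first exact: mhom_id.
  by apply/lker_eq0P => x; rewrite id_lfunE.
by apply/limg_fullP => x; exists x; rewrite id_lfunE.
Qed.

Section Sub.
Variables (M : fdmod R) (U : {vspace M}) (hU : submod U).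

Let sub_act (a : R) : 'End(subvs_of U) :=
  (linfun (vsproj U) \o act M a \o linfun vsval)%VF.

Let sub_actE a x : vsval (sub_act a x) = act M a (vsval x).
Proof.
rewrite /sub_act !comp_lfunE !lfunE /= vsprojK //.
by apply: (submodP _).1 => //; apply: subvsP.
Qed.

Let sub_act_linear : linear sub_act.
Proof.
move=> k a b; apply/lfunP => x; apply: val_inj.
rewrite add_lfunE scale_lfunE; transitivity (k *: vsval (sub_act a x) + vsval (sub_act b x)) => //.
by rewrite !sub_actE -actZ -actD -sub_actE.
Qed.

Let sub_act1 : sub_act 1 = \1%VF.
Proof. by apply/lfunP => x; apply: val_inj; rewrite /= sub_actE act1E id_lfunE. Qed.

Let sub_actM a b : sub_act (a * b) = (sub_act a \o sub_act b)%VF.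
Proof.
by apply/lfunP => x; apply: val_inj; rewrite /= comp_lfunE !sub_actE actME.
Qed.

Definition fdsub : fdmod R := FDMod sub_act_linear sub_act1 sub_actM.

Definition fdincl : 'Hom(fdsub, M) := linfun (@vsval _ _ U).

Lemma fdinclE x : fdincl x = vsval x. Proof. exact: lfunE. Qed.

Lemma mhom_incl : mhom fdincl.
Proof. by move=> a x; rewrite !fdinclE sub_actE. Qed.

Lemma fdincl_inj x : fdincl x = 0 -> x = 0.
Proof. by rewrite fdinclE => h; exact: val_inj. Qed.

Lemma fdincl_img : limg fdincl = U.
Proof.
apply/vspaceP => x; apply/memv_imgP/idP => [[y _ ->]|xU]; first by rewrite fdinclE subvsP.
by exists (vsproj U x); rewrite ?memvf // fdinclE vsprojK.
Qed.

Lemma mhom_restr N (f : 'Hom(N, M)) : mhom f -> (limg f <= U)%VS ->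
  exists g : 'Hom(N, fdsub),
    [/\ mhom g, forall x, vsval (g x) = f x & (fdincl \o g)%VF = f].
Proof.
move=> hf fU; pose g : 'Hom(N, fdsub) := (linfun (vsproj U) \o f)%VF.
have gE x : vsval (g x) = f x.
  by rewrite /g comp_lfunE lfunE /= vsprojK // (subvP fU) // memv_img ?memvf.
exists g; split=> //; last by apply/lfunP => x; rewrite comp_lfunE fdinclE gE.
by move=> a x; apply: val_inj; rewrite [RHS]/= sub_actE /= !gE hf.
Qed.

End Sub.

Section Quot.
Variables (M : fdmod R) (U : {vspace M}) (hU : submod U).

Let quot_act (a : R) : 'End(quot U) := (qproj U \o act M a \o qlift U)%VF.

Let quot_actE a x : quot_act a (qproj U x) = qproj U (act M a x).
Proof.
rewrite /quot_act !comp_lfunE; apply/eqP; rewrite -subr_eq0 -!linearB /=.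
by apply/eqP/qproj_eq0; apply: (submodP _).1 => //; apply: qprojK.
Qed.

Let quot_act_linear : linear quot_act.
Proof.
move=> k a b; apply/lfunP => x; rewrite -[x]qliftK.
by rewrite add_lfunE scale_lfunE !quot_actE -linearP /= actD actZ.
Qed.

Let quot_act1 : quot_act 1 = \1%VF.
Proof. by apply/lfunP => x; rewrite -[x]qliftK quot_actE act1E id_lfunE. Qed.

Let quot_actM a b : quot_act (a * b) = (quot_act a \o quot_act b)%VF.
Proof. by apply/lfunP => x; rewrite -[x]qliftK comp_lfunE !quot_actE actME. Qed.

Definition fdquot : fdmod R := FDMod quot_act_linear quot_act1 quot_actM.

Definition fdproj : 'Hom(M, fdquot) := qproj U.

Lemma mhom_proj : mhom fdproj.
Proof. by move=> a x; rewrite /fdproj -quot_actE. Qed.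

Lemma fdproj_onto : limg fdproj = fullv. Proof. exact: qproj_onto. Qed.

Lemma fdproj_ker : lker fdproj = U. Proof. exact: lker_qproj. Qed.

End Quot.

Lemma simple_hom_inj M N (f : 'Hom(M, N)) x :
  simple M -> mhom f -> f x != 0 -> lker f = 0%VS.
Proof.
case=> _ hM hf fx; have [//|h] := hM _ (submod_ker hf).
by move: fx; rewrite -memv_ker h memvf.
Qed.

End Action.

(** * Change of rings *)

Definition alghom (K : fieldType) (R S : falgType K) (f : R -> S) : Prop :=
  [/\ linear f, f 1 = 1 & {morph f : x y / x * y}].

Section Pull.
Variables (K : fieldType) (R S : falgType K) (f : R -> S) (hf : alghom f).

Let pull_linear (M : fdmod S) : linear (fun a => act M (f a)).
Proof. by case: hf => h _ _ k a b; rewrite h act_linear. Qed.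

Let pull_act1 (M : fdmod S) : act M (f 1) = \1%VF.
Proof. by case: hf => _ -> _; apply: act1. Qed.

Let pull_actM (M : fdmod S) a b : act M (f (a * b)) = (act M (f a) \o act M (f b))%VF.
Proof. by case: hf => _ _ ->; apply: actM. Qed.

Definition pull (M : fdmod S) : fdmod R :=
  FDMod (pull_linear M) (pull_act1 M) (@pull_actM M).

Lemma mhom_pull (M N : fdmod S) (g : 'Hom(M, N)) :
  mhom g -> @mhom _ _ (pull M) (pull N) g.
Proof. by move=> hg a x; apply: hg. Qed.

Lemma alghom0 : f 0 = 0.
Proof.
have [h _ _] := hf; have := h 1 0 0; rewrite !scale1r addr0 => /eqP.
by rewrite -subr_eq0 opprD addNKr oppr_eq0 => /eqP.
Qed.

Lemma alghomD a b : f (a + b) = f a + f b.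
Proof. by have [h _ _] := hf; have := h 1 a b; rewrite !scale1r. Qed.

Lemma alghomZ k a : f (k *: a) = k *: f a.
Proof. by have [h _ _] := hf; have := h k a 0; rewrite !addr0 alghom0 addr0. Qed.

Lemma alghomB a b : f (a - b) = f a - f b.
Proof. by rewrite alghomD -scaleN1r alghomZ scaleN1r. Qed.

Lemma alghom1 : f 1 = 1. Proof. by case: hf. Qed.

Lemma alghomM a b : f (a * b) = f a * f b. Proof. by case: hf. Qed.

Lemma misom_pull (M N : fdmod S) : misom M N -> misom (pull M) (pull N).
Proof. by case=> g [hg k0 ff]; exists g; split=> //; apply: mhom_pull. Qed.

(* C need only be related to C' on modules killed by the annihilator of M',
   because these include all subquotients of M'. *)
Lemma filtration_transport (I I' T : eqType) (h : I -> T) (h' : I' -> T)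
    (C : I -> fdmod R -> Prop) (C' : I' -> fdmod S -> Prop)
    (M : fdmod R) (M' : fdmod S) (g : 'Hom(M, M')) :
    (forall a x, g (act M a x) = act M' (f a) (g x)) ->
    lker g = 0%VS -> limg g = fullv ->
    (forall j X, C' j X ->
       (forall b, (forall x, act M' b x = 0) -> forall x, act X b x = 0) ->
       exists i, h i = h' j /\ C i (pull X)) ->
  forall U s, filtration C' U s ->
    exists2 s', filtration C (g @^-1: U)%VS s' & map h s' = map h' s.
Proof.
move=> hg k0 /limg_fullP sg hC U s; elim=> {U s} [|U V X i s _ [s' fs' es'] hV [p [hp pV pU]] CX].
  by exists [::] => //; rewrite lpreim0 k0; apply: filtration_nil.
have [|j [ej Cj]] := hC _ _ CX.
  move=> b hb x; have : x \in (p @: V)%VS by rewrite pV memvf.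
  by case/memv_imgP=> y yV ->; rewrite -hp // hb linear0.
exists (j :: s'); last by rewrite /= ej es'.
apply: (filtration_cons fs' _ _ Cj).
  apply/submodP => a x; rewrite -!memv_preim hg => xV.
  exact: (submodP _).1.
exists (p \o g)%VF; split.
- by move=> a x; rewrite -memv_preim => xV; rewrite !comp_lfunE hg hp.
- rewrite limg_comp lpreimK // ; apply/subvP => y _; apply/memv_imgP.
  by have [x <-] := sg y; exists x; rewrite ?memvf.
- apply/vspaceP => x; rewrite memv_cap memv_ker comp_lfunE -!memv_preim -pU.
  by rewrite memv_cap memv_ker.
Qed.

End Pull.

Lemma alghom_id (K : fieldType) (R : falgType K) : alghom (@idfun R).
Proof. by split. Qed.

(** * Standard modules and their tops *)

Section PointedModules.
Variables (K : fieldType) (R : falgType K) (I : finType) (L : I -> fdmod R).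
Variable le : rel I.
Implicit Types M P D X : fdmod R.

Lemma factors_below_iso i D D' :
  misom D' D -> factors_below L le i D -> factors_below L le i D'.
Proof.
case=> g [hg k0 gf] [s fs als].
have [||||s' fs' es] := @filtration_transport _ _ _ _ (alghom_id R) _ _ _ id id
  (is_simple_at L) (is_simple_at L) D' D g _ _ _ _ _ _ fs => //.
  by move=> j X hX _; exists j; split.
exists s'; last by move: es; rewrite !map_id => ->.
suff <- : (g @^-1: fullv)%VS = fullv by [].
by apply/vspaceP => x; rewrite -memv_preim !memvf.
Qed.

Lemma is_standard_iso i D D' :
  misom D D' -> is_standard L le i D -> is_standard L le i D'.
Proof.
move=> isoDD'; have isoD'D := misom_sym isoDD'.
case: isoDD' => g [hg k0 gf] [P [q [hP [hq qf fD hD]]]].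
exists P, (g \o q)%VF; split=> //; split.
- exact: mhom_comp.
- by rewrite limg_comp qf.
- exact: factors_below_iso fD.
- move=> X q' hq' q'f fX; apply: subv_trans (hD _ _ hq' q'f fX).
  apply/subvP => x; rewrite !memv_ker comp_lfunE => /eqP.
  by move/(lker_eq0P _).1: k0 => k0 /k0 ->.
Qed.

Hypothesis le_refl : reflexive le.

Lemma factors_below_simple i X : misom X (L i) -> factors_below L le i X.
Proof.
move=> hX; exists [:: i]; last by rewrite /= le_refl.
apply: (@filtration_cons _ _ _ _ _ 0%VS fullv X) => //; first exact: filtration_nil.
  by apply/submodP => *; rewrite memvf.
exists \1%VF; split; first by move=> a x _; rewrite !id_lfunE.
  by rewrite lim1g.
by apply/vspaceP => x; rewrite memv_cap memvf andbT memv_ker id_lfunE memv0.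
Qed.

(** By reflexivity [L i] is itself a quotient of [P] with all factors below [i], so the largest such
    quotient maps to it. *)
Lemma standard_top i P D (p : 'Hom(P, L i)) (q : 'Hom(P, D)) :
    proj_cover p -> largest_quotient L le i q ->
  exists2 r : 'Hom(D, L i), mhom r & p = (r \o q)%VF.
Proof.
case=> _ hp pf _ [hq qf _ hD].
have hk : (lker q <= lker p)%VS by apply: hD => //; apply/factors_below_simple/misom_refl.
have [r pE] := factor_through qf hk; exists r => //.
move=> a y; have [x <-] := (limg_fullP _).1 qf y.
have rE z : r (q z) = p z by rewrite pE comp_lfunE.
by rewrite -hq !rE hp.
Qed.

End PointedModules.

(** * Inflation along a surjection [phi] with a section [sigma] *)

Section Retract.
Variables (K : fieldType) (R S : falgType K) (phi : R -> S) (sigma : S -> R).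
Hypotheses (hphi : alghom phi) (hsigma : alghom sigma).
Hypothesis sigmaK : cancel sigma phi.
Implicit Types (M : fdmod R) (N : fdmod S).

(** These are the modules inflated along [phi]: on them [sigma (phi a)] acts as [a], so restriction
    along [sigma] inverts inflation. *)
Definition killed (M : fdmod R) : Prop :=
  forall a, phi a = 0 -> forall x, act M a x = 0.

Lemma killedE M a x : killed M -> act M (sigma (phi a)) x = act M a x.
Proof.
move=> kM; apply/eqP; rewrite -subr_eq0 -actB kM //.
by rewrite (alghomB hphi) sigmaK subrr.
Qed.

Lemma killed_pull N : killed (pull hphi N).
Proof. by move=> a h x; rewrite /= h act0. Qed.

Lemma killed_onto M (M' : fdmod R) (g : 'Hom(M, M')) :
  mhom g -> limg g = fullv -> killed M -> killed M'.
Proof.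
move=> hg /limg_fullP sg kM a ha y; have [x <-] := sg y.
by rewrite -hg kM // linear0.
Qed.

Lemma mhom_up M N (g : 'Hom(M, N)) : killed M ->
  @mhom _ _ (pull hsigma M) N g -> @mhom _ _ M (pull hphi N) g.
Proof. by move=> kM hg a x; rewrite -killedE //; apply: hg. Qed.

Lemma mhom_down M N (g : 'Hom(M, N)) :
  @mhom _ _ M (pull hphi N) g -> @mhom _ _ (pull hsigma M) N g.
Proof. by move=> hg b x; rewrite [act _ _]/= hg /= sigmaK. Qed.

Lemma mhom_down_l N M (g : 'Hom(N, M)) :
  @mhom _ _ (pull hphi N) M g -> @mhom _ _ N (pull hsigma M) g.
Proof. by move=> hg b x; rewrite /= -hg /= sigmaK. Qed.

Lemma submod_up M U : killed M -> @submod _ _ (pull hsigma M) U -> @submod _ _ M U.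
Proof.
move=> kM /submodP hU; apply/submodP => a x xU.
by rewrite -killedE //; apply: (hU (phi a)).
Qed.

Lemma submod_pull N U : @submod _ _ (pull hphi N) U <-> @submod _ _ N U.
Proof.
split=> /submodP hU; apply/submodP => a x xU; last exact: hU.
by have := hU (sigma a) x xU; rewrite /= sigmaK.
Qed.

Lemma simple_pull N : simple N -> simple (pull hphi N).
Proof. by case=> dN hN; split=> // U /submod_pull; apply: hN. Qed.

Lemma simple_down M : killed M -> simple M -> simple (pull hsigma M).
Proof. by move=> kM [dM hM]; split=> // U /(submod_up kM); apply: hM. Qed.

Lemma simple_up M : simple (pull hsigma M) -> simple M.
Proof. by case=> dM hM; split=> // U hU; apply: hM => a; apply: hU. Qed.

Lemma misom_up M N : killed M -> misom (pull hsigma M) N -> misom M (pull hphi N).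
Proof. by move=> kM [g [hg k0 ff]]; exists g; split=> //; apply: mhom_up. Qed.

Lemma misom_down M N : misom M (pull hphi N) -> misom (pull hsigma M) N.
Proof. by case=> g [hg k0 ff]; exists g; split=> //; apply: mhom_down. Qed.

Lemma projective_down (P : fdmod R) : killed P -> projective P -> projective (pull hsigma P).
Proof.
move=> kP hP M N g f hg gf hf.
have [h hh e] := hP (pull hphi M) (pull hphi N) g f (mhom_pull (hf := hphi) hg) gf (mhom_up kP hf).
by exists h => //; apply: mhom_down.
Qed.

(* c makes M |-> c M a right adjoint of the inflation along phi. *)
Variable c : R.
Hypotheses (phic : phi c = 1) (hc : forall a, c * sigma (phi a) = a * c).

Lemma projective_pull (P : fdmod S) : projective P -> projective (pull hphi P).
Proof.
move=> hP M N g f hg gf hf.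
have [h hh e] := hP (pull hsigma M) (pull hsigma N) g f (mhom_pull (hf := hsigma) hg) gf
   (mhom_down_l hf).
(* [h] is linear only for the action through [sigma]; [hc] moves [a] past [c] as [sigma (phi a)],
   which makes the composite linear over [R]. *)
exists (act M c \o h)%VF.
  by move=> a x; rewrite !comp_lfunE /= hh /= -!actME hc.
apply/lfunP => x; rewrite !comp_lfunE hg; have <- : f x = g (h x) by rewrite -e comp_lfunE.
by rewrite -hf /= phic act1E.
Qed.

Variables (I J : finType) (v : J -> I) (L : I -> fdmod R) (L' : J -> fdmod S).
Variable le : rel I.
Local Notation le' := (relpre v le).
Hypothesis hL : forall j, misom (pull hphi (L' j)) (L (v j)).
Hypothesis Lout : forall i,
  (exists j, v j = i) \/ (exists2 a, phi a = 0 & exists x, act (L i) a x != 0).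
Hypothesis le_refl : reflexive le.

Lemma hL_down j : misom (L' j) (pull hsigma (L (v j))).
Proof. by apply/misom_sym/misom_down/misom_sym/hL. Qed.

Lemma proj_cover_pull j (P : fdmod S) (p : 'Hom(P, L' j)) : proj_cover p ->
  is_proj_at L (v j) (pull hphi P).
Proof.
case=> hP hp pf hU; have [g [hg k0 gf]] := hL j.
exists (g \o p)%VF; split; first exact: projective_pull.
- by apply: mhom_comp => //; apply: mhom_pull.
- by rewrite limg_comp pf.
- by move=> U /submod_pull hU'; rewrite lker_comp_inj //; apply: hU.
Qed.

Lemma proj_cover_down j (P : fdmod R) (p : 'Hom(P, L (v j))) : killed P -> proj_cover p ->
  exists2 g : 'Hom(L (v j), L' j), @mhom _ _ (pull hsigma (L (v j))) (L' j) g &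
   lker g = 0%VS /\ @proj_cover _ _ (pull hsigma P) (L' j) (g \o p)%VF.
Proof.
move=> kP [hP hp pf hU]; have [g [hg k0 gf]] := misom_sym (hL_down j).
exists g => //; split=> //; split.
- exact: projective_down.
- by move=> a x; rewrite !comp_lfunE /= hp hg.
- by rewrite limg_comp pf.
- by move=> U /(submod_up kP) hU'; rewrite lker_comp_inj //; apply: hU.
Qed.

Lemma filtration_up (C : I -> fdmod R -> Prop) (C' : J -> fdmod S -> Prop) M :
    killed M -> (forall j X, C' j X -> C (v j) (pull hphi X)) ->
  forall U s, @filtration _ _ _ C' (pull hsigma M) U s ->
  @filtration _ _ _ C M U (map v s).
Proof.
move=> kM hC U s fs.
have [||||s' fs' es] := @filtration_transport _ _ _ _ hphi _ _ _ id v
  C C' M (pull hsigma M) \1%VF _ _ _ _ _ _ fs.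
- by move=> a x; rewrite !id_lfunE /= killedE.
- by apply/lker_eq0P => x; rewrite id_lfunE.
- by rewrite lim1g.
- by move=> j X CX _; exists (v j); split=> //; apply: hC.
rewrite map_id in es; rewrite -es.
suff <- : (\1%VF @^-1: U)%VS = U by [].
by apply/vspaceP => x; rewrite -memv_preim id_lfunE.
Qed.

Lemma filtration_pull (C : I -> fdmod R -> Prop) (C' : J -> fdmod S -> Prop) N :
    (forall j X, C' j X -> C (v j) (pull hphi X)) ->
  forall U s, @filtration _ _ _ C' N U s ->
  @filtration _ _ _ C (pull hphi N) U (map v s).
Proof.
move=> hC U s fs.
have [||||s' fs' es] := @filtration_transport _ _ _ _ hphi _ _ _ id v
  C C' (pull hphi N) N \1%VF _ _ _ _ _ _ fs.
- by move=> a x; rewrite !id_lfunE.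
- by apply/lker_eq0P => x; rewrite id_lfunE.
- by rewrite lim1g.
- by move=> j X CX _; exists (v j); split=> //; apply: hC.
rewrite map_id in es; rewrite -es.
suff <- : (\1%VF @^-1: U)%VS = U by [].
by apply/vspaceP => x; rewrite -memv_preim id_lfunE.
Qed.

Lemma simple_at_pull j X : is_simple_at L' j X -> is_simple_at L (v j) (pull hphi X).
Proof. by move=> hX; apply: misom_trans (misom_pull hphi hX) (hL j). Qed.

(** A composition factor of a module killed by the kernel of [phi] is killed as well, so by [Lout]
    it is a simple module at some [v k]. *)
Lemma factors_below_down j M : killed M ->
  factors_below L le (v j) M -> factors_below L' le' j (pull hsigma M).
Proof.
move=> kM [s fs als].
have [||||s' fs' es] := @filtration_transport _ _ _ _ hsigma _ _ _ v id
  (is_simple_at L') (is_simple_at L) (pull hsigma M) M \1%VF _ _ _ _ _ _ fs.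
- by move=> a x; rewrite !id_lfunE.
- by apply/lker_eq0P => x; rewrite id_lfunE.
- by rewrite lim1g.
- move=> i X hX kX; have [[k ek]|[a ha [x]]] := Lout i.
    subst i; exists k; split=> //; apply: misom_trans (misom_sym (hL_down k)).
    exact: misom_pull.
  have [g [hg _ /limg_fullP gf]] := hX; have [y <-] := gf x.
  by rewrite -hg kX ?linear0 ?eqxx // => z; apply: kM.
exists s'.
  suff <- : (\1%VF @^-1: fullv)%VS = fullv :> {vspace M} by [].
  by apply/vspaceP => x; rewrite -memv_preim id_lfunE.
by rewrite map_id in es; move: als; rewrite -es all_map.
Qed.

Lemma factors_below_pull j N :
  factors_below L' le' j N -> factors_below L le (v j) (pull hphi N).
Proof.
case=> s fs als; exists (map v s); last by rewrite all_map.
by apply: filtration_pull fs => k X; apply: simple_at_pull.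
Qed.

(** A quotient of an inflated module is inflated, so every competing quotient over [R] descends to
    [S]. *)
Lemma largest_quotient_pull j (P D : fdmod S) (q : 'Hom(P, D)) :
  largest_quotient L' le' j q ->
  @largest_quotient _ _ _ L le (v j) (pull hphi P) (pull hphi D) q.
Proof.
case=> hq qf fD hD; split; [exact: mhom_pull|by []|exact: factors_below_pull|].
move=> X q' hq' q'f fX; have kX : killed X := killed_onto hq' q'f (@killed_pull P).
apply: (hD (pull hsigma X) q') => //; first exact: mhom_down_l.
exact: factors_below_down.
Qed.

Lemma largest_quotient_down j (P D : fdmod R) (q : 'Hom(P, D)) : killed P ->
  largest_quotient L le (v j) q ->
  @largest_quotient _ _ _ L' le' j (pull hsigma P) (pull hsigma D) q.
Proof.
move=> kP [hq qf fD hD]; have kD := killed_onto hq qf kP.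
split; [exact: mhom_pull|by []|exact: factors_below_down|].
move=> X q' hq' q'f fX; apply: (hD (pull hphi X) q') => //; first exact: mhom_up.
exact: factors_below_pull.
Qed.

Lemma is_standard_pull j D :
  is_standard L' le' j D -> is_standard L le (v j) (pull hphi D).
Proof.
case=> P [q [[p hp] hq]]; exists (pull hphi P), q; split.
  exact: proj_cover_pull hp.
exact: largest_quotient_pull.
Qed.

(** Once the projective cover is killed by the kernel of [phi], the whole test situation at [v j]
    descends to [S]; the filtrations found there are inflated back. *)
Lemma quasi_hereditary_up j (P D : fdmod R) (p : 'Hom(P, L (v j))) (q : 'Hom(P, D))
    (r : 'Hom(D, L (v j))) :
    quasi_hereditary L' le' -> killed P ->
    proj_cover p -> largest_quotient L le (v j) q -> mhom r -> p = (r \o q)%VF ->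
    injective v ->
  (exists2 s, @filtration _ _ _ (is_standard L le) P (lker q) s & all (slt le (v j)) s) /\
  (exists2 s, @filtration _ _ _ (is_simple_at L) D (lker r) s
            & all (fun k => slt le k (v j)) s).
Proof.
move=> qh kP hp hq hr pE vinj.
have [g hg [g0 hgp]] := proj_cover_down kP hp.
have hq' := largest_quotient_down kP hq.
have kD : killed D by case: hq => hq qf _ _; apply: killed_onto qf kP.
have hr' : @mhom _ _ (pull hsigma D) (L' j) (g \o r)%VF.
  by move=> a x; rewrite !comp_lfunE /= hr hg.
have e : ((g \o p) = (g \o r) \o q)%VF by rewrite pE comp_lfunA.
have [[s fs als] [t ft alt]] := qh _ _ _ _ _ _ hgp hq' hr' e.
have kgr : lker (g \o r) = lker r by apply: lker_comp_inj.
split.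
  exists (map v s); first by apply: filtration_up fs => // k X; apply: is_standard_pull.
  by rewrite all_map; apply: sub_all als => k; rewrite /slt /= (inj_eq vinj).
exists (map v t).
  by rewrite -kgr; apply: filtration_up ft => // k X; apply: simple_at_pull.
by rewrite all_map; apply: sub_all alt => k; rewrite /slt /= (inj_eq vinj).
Qed.

Lemma standard_simple_up j (P D : fdmod R) (p : 'Hom(P, L (v j))) (q : 'Hom(P, D)) :
    (forall i X, is_standard L' le' i X -> simple X) -> killed P ->
    proj_cover p -> largest_quotient L le (v j) q -> simple D.
Proof.
move=> hs kP hp hq; apply/simple_up/(hs j).
exists (pull hsigma P), q; split; last exact: largest_quotient_down.
by have [g _ [_ hgp]] := proj_cover_down kP hp; exists (g \o p)%VF.
Qed.

End Retract.

Lemma proj_cover_central (K : fieldType) (R : falgType K) (P M : fdmod R)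
    (p : 'Hom(P, M)) (f : R) :
    (forall a, f * a = a * f) -> f * f = f -> (forall x, act M f x = 0) ->
    proj_cover p -> forall x, act P f x = 0.
Proof.
move=> fC ff fM [_ hp _ hU] x.
have hU1 : submod (lker (act P f)).
  apply/submodP => a y; rewrite !memv_ker -actME fC actME => /eqP ->.
  by rewrite linear0.
have /vspaceP/(_ x) : lker (act P f) = fullv.
  apply: (hU _ hU1); apply/vspaceP => y; rewrite memvf.
  have -> : y = act P (1 - f) y + act P f y by rewrite -actD subrK act1E.
  apply: memv_add; rewrite memv_ker; last by rewrite hp fM.
  by rewrite -actME mulrBr mulr1 ff subrr act0.
by rewrite memvf memv_ker => /eqP.
Qed.

(** * Tensor products *)

Section Tensor.
Variables (K : fieldType) (A : falgType K) (B : {aspace A}).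
Local Notation Bt := (subvs_of B).
Implicit Types (M N X : fdmod Bt) (Y : fdmod A).

Lemma pure_is_linear M a : linear (pure (M := M) a).
Proof. by move=> k x y; rewrite /pure !linearP. Qed.

Lemma pure0r M a : pure (M := M) a 0 = 0.
Proof. by rewrite /pure !linear0. Qed.

Lemma pureDl M a b x : pure (M := M) (a + b) x = pure a x + pure b x.
Proof. by have := pure_linearl x 1 a b; rewrite !scale1r. Qed.

Lemma tens_lift M (W : vectType K) (g : A -> M -> W) :
    (forall m, linear (g^~ m)) -> (forall a, linear (g a)) ->
    (forall a (b : Bt) m, g (a * vsval b) m = g a (act M b m)) ->
  exists h : 'Hom(tens M, W), forall a m, h (pure a m) = g a m.
Proof. by move=> h1 h2 h3; have [h [hE _]] := tens_universal h1 h2 h3; exists h. Qed.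

Lemma tens_act_pureE M a b x : act (tens M) a (pure b x) = pure (a * b) x.
Proof. exact: tens_act_pure. Qed.

Lemma pure_act1 M a x : pure (M := M) a x = act (tens M) a (pure 1 x).
Proof. by rewrite tens_act_pureE mulr1. Qed.

Lemma tens_mhom M Y (h : 'Hom(tens M, Y)) :
  (forall a x, h (pure a x) = act Y a (h (pure 1 x))) -> mhom h.
Proof.
move=> hh a; have E b x : h (act (tens M) a (pure b x)) = act Y a (h (pure b x)).
  by rewrite tens_act_pureE hh [h (pure b x)]hh actME.
suff /lfunP {}E : (h \o act (tens M) a = act Y a \o h)%VF.
  by move=> x; have := E x; rewrite !comp_lfunE.
by apply: tens_ext => b x; rewrite comp_lfunE [RHS]comp_lfunE; apply: E.
Qed.

Lemma tens_mhom_ext M Y (h h' : 'Hom(tens M, Y)) : mhom h -> mhom h' ->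
  (forall x, h (pure 1 x) = h' (pure 1 x)) -> h = h'.
Proof.
by move=> mh mh' e; apply: tens_ext => a x; rewrite pure_act1 mh mh' e.
Qed.

Lemma tens_map_mhom M N (f : 'Hom(M, N)) : mhom f -> mhom (tens_map f).
Proof.
by move=> hf; apply: tens_mhom => a x; rewrite !tens_map_pure // pure_act1.
Qed.

Lemma tens_map_comp M N X (f : 'Hom(M, N)) (g : 'Hom(N, X)) : mhom f -> mhom g ->
  tens_map (g \o f)%VF = (tens_map g \o tens_map f)%VF.
Proof.
move=> hf hg; apply: tens_ext => a x; rewrite [RHS]comp_lfunE !tens_map_pure //.
  by rewrite comp_lfunE.
exact: mhom_comp.
Qed.

Lemma tens_map0 M N : tens_map (0 : 'Hom(M, N)) = 0.
Proof.
apply: tens_ext => a x; rewrite tens_map_pure ?zero_lfunE ?pure0r //.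
exact: mhom0.
Qed.

(** The projection onto the cokernel kills all pure tensors, hence vanishes. *)
Lemma tens_map_onto M N (f : 'Hom(M, N)) : mhom f -> limg f = fullv ->
  limg (tens_map f) = fullv.
Proof.
move=> hf /limg_fullP sf; set U := limg _.
suff e : qproj U = 0.
  apply/vspaceP => x; rewrite memvf -(lker_qproj U) memv_ker e zero_lfunE.
  by rewrite eqxx.
apply: tens_ext => a x; rewrite zero_lfunE; have [y <-] := sf x.
by rewrite -tens_map_pure // qproj_eq0 // memv_img ?memvf.
Qed.

Hypothesis B1 : 1 \in B.

Lemma alghom_vsval : alghom (@vsval K A B).
Proof.
by split=> [||a b] //; rewrite -[LHS]/(algid B); apply/eqP; rewrite algid_eq1.
Qed.

Definition res_to Y : fdmod Bt := pull alghom_vsval Y.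

Lemma tens_adj M Y (g : 'Hom(M, res_to Y)) : mhom g ->
  exists2 h : 'Hom(tens M, Y), mhom h & forall a x, h (pure a x) = act Y a (g x).
Proof.
move=> hg; have [|||h hE] := @tens_lift M Y (fun a x => act Y a (g x)).
- by move=> m k a b; rewrite actD actZ.
- by move=> a k x y; rewrite !linearP.
- by move=> a b m; rewrite hg /= actME.
exists h => //; apply: tens_mhom => a x; by rewrite !hE act1E.
Qed.

Lemma unit_linear M Y (h : 'Hom(tens M, Y)) :
  exists g : 'Hom(M, Y), forall x, g x = h (pure 1 x).
Proof. by apply: linear_hom => k x y; rewrite pure_is_linear linearP. Qed.

Lemma tens_coadj M Y (h : 'Hom(tens M, Y)) : mhom h ->
  exists2 g : 'Hom(M, res_to Y), mhom g & forall x, g x = h (pure 1 x).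
Proof.
move=> hh; have [g gE] := unit_linear h; exists g => // b x.
rewrite !gE /= -hh; congr (h _).
by rewrite tens_act_pureE mulr1 -(pure_balanced 1) mul1r.
Qed.

Lemma tens_projective M : projective M -> projective (tens M).
Proof.
move=> hM X Y g f hg gf hf; have [f' hf' f'E] := tens_coadj hf.
have [h hh e] := hM (res_to X) (res_to Y) g f' (mhom_pull (hf := alghom_vsval) hg) gf hf'.
have [h' hh' h'E] := tens_adj hh; exists h' => //.
apply: tens_mhom_ext => //; first exact: mhom_comp.
move=> x; rewrite comp_lfunE h'E act1E -f'E -e comp_lfunE //.
Qed.

Hypothesis hex : tens_exact B.

Lemma tens_map_inj M N (f : 'Hom(M, N)) : mhom f -> lker f = 0%VS ->
  lker (tens_map f) = 0%VS.
Proof.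
move=> hf f0; have hI := submod_img hf.
by have [|] := hex hf (mhom_proj hI) f0 _ (fdproj_onto hI); rewrite ?fdproj_ker.
Qed.

(** [tens_exact] speaks of short exact sequences only, so [f] and [g] are factored through their
    images. *)
Lemma tens_map_exact M N X (f : 'Hom(M, N)) (g : 'Hom(N, X)) :
  mhom f -> mhom g -> limg f = lker g -> limg (tens_map f) = lker (tens_map g).
Proof.
move=> hf hg e; have hI := submod_img hf; have hK := submod_ker hg.
have [f' [hf' f'E f'C]] := mhom_restr hI hf (subvv _).
have hIX := submod_img hg.
have [g' [hg' g'E g'C]] := mhom_restr hIX hg (subvv _).
have f'f : limg f' = fullv.
  apply/limg_fullP => y; have /memv_imgP[x _ yE] : vsval y \in limg f by apply: subvsP.
  by exists x; apply: val_inj; rewrite [LHS]f'E.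
have g'f : limg g' = fullv.
  apply/limg_fullP => y; have /memv_imgP[x _ yE] : vsval y \in limg g by apply: subvsP.
  by exists x; apply: val_inj; rewrite [LHS]g'E.
have i0 (V : fdmod Bt) (U : {vspace V}) (hU : submod U) : lker (fdincl hU) = 0%VS.
  by apply/lker_eq0P => x; apply: fdincl_inj.
have kg' : lker g' = lker g by rewrite -[RHS](congr1 (@lker _ _ _) g'C) lker_comp_inj.
have [|_ e' _] := hex (@mhom_incl _ _ _ _ hI) hg' (i0 _ _ _) _ g'f.
  by rewrite fdincl_img kg'.
have t0 := tens_map_inj (@mhom_incl _ _ _ _ hIX) (i0 _ _ _).
transitivity (limg (tens_map (fdincl hI \o f'))); first by rewrite f'C.
transitivity (lker (tens_map (fdincl hIX \o g'))); last by rewrite g'C.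
rewrite !tens_map_comp //; try exact: mhom_incl.
by rewrite lker_comp_inj // limg_comp tens_map_onto.
Qed.

End Tensor.

(** * Exact Borel subalgebras of split basic algebras *)

(** The form in which [A] and its quotients [A_l] enter the Borel argument: one-dimensional simple
    modules with characters [chi], whose common kernel is nilpotent. It spares a quiver presentation
    of the quotients. *)
Record split_basic (K : fieldType) (A : falgType K) (I : finType)
    (L : I -> fdmod A) (chi : I -> A -> K) (e : I -> A) (rad : {vspace A}) : Prop :=
  SplitBasic {
    chi_lin : forall i k a b, chi i (k *: a + b) = k * chi i a + chi i b;
    chi1 : forall i, chi i 1 = 1;
    chiM : forall i a b, chi i (a * b) = chi i a * chi i b;
    chi_act : forall i a x, act (L i) a x = chi i a *: x;
    chi_e : forall i j, chi i (e j) = (i == j)%:R;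
    L_neq0 : forall i, exists x : L i, x != 0;
    L_line : forall i (x y : L i), x != 0 -> exists k, y = k *: x;
    radE : forall a, a \in rad <-> forall i, chi i a = 0;
    rad_nil : exists m, (rad ^+ m)%VS = 0%VS
  }.

Section SplitBasic.
Variables (K : fieldType) (A : falgType K) (I : finType) (L : I -> fdmod A).
Variables (chi : I -> A -> K) (e : I -> A) (rad : {vspace A}).
Hypothesis hA : split_basic L chi e rad.
Variable le : rel I.
Hypothesis le_refl : reflexive le.

Lemma chi0 i : chi i 0 = 0.
Proof. by have := chi_lin hA i (-1) 1 1; rewrite scaleN1r addNr => ->; rewrite mulN1r addNr. Qed.

Lemma chiD i a b : chi i (a + b) = chi i a + chi i b.
Proof. by have := chi_lin hA i 1 a b; rewrite scale1r mul1r. Qed.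

Lemma chiZ i k a : chi i (k *: a) = k * chi i a.
Proof. by have := chi_lin hA i k a 0; rewrite chi0 !addr0. Qed.

Lemma chiB i a b : chi i (a - b) = chi i a - chi i b.
Proof. by rewrite chiD -scaleN1r chiZ mulN1r. Qed.

Lemma chiX i a n : chi i (a ^+ n) = chi i a ^+ n.
Proof. by elim: n => [|n IH]; rewrite ?(chi1 hA) // !exprS (chiM hA) IH. Qed.

Lemma chi_sum i (J : finType) (F : J -> A) :
  chi i (\sum_j F j) = \sum_j chi i (F j).
Proof. exact: (big_morph _ (chiD i) (chi0 i)). Qed.

Lemma simple_split i : simple (L i).
Proof.
have [x xn0] := L_neq0 hA i; split.
  rewrite lt0n dimv_eq0; apply: contraNneq xn0 => h.
  by rewrite -memv0 -h memvf.
move=> U hU; have [U0|Un0] := eqVneq U 0%VS; [by left | right].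
have yn0 : vpick U != 0 by rewrite vpick0.
apply/vspaceP => z; rewrite memvf.
by have [k ->] := L_line hA z yn0; rewrite memvZ // memv_pick.
Qed.

Lemma proj_cover_generator i (P : fdmod A) (p : 'Hom(P, L i)) : proj_cover p ->
  exists z, forall y, exists a, y = act P a (act P (e i) z).
Proof.
case=> _ hp /limg_fullP pf hU; have [x0 x0n] := L_neq0 hA i.
have [z pz] := pf x0; exists z.
have [F FE] := linear_hom (act_linear_fun (act P (e i) z)).
have hF : limg F = fullv.
  apply: hU; first by apply/submodP => a _ /memv_imgP[b _ ->]; rewrite FE -actME -FE memv_img ?memvf.
  apply/vspaceP => y; rewrite memvf.
  have [k pk] := L_line hA (p y) x0n.
  rewrite -[y](subrKC (k *: act P (e i) z)); apply: memv_add.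
    by rewrite -[X in _ *: X]act1E -actZ -FE memv_img ?memvf.
  by rewrite memv_ker linearB linearZ /= hp (chi_act hA) (chi_e hA) eqxx scale1r pz pk subrr.
by move=> y; have [a <-] := (limg_fullP _).1 hF y; exists a; rewrite FE.
Qed.

Lemma standard_generator i (D : fdmod A) : is_standard L le i D ->
  exists z, forall y, exists a, y = act D a (act D (e i) z).
Proof.
case=> P [q [[p hp] [hq qf _ _]]]; have [z hz] := proj_cover_generator hp.
exists (q z) => y; have [x <-] := (limg_fullP _).1 qf y.
by have [a ->] := hz x; exists a; rewrite !hq.
Qed.

(* The hypothesis on g says that it maps U to copies of the simple module at v,
   which is not a quotient of the other standard modules. *)
Lemma filtration_hom_eq0 v (P : fdmod A) (U : {vspace P}) s (W : vectType K)
    (g : 'Hom(P, W)) :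
    filtration (is_standard L le) U s -> v \notin s ->
    (forall a x, x \in U -> g (act P a x) = chi v a *: g x) ->
  forall x, x \in U -> g x = 0.
Proof.
elim=> {U s} [_ _ x|U V X i s fU IH hV [f [hf fV fU']] CX].
  by rewrite memv0 => /eqP ->; rewrite linear0.
rewrite inE negb_or => /andP[vi vs] hg x xV.
have UV : {subset U <= V} by move=> y; rewrite -fU' memv_cap => /andP[].
have {}IH := IH vs (fun a y yU => hg a y (UV y yU)).
(* Modulo [U], where [g] vanishes by induction, [V] is generated by some [e i z], and [g] multiplies
   it by [chi v (e i) = 0]. *)
have [z0 hz] := standard_generator CX.
have : z0 \in (f @: V)%VS by rewrite fV memvf.
case/memv_imgP=> z zV zE; rewrite {}zE in hz.
have [a fx] := hz (f x).
have ezV : act P (e i) z \in V by apply: (submodP _).1.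
have aezV : act P a (act P (e i) z) \in V by apply: (submodP _).1.
have xU : x - act P a (act P (e i) z) \in U.
  by rewrite -fU' memv_cap andbC memvB // memv_ker linearB /= !hf // fx subrr.
have /eqP := IH _ xU; rewrite linearB subr_eq0 /= => /eqP ->.
by rewrite !hg // (chi_e hA) (negbTE vi) scale0r scaler0.
Qed.

Variables (v : I).
Hypothesis hv : forall a, a * e v = chi v a *: e v.
Hypothesis v_min : forall u P m,
  is_proj_at L u P -> standard_mult L le P v m -> (0 < m)%N -> u = v.
Hypothesis qh : quasi_hereditary L le.

(** By [hv] the left ideal [A e_v] is a line, so the generator [e_v z] already spans [D]. *)
Lemma standard_at_v (D : fdmod A) a x : is_standard L le v D -> act D a x = chi v a *: x.
Proof.
move=> hD; have [z hz] := standard_generator hD.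
have evE b : act D b (act D (e v) z) = chi v b *: act D (e v) z.
  by rewrite -actME hv actZ.
by have [b ->] := hz x; rewrite evE linearZ /= evE !scalerA mulrC.
Qed.

Variables (B : {aspace A}) (LB : I -> fdmod (subvs_of B)).
Hypothesis hB : exact_borel L le LB.

Let B1 : 1 \in B. Proof. by case: hB. Qed.

(* The unit L_B(j) -> A (x) L_B(j) followed by the projection of
   Delta(j) = A (x) L_B(j) onto its top identifies L_B(j) with the restriction
   of L(j) to B. *)
Lemma borel_top j : exists2 r : 'Hom(tens (LB j), L j), mhom r &
  forall y, y != 0 -> r (pure 1 y) != 0.
Proof.
have [_ [[simB _ _] _ _] _ stB] := hB.
have [P [q [[p hp] hq]]] := stB j.
have [r hr pE] := standard_top le_refl hp hq; exists r => // y yn0.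
have [u hu uE] := tens_coadj B1 hr.
have [x xn0] := L_neq0 hA j; have [_ _ /limg_fullP pf _] := hp.
have [z pz] := pf x.
case: (classic (exists y, u y != 0)) => [[y' hy']|h].
  have /lker_eq0P u0 := simple_hom_inj (simB j) hu hy'.
  by rewrite -uE; apply: contraNneq yn0 => /u0 ->.
case/eqP: xn0; rewrite -pz pE.
rewrite (_ : r = 0) ?comp_lfunE ?zero_lfunE //.
apply: tens_mhom_ext => //; first exact: mhom0.
move=> y'; rewrite zero_lfunE -uE; apply/eqP/negPn/negP => hy'.
by case: h; exists y'.
Qed.

(** The map [y |-> r (pure 1 y)] of [borel_top] is an injective [B]-map into the line [L j], which
    transfers dimension and character. *)
Lemma borel_line j : exists w : LB j, [/\ w != 0,
  exists lam : 'Hom(LB j, K^o), forall y, y = (lam y : K) *: w &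
  forall b y, act (LB j) b y = chi j (vsval b) *: y].
Proof.
have [r hr rn0] := borel_top j.
have [u hu uE] := tens_coadj B1 hr.
have u0 y : u y = 0 -> y = 0.
  by move=> uy; apply/eqP; apply: contraT => /rn0; rewrite -uE uy eqxx.
have [_ [[simB _ _] _ _] _ _] := hB.
have [w wn0] : exists w : LB j, w != 0.
  have [dB _] := simB j; exists (vpick {:LB j}); rewrite vpick0.
  by apply: contraTneq dB => ->; rewrite dimv0.
have line y : exists k, y = k *: w.
  have [|k hk] := L_line hA (x := u w) (u y); first by rewrite uE rn0.
  exists k; apply/eqP; rewrite -subr_eq0; apply/eqP/u0.
  by rewrite linearB linearZ /= hk subrr.
exists w; split=> //.
  exact: line_coord.
move=> b y; apply/eqP; rewrite -subr_eq0; apply/eqP/u0.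
by rewrite linearB linearZ /= hu /= (chi_act hA) subrr.
Qed.

(* A cocycle delta is an extension of the simple B-module at p by the one at
   q; it splits as soon as the induced extension of Delta(p) by Delta(q) is
   split over B. *)
Section Extension.
Variables (p q : I) (delta : A -> K).
Hypothesis dlin : forall k a b, delta (k *: a + b) = k * delta a + delta b.
Hypothesis dM : forall a b, a \in B -> b \in B ->
  delta (a * b) = chi q a * delta b + delta a * chi p b.

Let X : vectType K := (K^o * K^o)%type.

Let xact_fun (b : subvs_of B) (x : X) : X :=
  (chi p (vsval b) * x.1, chi q (vsval b) * x.2 + delta (vsval b) * x.1).

Let xact_lin b : linear (xact_fun b).
Proof.
move=> k [x1 x2] [y1 y2]; set P := chi p (vsval b); set Q := chi q (vsval b).
set D := delta (vsval b); move: x1 x2 y1 y2; rewrite /= -/K => x1 x2 y1 y2.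
have E1 : P * (k * x1 + y1) = k * (P * x1) + P * y1 by ring.
have E2 : Q * (k * x2 + y2) + D * (k * x1 + y1)
        = k * (Q * x2 + D * x1) + (Q * y2 + D * y1) by ring.
exact: (congr2 pair E1 E2).
Qed.

Let xact b : 'End(X) :=
  proj1_sig (constructive_indefinite_description _ (linear_hom (xact_lin b))).

Let xactE b x : xact b x = xact_fun b x.
Proof. by rewrite /xact; case: (constructive_indefinite_description _ _) => F /= ->. Qed.

Let xact_linear : linear xact.
Proof.
move=> k a b; apply/lfunP => -[x1 x2].
rewrite add_lfunE scale_lfunE !xactE /xact_fun /= !(chi_lin hA) dlin.
set P := chi p (vsval a); set P' := chi p (vsval b).
set Q := chi q (vsval a); set Q' := chi q (vsval b).
set D := delta (vsval a); set D' := delta (vsval b).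
have E1 : (k * P + P') * x1 = k * (P * x1) + P' * x1 by ring.
have E2 : (k * Q + Q') * x2 + (k * D + D') * x1
        = k * (Q * x2 + D * x1) + (Q' * x2 + D' * x1) by ring.
exact: (congr2 pair E1 E2).
Qed.

Let xact1 : xact 1 = \1%VF.
Proof.
have v1 : vsval (1 : subvs_of B) = 1 by case: (alghom_vsval B1).
have d1 : delta 1 = 0.
  have := dM B1 B1; rewrite mulr1 !(chi1 hA) mul1r mulr1 => /eqP.
  by rewrite -subr_eq0 opprD addNKr oppr_eq0 => /eqP.
apply/lfunP => -[x1 x2]; rewrite id_lfunE xactE /xact_fun v1 /= !(chi1 hA) d1.
by rewrite !mul1r mul0r addr0.
Qed.

Let xactM a b : xact (a * b) = (xact a \o xact b)%VF.
Proof.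
apply/lfunP => -[x1 x2]; rewrite comp_lfunE !xactE /xact_fun /= !(chiM hA) dM ?subvsP //.
set P := chi p (vsval a); set P' := chi p (vsval b).
set Q := chi q (vsval a); set Q' := chi q (vsval b).
set D := delta (vsval a); set D' := delta (vsval b).
have E1 : P * P' * x1 = P * (P' * x1) by ring.
have E2 : Q * Q' * x2 + (Q * D' + D * P') * x1
        = Q * (Q' * x2 + D' * x1) + D * (P' * x1) by ring.
exact: (congr2 pair E1 E2).
Qed.

Let Xm : fdmod (subvs_of B) := FDMod xact_linear xact1 xactM.

(** Realized on [K * K], with [b] acting by the triangular matrix with diagonal [chi p b], [chi q b]
    and corner entry [delta b]; the record keeps only what the splitting argument uses. *)
Record extension : Type := Extension {
  ext_mod : fdmod (subvs_of B);
  ext_incl : 'Hom(LB q, ext_mod);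
  ext_proj : 'Hom(ext_mod, LB p);
  ext_gen : ext_mod; ext_bot : LB q; ext_top : LB p;
  ext_incl_hom : mhom ext_incl; ext_proj_hom : mhom ext_proj;
  ext_incl_inj : lker ext_incl = 0%VS;
  ext_exact : limg ext_incl = lker ext_proj;
  ext_proj_onto : limg ext_proj = fullv;
  ext_bot_neq0 : ext_bot != 0;
  ext_projE : ext_proj ext_gen = ext_top;
  ext_gen_act : forall b, act ext_mod b ext_gen =
    chi p (vsval b) *: ext_gen + delta (vsval b) *: ext_incl ext_bot
}.

Lemma extension_exists : inhabited extension.
Proof.
have [wq [wqn0 [lam lamE] actq]] := borel_line q.
have [wp [wpn0 [mu muE] actp]] := borel_line p.
have lam1 : lam wq = 1.
  by apply: (scaler_neq0_inj wqn0); rewrite -lamE scale1r.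
have [|i iE] := @linear_hom K (LB q) Xm (fun y => (0, lam y) : X).
  move=> k x y; have E1 : (0 : K) = k * 0 + 0 by ring.
  exact: (congr2 pair E1 (linearP lam k x y)).
have [|g gE] := @linear_hom K Xm (LB p) (fun x : X => (x.1 : K) *: wp).
  by move=> k x y /=; rewrite scalerDl scalerA.
have /(_ i g) F := @Extension Xm _ _ ((1, 0) : X) wq wp.
constructor; apply: F => //.
- move=> b y; rewrite !iE actq /= xactE /xact_fun /=.
  have E1 : (0 : K) = chi p (vsval b) * 0 by rewrite mulr0.
  have E2 : lam (chi q (vsval b) *: y) = chi q (vsval b) * lam y + delta (vsval b) * 0 :> K.
    by rewrite linearZ mulr0 addr0.
  exact: (congr2 pair E1 E2).
- move=> b [x1 x2]; rewrite !gE /= xactE /xact_fun /= actp.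
  by rewrite scalerA.
- by apply/lker_eq0P => y; rewrite iE => -[ly]; rewrite [y]lamE ly scale0r.
- apply/exactP; split=> [y|[x1 x2]]; first by rewrite gE iE /= scale0r.
  rewrite gE /= => /eqP; rewrite scaler_eq0 (negbTE wpn0) orbF => /eqP ->.
  exists (x2 *: wq); rewrite iE linearZ /= lam1.
  exact: (congr2 pair (erefl (0 : K)) (mulr1 (x2 : K))).
- by apply/limg_fullP => y; exists ((mu y, 0) : X); rewrite gE -muE.
- by rewrite gE scale1r.
- move=> b; rewrite /= xactE /xact_fun /= iE lam1.
  have E1 : chi p (vsval b) * 1 = chi p (vsval b) * 1 + delta (vsval b) * 0 by ring.
  have E2 : chi q (vsval b) * 0 + delta (vsval b) * 1
          = chi p (vsval b) * 0 + delta (vsval b) * 1 by ring.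
  exact: (congr2 pair E1 E2).
Qed.

(** [pure 1 (ext_gen E) - z0] comes from an element [z] of the standard module at [q]. If the image
    of [z] in the top [L q] is [t] times that of the generator, letting [b] act on [z] gives
    [chi q b * t = chi p b * t + delta b]. *)
Lemma extension_split (E : extension) (z0 : tens (ext_mod E)) :
    tens_map (ext_proj E) z0 = pure 1 (ext_top E) ->
    (forall b, b \in B -> act (tens (ext_mod E)) b z0 = chi p b *: z0) ->
  exists t, forall b, b \in B -> delta b = t * (chi q b - chi p b).
Proof.
case: E z0 => X' i g x0 wq wp hi hg i0 ex gf wqn0 /= gx0 actx z0 gz0 bz0.
have [_ _ hex _] := hB.
have ti := tens_map_inj hex hi i0.
have [_ te] := (exactP _ _).1 (tens_map_exact hex hi hg ex).
have [z zE] : exists z, tens_map i z = pure 1 x0 - z0.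
  by apply: te; rewrite linearB /= gz0 tens_map_pure // gx0 subrr.
have [r hr rn0] := borel_top q.
have [t rz] := L_line hA (r z) (rn0 _ wqn0).
exists t => b bB; pose b' : subvs_of B := Subvs bB.
have e1 : act (tens (LB q)) b z = chi p b *: z + delta b *: pure 1 wq.
  apply/eqP; rewrite -subr_eq0; apply/eqP/((lker_eq0P _).1 ti).
  rewrite linearB linearD !linearZ /= (tens_map_mhom hi) tens_map_pure // zE.
  rewrite linearB /= bz0 // tens_act_pureE mulr1 -[b]/(vsval b') -[vsval b']mul1r.
  rewrite pure_balanced actx mul1r /= scalerBr.
  have -> c d (x y : X') : pure (M := X') 1 (c *: x + d *: y) = c *: pure 1 x + d *: pure 1 y.
    by rewrite pure_is_linear -[d *: y]addr0 pure_is_linear pure0r addr0.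
  by apply/eqP; rewrite subr_eq0 addrAC.
have := congr1 r e1; rewrite hr linearD !linearZ /= (chi_act hA) rz !scalerA.
rewrite -scalerDl => /(scaler_neq0_inj (rn0 _ wqn0)) /eqP.
by rewrite addrC -subr_eq => /eqP <-; rewrite mulrBr mulrC [chi p b * _]mulrC.
Qed.

End Extension.

Lemma extension_top_v q (delta : A -> K) :
    (forall k a b, delta (k *: a + b) = k * delta a + delta b) ->
    (forall a b, a \in B -> b \in B ->
       delta (a * b) = chi q a * delta b + delta a * chi v b) ->
  exists t, forall b, b \in B -> delta b = t * (chi q b - chi v b).
Proof.
move=> dlin dM; have [E] := extension_exists dlin dM.
have [_ _ _ stB] := hB.
(* The lift is [e v] applied to the generator: as [A e_v] is a line, [B] acts on it through [chi v],
   and [e v] acts as 1 on the standard module at [v]. *)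
apply: (@extension_split _ _ _ E (act (tens (ext_mod E)) (e v) (pure 1 (ext_gen E)))).
  rewrite (tens_map_mhom (@ext_proj_hom _ _ _ E)) tens_map_pure ?ext_projE; last exact: (@ext_proj_hom _ _ _ E).
  by rewrite (standard_at_v _ _ (stB v)) (chi_e hA) eqxx scale1r.
by move=> b _; rewrite -actME hv actZ.
Qed.

(** The map of [P] onto the standard module at [p] lifts to [h] into the induced extension. On the
    kernel, [h] takes values in the standard module at [v], which has no counterpart in the
    filtration of that kernel; so [h] vanishes there and yields the splitting. *)
Lemma extension_sub_v p (delta : A -> K) : p != v ->
    (forall k a b, delta (k *: a + b) = k * delta a + delta b) ->
    (forall a b, a \in B -> b \in B ->
       delta (a * b) = chi v a * delta b + delta a * chi p b) ->
  exists t, forall b, b \in B -> delta b = t * (chi v b - chi p b).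
Proof.
move=> pv dlin dM; have [E] := extension_exists dlin dM.
have [_ _ hex stB] := hB.
have [P [q [[pi hpi] hq]]] := stB p.
have [r hr piE] := standard_top le_refl hpi hq.
have [[s fs als] _] := qh hpi hq hr piE.
have [hqh qf _ _] := hq; have [Pproj _ _ _] := hpi.
have tg := tens_map_mhom (@ext_proj_hom _ _ _ E).
have [h hh hE] := Pproj _ _ _ _ tg (tens_map_onto (@ext_proj_hom _ _ _ E) (ext_proj_onto E)) hqh.
(* An occurrence of [v] would make the multiplicity of the standard module at [v] in [P] positive,
   and minimality would force [p = v]. *)
have vs : v \notin s.
  apply/negP => vs; case/eqP: pv; apply: (v_min (P := P) (m := count_mem v (p :: s))).
  - by exists pi.
  - exists (p :: s) => //; apply: filtration_cons fs _ _ (stB p).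
      by apply/submodP => *; rewrite memvf.
    exists q; split=> //; first by move=> a x _; apply: hqh.
    by rewrite capvf.
  - by rewrite -has_count has_pred1 inE vs orbT.
have [_ te] := (exactP _ _).1 (tens_map_exact hex (@ext_incl_hom _ _ _ E) (@ext_proj_hom _ _ _ E) (ext_exact E)).
have h0 x : x \in lker q -> h x = 0.
  apply: (filtration_hom_eq0 fs vs) => a y; rewrite memv_ker => /eqP qy.
  have [z zE] : exists z, tens_map (ext_incl E) z = h y.
    by apply: te; rewrite -qy -hE comp_lfunE.
  by rewrite hh -zE -(tens_map_mhom (@ext_incl_hom _ _ _ E)) (standard_at_v _ _ (stB v)) linearZ.
have [y yE] := (limg_fullP _).1 qf (pure 1 (ext_top E)).
apply: (@extension_split _ _ _ E (h y)); first by rewrite -yE -hE comp_lfunE.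
move=> b bB; apply/eqP; rewrite -hh -linearZ -subr_eq0 -linearB /=.
apply/eqP/h0; rewrite memv_ker linearB linearZ /= hqh yE tens_act_pureE mulr1.
have [w [wn0 _ actw]] := borel_line p.
rewrite -[b]/(vsval (Subvs bB)) -[vsval _]mul1r pure_balanced actw /= mul1r.
by rewrite -[_ *: ext_top E]addr0 pure_is_linear pure0r addr0 subrr.
Qed.

(** If the characters agreed on [B], any linear isomorphism of the lines [LB i] and [LB j] would be
    [B]-linear. *)
Lemma borel_separating i j : i != j -> exists2 b, b \in B & chi i b != chi j b.
Proof.
move=> ij; apply: NNPP => h; case/eqP: ij.
have [_ [[_ isoB _] _ _] _ _] := hB; apply: isoB.
have [wi [win0 [lam lamE] acti]] := borel_line i.
have [wj [wjn0 [mu muE] actj]] := borel_line j.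
have [||g [g0 gf]] := line_iso win0 wjn0.
- by move=> x; exists (lam x); apply: lamE.
- by move=> y; exists (mu y); apply: muE.
exists g; split=> // b x; rewrite acti actj linearZ /=; congr (_ *: _).
by apply/eqP/negPn/negP => hb; apply: h; exists (vsval b) => //; exact: subvsP.
Qed.

(** Lagrange interpolation: a product of elements vanishing at one [i != j] each, normalized at [j].
    The result is idempotent modulo the radical, but need not be so in [B]. *)
Lemma borel_dual j : exists2 b, b \in B & forall i, chi i b = (i == j)%:R.
Proof.
have [c cP] : exists c : I -> A, forall i, c i \in B /\ (i != j -> chi i (c i) != chi j (c i)).
  apply: (@fin_all_exists _ (fun=> A) (fun i b => b \in B /\ (i != j -> chi i b != chi j b))).
  move=> i; have [->|ij] := eqVneq i j; first by exists 1.
  by have [b bB hb] := borel_separating ij; exists b.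
pose d i := (chi j (c i) - chi i (c i))^-1 *: (c i - chi i (c i) *: 1).
exists (\prod_(i | i != j) d i).
  elim/big_rec: _ => // i x _ xB; apply: memvM => //.
  by rewrite memvZ // memvB ?memvZ //; case: (cP i).
move=> k; have -> : chi k (\prod_(i | i != j) d i) = \prod_(i | i != j) chi k (d i).
  exact: (big_morph _ (chiM hA k) (chi1 hA k)).
have dE i l : chi l (d i) = (chi j (c i) - chi i (c i))^-1 * (chi l (c i) - chi i (c i)).
  by rewrite chiZ chiB chiZ (chi1 hA) mulr1.
have [->|kj] := eqVneq k j.
  rewrite big1 // => i ij; rewrite dE mulVf // subr_eq0 eq_sym.
  by case: (cP i) => _; apply.
by rewrite (bigD1 k) //= dE subrr mulr0 mul0r.
Qed.

Let RB : {vspace A} := (B :&: rad)%VS.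

Let RBP a : reflect (a \in B /\ forall i, chi i a = 0) (a \in RB).
Proof.
rewrite memv_cap; apply: (iffP andP) => -[h1 h2]; split=> //; exact/(radE hA).
Qed.

Let RBl a b : a \in B -> b \in RB -> a * b \in RB.
Proof.
move=> aB /RBP[bB hb]; apply/RBP; split; first exact: memvM.
by move=> i; rewrite (chiM hA) hb mulr0.
Qed.

Let RBr a b : a \in RB -> b \in B -> a * b \in RB.
Proof.
move=> /RBP[aB ha] bB; apply/RBP; split; first exact: memvM.
by move=> i; rewrite (chiM hA) ha mul0r.
Qed.

(* If the functional mu vanishes on RB^2, then b |-> mu (c_j (b - chi v b) f) is a
   cocycle; it splits, so it vanishes on RB, where it is r |-> mu (c_j r f). *)
Lemma borel_radical_sqr f : f \in B -> (forall i, chi i f = (i == v)%:R) ->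
  forall r, r \in RB -> r * f \in (RB * RB)%VS /\ f * r \in (RB * RB)%VS.
Proof.
move=> fB chif r rR; have [rB chir] := RBP _ rR.
have [c cB chicj] := fin_all_exists2 borel_dual.
have chic i j : chi i (c j) = (i == j)%:R by apply: chicj.
(* The dual elements add up to 1 modulo the radical, so testing against all [c j] loses nothing
   modulo [RB * RB]. *)
have r0R : 1 - \sum_j c j \in RB.
  apply/RBP; split; first by rewrite memvB ?memv_suml.
  move=> i; rewrite chiB (chi1 hA) chi_sum (bigD1 i) //= chic eqxx big1 ?addr0 ?subrr //.
  by move=> j ji; rewrite chic eq_sym (negbTE ji).
have bfR b : b \in B -> (b - chi v b *: 1) * f \in RB /\ f * (b - chi v b *: 1) \in RB.
  move=> bB; have bB' : b - chi v b *: 1 \in B by rewrite memvB ?memvZ.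
  split; apply/RBP; split; rewrite ?memvM // => i;
    rewrite (chiM hA) chif chiB chiZ (chi1 hA) mulr1;
    by have [->|] := eqVneq i v; rewrite ?subrr ?mul0r ?mulr0.
have cR j b : b \in B -> c j * b - chi j b *: c j \in RB /\ b * c j - chi j b *: c j \in RB.
  move=> bB; split; apply/RBP; split; rewrite ?memvB ?memvZ ?memvM // => i;
    rewrite chiB (chiM hA) chiZ chic;
    by have [->|] := eqVneq i j; rewrite ?mulr1 ?mul1r ?mulr0 ?mul0r subrr.
have chi_r : chi v r *: 1 = 0 :> A by rewrite chir scale0r.
split; apply: contraT => /exists_functional[mu [mu0 mun0]];
  (have muZ k x : (mu (k *: x) : K) = k * mu x by rewrite linearZ);
  (have muD x y : (mu (x + y) : K) = mu x + mu y by rewrite linearD).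
- have [j hj] : exists j, mu (c j * (r * f)) != 0.
    apply: NNPP => h; case/eqP: mun0.
    rewrite -[r * f]mul1r -[1](subrK (\sum_j c j)) mulrDl linearD /=.
    rewrite mu0 ?add0r; last by rewrite memv_mul // RBr.
    rewrite mulr_suml linear_sum big1 // => j _; apply/eqP/negPn/negP => hj.
    by apply: h; exists j.
  pose delta b : K := mu (c j * ((b - chi v b *: 1) * f)).
  have [||t ht] := @extension_top_v j delta.
  + move=> k a b; rewrite /delta (chi_lin hA).
    rewrite -[RHS](linearP mu) /= scalerAr -mulrDr scalerAl -mulrDl; congr (mu (_ * (_ * _))).
    by rewrite scalerBr scalerA scalerDl opprD addrACA.
  + move=> a b aB bB; rewrite /delta.
    (* The only error term in the Leibniz rule for [delta] is a product of two elements of [RB], on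
       which [mu] vanishes. *)
    have -> : c j * ((a * b - chi v (a * b) *: 1) * f)
      = (c j * a - chi j a *: c j) * ((b - chi v b *: 1) * f)
        + (chi j a *: (c j * ((b - chi v b *: 1) * f))
           + chi v b *: (c j * ((a - chi v a *: 1) * f))).
      have -> : a * b - chi v (a * b) *: 1
          = a * (b - chi v b *: 1) + chi v b *: (a - chi v a *: 1).
        rewrite (chiM hA) mulrBr -scalerAr mulr1 scalerBr scalerA.
        by rewrite addrA subrK mulrC.
      rewrite mulrDl mulrDr -!scalerAl -!scalerAr [in RHS]addrA; congr (_ + _).
      rewrite -[X in c j * X]mulrA mulrA -[c j * a in LHS](subrK (chi j a *: c j)).
      by rewrite mulrDl -scalerAl.
    rewrite muD muD (mu0 ((c j * a - _) * _)) ?add0r; last by apply: memv_mul; [case: (cR j a aB)|case: (bfR b bB)].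
    by rewrite !muZ [chi v b * _]mulrC.
  (* All characters vanish at [r], so the split [delta] does too, whereas [delta r] is
     [mu (c j * (r * f))]. *)
  case/eqP: hj; have := ht r rB; rewrite /delta chi_r subr0 !chir subr0 mulr0.
  by [].
- have [j hj] : exists j, mu (f * r * c j) != 0.
    apply: NNPP => h; case/eqP: mun0.
    rewrite -[f * r]mulr1 -[1](subrK (\sum_j c j)) mulrDr linearD /=.
    rewrite mu0 ?add0r; last by rewrite memv_mul // RBl.
    rewrite mulr_sumr linear_sum big1 // => j _; apply/eqP/negPn/negP => hj.
    by apply: h; exists j.
  pose delta b : K := mu (f * (b - chi v b *: 1) * c j).
  have dlin k a b : delta (k *: a + b) = k * delta a + delta b.
    rewrite /delta (chi_lin hA).
    rewrite -[RHS](linearP mu) /= scalerAl -mulrDl scalerAr -mulrDr; congr (mu (_ * _ * _)).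
    by rewrite scalerBr scalerA scalerDl opprD addrACA.
  have dM a b : a \in B -> b \in B ->
    delta (a * b) = chi v a * delta b + delta a * chi j b.
    move=> aB bB; rewrite /delta.
    have -> : f * (a * b - chi v (a * b) *: 1) * c j
      = (f * (a - chi v a *: 1)) * (b * c j - chi j b *: c j)
        + (chi v a *: (f * (b - chi v b *: 1) * c j)
           + chi j b *: (f * (a - chi v a *: 1) * c j)).
      have -> : a * b - chi v (a * b) *: 1
          = (a - chi v a *: 1) * b + chi v a *: (b - chi v b *: 1).
        rewrite (chiM hA) mulrBl -scalerAl mul1r scalerBr scalerA.
        by rewrite addrA subrK.
      rewrite mulrDr mulrDl -!scalerAr -!scalerAl [in RHS]addrCA [RHS]addrC; congr (_ + _).
      rewrite [f * _]mulrA -[LHS]mulrA -[b * c j in LHS](subrK (chi j b *: c j)).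
      by rewrite mulrDr -scalerAr.
    rewrite muD muD (mu0 (f * _ * (b * c j - _))) ?add0r; last by apply: memv_mul; [case: (bfR a aB)|case: (cR j b bB)].
    by rewrite !muZ [chi j b * _]mulrC.
  (* Here the simple module at [v] is the submodule; for [j = v] it is the top as well, and the
     other splitting lemma applies. *)
  have [t ht] : exists t, forall b, b \in B -> delta b = t * (chi v b - chi j b).
    have [jv|jv] := eqVneq j v; last exact: extension_sub_v.
    by move: dM; rewrite jv => dM; apply: extension_top_v.
  case/eqP: hj; have := ht r rB; rewrite /delta chi_r subr0 !chir subr0 mulr0.
  by [].
Qed.

(** Each factor [f] pushes [RB] into the next power of itself, and these powers end at 0; so a high
    power of [f] is annihilated from both sides by [b - chi v b] for every [b] in [B]. *)
Theorem borel_central_idempotent : exists F : A, [/\ F \in B,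
    forall b, b \in B -> b * F = chi v b *: F /\ F * b = chi v b *: F,
    forall a, a * F = chi v a *: F,
    chi v F = 1 & forall i, i != v -> chi i F = 0].
Proof.
have [f fB chif] := borel_dual v.
have hf := borel_radical_sqr fB chif.
have [m radm] := rad_nil hA.
have RBm : (RB ^+ m.+1)%VS = 0%VS.
  apply/eqP; rewrite -subv0; apply: subv_trans (expvS _ (capvSr _ _)) _.
  by rewrite expvSl radm prodv0.
have Rfl n : (RB * <[f ^+ n]> <= RB ^+ n.+1)%VS.
  elim: n => [|n IH]; first by rewrite expr0 prodv1.
  rewrite exprSr -prodv_line prodvA; apply: subv_trans (prodvSl _ IH) _.
  rewrite expvSr -prodvA [X in (_ <= X)%VS]expvSr [X in (_ <= X * _)%VS]expvSr -prodvA.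
  apply: prodvSr; apply/prodvP => r _ rR /vlineP[k ->].
  by rewrite -scalerAr memvZ //; case: (hf r rR).
have Rfr n : (<[f ^+ n]> * RB <= RB ^+ n.+1)%VS.
  elim: n => [|n IH]; first by rewrite expr0 prod1v.
  rewrite exprS -prodv_line -prodvA; apply: subv_trans (prodvSr _ IH) _.
  rewrite expvSl prodvA [X in (_ <= X)%VS]expvSl [X in (_ <= _ * X)%VS]expvSl prodvA.
  apply: prodvSl; apply/prodvP => _ r /vlineP[k ->] rR.
  by rewrite -scalerAl memvZ //; case: (hf r rR).
have kill x : x \in (RB ^+ m.+1)%VS -> x = 0.
  by rewrite RBm memv0 => /eqP.
have fnB n : f ^+ n \in B by elim: n => [|n IH]; rewrite ?expr0 // exprS memvM.
have chiF n : chi v (f ^+ n) = 1 by rewrite chiX chif eqxx expr1n.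
(* One factor [f] brings [b - chi v b] into [RB], and the other [m] factors carry it into
   [RB ^+ m.+1 = 0]. *)
pose F := f ^+ m.+1.
have Fb b : b \in B -> b * F = chi v b *: F /\ F * b = chi v b *: F.
  move=> bB; have hR : (b - chi v b *: 1) * f \in RB /\ f * (b - chi v b *: 1) \in RB.
    have bB' : b - chi v b *: 1 \in B by rewrite memvB ?memvZ.
    split; apply/RBP; split; rewrite ?memvM // => i;
      rewrite (chiM hA) chif chiB chiZ (chi1 hA) mulr1;
      by have [->|] := eqVneq i v; rewrite ?subrr ?mul0r ?mulr0.
  split; apply/eqP; rewrite -subr_eq0.
    have -> : chi v b *: F = (chi v b *: 1) * F by rewrite -scalerAl mul1r.
    rewrite -mulrBl /F exprS mulrA.
    apply/eqP/kill/(subvP (Rfl m)); by rewrite memv_mul ?memv_line //; case: hR.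
  have -> : chi v b *: F = F * (chi v b *: 1) by rewrite -scalerAr mulr1.
  rewrite -mulrBr /F exprSr -mulrA.
  by apply/eqP/kill/(subvP (Rfr m)); rewrite memv_mul ?memv_line //; case: hR.
have F0 i : i != v -> chi i F = 0 by move=> iv; rewrite chiX chif (negbTE iv) expr0n.
exists F; split=> //; [exact: fnB|idtac|exact: chiF].
have FF : F * F = F by rewrite (Fb F (fnB _)).1 chiF scale1r.
have Fe : F * e v = e v by rewrite hv chiF scale1r.
have ee : e v * e v = e v by rewrite hv (chi_e hA) eqxx scale1r.
(* [F * e v = e v] makes this difference idempotent. It also lies in the radical, so it is 0, and
   [F = e v * F] inherits from [e v] that all of [A] acts on it by [chi v]. *)
pose g := F - e v * F.
have gg : g * g = g.
  rewrite /g mulrBl !mulrBr FF mulrA Fe -mulrA FF mulrA -[e v * F * e v]mulrA Fe ee.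
  by rewrite subrr subr0.
have grad : g \in rad.
  apply/(radE hA) => i; rewrite chiB (chiM hA) (chi_e hA).
  by have [->|iv] := eqVneq i v; rewrite ?mul1r ?subrr // F0 // mulr0 subr0.
have gn n : g \in (rad ^+ n.+1)%VS.
  by elim: n => [|n IH]; rewrite ?expv1 // expvSl -gg memv_mul.
have g0 : g = 0 by apply/eqP; rewrite -memv0; have := gn m; rewrite expvSl radm prodv0.
move=> a; have <- : e v * F = F by apply/esym/eqP; rewrite -subr_eq0 -/g g0.
by rewrite mulrA hv scalerAl.
Qed.

End SplitBasic.

(** * Resolutions *)

(** [Inv] is what makes the next choice possible, [Step] what ties it to its predecessor; the type
    varies with [k], as for chain maps and homotopies. *)
Lemma dependent_choice (T : nat -> Type) (Inv : forall k, T k -> Prop)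
    (Step : forall k, T k -> T k.+1 -> Prop) (Base : T 0%N -> Prop) :
    (exists x, Base x /\ Inv 0%N x) ->
    (forall k x, Inv k x -> exists y, Step k x y /\ Inv k.+1 y) ->
  exists f : forall k, T k,
    [/\ Base (f 0%N), forall k, Inv k (f k) & forall k, Step k (f k) (f k.+1)].
Proof.
case=> x0 [b0 i0] hS.
have F k (x : {x : T k | Inv k x}) : {y : {y : T k.+1 | Inv k.+1 y} | Step k (sval x) (sval y)}.
  apply: constructive_indefinite_description; case: x => x ix /=.
  by have [y [sy iy]] := hS _ _ ix; exists (exist _ y iy).
pose f := fix f k : {x : T k | Inv k x} :=
  if k is k'.+1 then sval (F k' (f k')) else exist _ x0 i0.
exists (fun k => sval (f k)); split=> // k; first by case: (f k).
by rewrite /=; case: (F k (f k)).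
Qed.

Section Resolutions.
Variables (K : fieldType) (R : falgType K).
Implicit Types M N X Y P : fdmod R.

(** [d] need not be onto: both maps are corestricted to its image before lifting. *)
Lemma lift_image P X Y (d : 'Hom(X, Y)) (f : 'Hom(P, Y)) :
    projective P -> mhom d -> mhom f -> (forall x, exists y, d y = f x) ->
  exists2 h : 'Hom(P, X), mhom h & (d \o h)%VF = f.
Proof.
move=> hP hd hf fd; have hU := submod_img hd.
have [d' [hd' d'E d'C]] := mhom_restr hU hd (subvv _).
have [|f' [hf' f'E f'C]] := mhom_restr hU hf.
  apply/subvP => _ /memv_imgP[x _ ->]; have [y <-] := fd x.
  by rewrite memv_img ?memvf.
have d'f : limg d' = fullv.
  apply/limg_fullP => y; have /memv_imgP[x _ yE] : vsval y \in limg d by apply: subvsP.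
  by exists x; apply: val_inj; rewrite [LHS]d'E.
have [h hh hE] := hP _ _ _ _ hd' d'f hf'; exists h => //.
by apply/lfunP => x; rewrite comp_lfunE -d'E -f'E -hE comp_lfunE.
Qed.

Section Exactness.
Variables (M : fdmod R) (P : resolution M).

Lemma res_augK (x : res P 1) : res_aug P (res_d P 0 x) = 0.
Proof. by have [h _] := (exactP _ _).1 (res_exact0 P). Qed.

Lemma res_dK k (x : res P k.+2) : res_d P k (res_d P k.+1 x) = 0.
Proof. by have [h _] := (exactP _ _).1 (res_exactS P k). Qed.

Lemma res_aug_lift (y : res P 0) : res_aug P y = 0 -> exists x, res_d P 0 x = y.
Proof. by have [_ h] := (exactP _ _).1 (res_exact0 P); apply: h. Qed.

Lemma res_d_lift k (y : res P k.+1) : res_d P k y = 0 -> exists x, res_d P k.+1 x = y.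
Proof. by have [_ h] := (exactP _ _).1 (res_exactS P k); apply: h. Qed.

End Exactness.

Lemma null_homotopy M N (P : resolution M) (S : resolution N)
    (u : forall k, 'Hom(res P k, res S k)) :
    (forall k, mhom (u k)) -> (forall x, res_aug S (u 0%N x) = 0) ->
    (forall k x, res_d S k (u k.+1 x) = u k (res_d P k x)) ->
  exists h : forall k, 'Hom(res P k, res S k.+1),
    [/\ forall k, mhom (h k), forall x, u 0%N x = res_d S 0 (h 0%N x)
      & forall k x, u k.+1 x = res_d S k.+1 (h k.+1 x) + h k (res_d P k x)].
Proof.
move=> hu u0 ud.
have dP k : mhom (res_d P k) by apply: res_d_hom.
have dS k : mhom (res_d S k) by apply: res_d_hom.
have Pproj k : projective (res P k) by apply: res_projective.
(* The next homotopy exists once [u k.+1 - h d] takes values in cycles. *)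
pose Inv k (h : 'Hom(res P k, res S k.+1)) := mhom h /\
  forall x, res_d S k (u k.+1 x - h (res_d P k x)) = 0.
pose Step k (h : 'Hom(res P k, res S k.+1)) (h' : 'Hom(res P k.+1, res S k.+2)) :=
  forall x, u k.+1 x = res_d S k.+1 (h' x) + h (res_d P k x).
have [||h [hb hi hs]] := @dependent_choice _ Inv Step
  (fun h => forall x, u 0%N x = res_d S 0 (h x)).
- have [|h hh hE] := lift_image (Pproj 0%N) (dS 0%N) (hu 0%N).
    by move=> x; apply: res_aug_lift.
  have hE' x : u 0%N x = res_d S 0 (h x) by rewrite -hE comp_lfunE.
  by exists h; split=> //; split=> // x; rewrite linearB /= -hE' ud subrr.
- move=> k h [hh hk].
  have hw : mhom (u k.+1 - (h \o res_d P k))%VF by apply: mhomB => //; apply: mhom_comp.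
  have [|h' hh' hE] := lift_image (Pproj k.+1) (dS k.+1) hw.
    move=> x; apply: res_d_lift; rewrite add_lfunE opp_lfunE comp_lfunE.
    exact: hk.
  have hE' x : res_d S k.+1 (h' x) = u k.+1 x - h (res_d P k x).
    by rewrite -comp_lfunE hE add_lfunE opp_lfunE comp_lfunE.
  exists h'; split; first by move=> x; rewrite hE' subrK.
  split=> // x; rewrite linearB /= hE' ud res_dK linear0 subr0.
  exact: subrr.
- by exists h; split=> // k; case: (hi k).
Qed.

Lemma lift_identity M (P S : resolution M) :
  exists u : forall k, 'Hom(res P k, res S k),
    [/\ forall k, mhom (u k), forall x, res_aug S (u 0%N x) = res_aug P x
      & forall k x, res_d S k (u k.+1 x) = u k (res_d P k x)].
Proof.
have dP k : mhom (res_d P k) by apply: res_d_hom.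
have dS k : mhom (res_d S k) by apply: res_d_hom.
have Pproj k : projective (res P k) by apply: res_projective.
pose Inv k (u : 'Hom(res P k, res S k)) := mhom u /\
  forall x, exists y, res_d S k y = u (res_d P k x).
pose Step k (u : 'Hom(res P k, res S k)) (u' : 'Hom(res P k.+1, res S k.+1)) :=
  forall x, res_d S k (u' x) = u (res_d P k x).
have [||u [ub ui us]] := @dependent_choice _ Inv Step
  (fun u => forall x, res_aug S (u x) = res_aug P x).
- have [|u hu uE] := lift_image (Pproj 0%N) (@res_aug_hom _ _ _ S) (@res_aug_hom _ _ _ P).
    by move=> x; apply: (limg_fullP _).1 => //; apply: res_aug_onto.
  have uE' x : res_aug S (u x) = res_aug P x by rewrite -uE comp_lfunE.
  exists u; split=> //; split=> // x; apply: res_aug_lift.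
  by rewrite uE' res_augK.
- move=> k u [hu uk].
  have [|u' hu' uE] := lift_image (Pproj k.+1) (dS k) (mhom_comp hu (dP k)).
    by move=> x; rewrite comp_lfunE.
  have uE' x : res_d S k (u' x) = u (res_d P k x) by rewrite -comp_lfunE uE comp_lfunE.
  exists u'; split=> //; split=> // x; apply: res_d_lift.
  by rewrite uE' res_dK linear0.
- by exists u; split=> // k; case: (ui k).
Qed.

(** A chain map over the identity is a homotopy equivalence, with inverse given by [lift_identity].
    Surjectivity is phrased through [g'] so that it can be chained with an approximation of [g'] by
    some [tens_map f]. *)
Lemma ext_compare M (P S : resolution M) (c : forall k, 'Hom(res P k, res S k))
    X k :
    (forall k, mhom (c k)) -> (forall x, res_aug S (c 0%N x) = res_aug P x) ->
    (forall k x, res_d S k (c k.+1 x) = c k (res_d P k x)) ->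
  (forall f : 'Hom(res S k.+1, X), cocycle f ->
     coboundary (f \o c k.+1)%VF -> coboundary f) /\
  (forall g : 'Hom(res P k.+1, X), cocycle g ->
     exists2 g' : 'Hom(res S k.+1, X), cocycle g' &
       forall f : 'Hom(res S k.+1, X), coboundary (g' - f) ->
         coboundary (g - (f \o c k.+1))%VF).
Proof.
move=> hc c0 cd; have [u [hu u0 ud]] := lift_identity S P.
pose w k := (c k \o u k - \1)%VF.
have wE j x : w j x = c j (u j x) - x.
  by rewrite /w add_lfunE opp_lfunE comp_lfunE id_lfunE.
have [|||h [hh h0 hS]] := @null_homotopy _ _ S S w.
- by move=> j; apply: mhomB; [apply: mhom_comp|apply: mhom_id].
- by move=> x; rewrite wE linearB /= c0 u0 subrr.
- by move=> j x; rewrite !wE linearB /= cd ud.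
pose w' k := (u k \o c k - \1)%VF.
have w'E j x : w' j x = u j (c j x) - x.
  by rewrite /w' add_lfunE opp_lfunE comp_lfunE id_lfunE.
have [|||h' [hh' h'0 h'S]] := @null_homotopy _ _ P P w'.
- by move=> j; apply: mhomB; [apply: mhom_comp|apply: mhom_id].
- by move=> x; rewrite w'E linearB /= u0 c0 subrr.
- by move=> j x; rewrite !w'E linearB /= ud cd.
split=> [f [hf /lfunP f0] [g hg /lfunP gE]|g [hg /lfunP g0]].
  have {}f0 x : f (res_d S k.+1 x) = 0 by have := f0 x; rewrite comp_lfunE zero_lfunE.
  have {}gE x : f (c k.+1 x) = g (res_d P k x) by have := gE x; rewrite !comp_lfunE.
  exists ((g \o u k) - (f \o h k))%VF.
    by apply: mhomB; apply: mhom_comp.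
  apply/lfunP => x; rewrite comp_lfunE add_lfunE opp_lfunE !comp_lfunE.
  rewrite -ud -gE -[c k.+1 _](subrK x) -wE hS !linearD /= f0 add0r.
  by rewrite addrAC subrr add0r.
have {}g0 x : g (res_d P k.+1 x) = 0 by have := g0 x; rewrite comp_lfunE zero_lfunE.
exists (g \o u k.+1)%VF.
  split; first exact: mhom_comp.
  by apply/lfunP => x; rewrite !comp_lfunE zero_lfunE -ud g0.
move=> f [H hH /lfunP HE].
have {}HE x : g (u k.+1 x) - f x = H (res_d S k x).
  by have := HE x; rewrite add_lfunE opp_lfunE !comp_lfunE.
exists ((H \o c k) - (g \o h' k))%VF.
  by apply: mhomB; apply: mhom_comp.
apply/lfunP => x; rewrite comp_lfunE !add_lfunE !opp_lfunE !comp_lfunE.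
rewrite -cd -HE -[u k.+1 _](subrK x) -w'E h'S !linearD /= g0 add0r.
by rewrite -[X in _ = X - _]addrA [RHS]addrAC subrr add0r.
Qed.

(* 1 - a is null-homotopic on P, and f (1 - a) = f. *)
Lemma coboundary_of_null M (P : resolution M) X k (a : R) (f : 'Hom(res P k.+1, X)) :
    (forall b, a * b = b * a) -> (forall x, act M a x = x) ->
    (forall x, act X a x = 0) -> cocycle f -> coboundary f.
Proof.
move=> aC aM aX [hf /lfunP f0].
have {}f0 x : f (res_d P k.+1 x) = 0 by have := f0 x; rewrite comp_lfunE zero_lfunE.
pose w k : 'End(res P k) := act (res P k) (1 - a).
have wE j x : w j x = x - act (res P j) a x by rewrite /w actB act1E.
have hw j : mhom (w j).
  by move=> b x; rewrite !wE linearB /= -!actME aC.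
have [||h [hh _ hS]] := @null_homotopy _ _ P P w hw.
- move=> x; rewrite wE linearB /=.
  by rewrite [res_aug P (act _ _ _)](@res_aug_hom _ _ _ P) aM subrr.
- move=> j x; rewrite !wE linearB /=.
  by rewrite [res_d P j (act _ _ _)](@res_d_hom _ _ _ P).
exists (f \o h k)%VF; first exact: mhom_comp.
apply/lfunP => x; rewrite !comp_lfunE.
have <- : f (w k.+1 x) = f x by rewrite wE linearB /= hf aX subr0.
by rewrite hS linearD /= f0 add0r.
Qed.

End Resolutions.

(** * Ext between induced modules, computed over [B] *)

Section ExtAdjunction.
Variables (K : fieldType) (A : falgType K) (B : {aspace A}).
Local Notation Bt := (subvs_of B).
Hypotheses (B1 : 1 \in B) (hex : tens_exact B).
Implicit Types M N : fdmod Bt.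

Section TensorResolution.
Variables (M : fdmod Bt) (P : resolution M).

Let dP k : mhom (res_d P k). Proof. exact: res_d_hom. Qed.
Let aP : mhom (res_aug P). Proof. exact: res_aug_hom. Qed.

Let tproj k : projective (tens (res P k)).
Proof. exact/(tens_projective B1)/res_projective. Qed.

Let thom k : mhom (tens_map (res_d P k)). Proof. exact: tens_map_mhom. Qed.

Let taug : mhom (tens_map (res_aug P)). Proof. exact: tens_map_mhom. Qed.

Let tonto : limg (tens_map (res_aug P)) = fullv.
Proof. exact/tens_map_onto/res_aug_onto. Qed.

Let texact0 : limg (tens_map (res_d P 0)) = lker (tens_map (res_aug P)).
Proof. by apply: tens_map_exact => //; apply: res_exact0. Qed.

Let texactS k : limg (tens_map (res_d P k.+1)) = lker (tens_map (res_d P k)).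
Proof. by apply: tens_map_exact => //; apply: res_exactS. Qed.

Definition tens_resolution : resolution (tens M) :=
  Resolution tproj thom taug tonto texact0 texactS.

End TensorResolution.

(* The comparison map on Ext^{k+1}, computed over B: by adjunction it is
   induced by the unit N -> A (x) N. *)
Definition ext_unit_iso k M N (P : resolution M) : Prop :=
  (forall f : 'Hom(res P k.+1, N), cocycle f ->
     forall g : 'Hom(res P k, res_to B1 (tens N)), mhom g ->
     (forall x, pure 1 (f x) = g (res_d P k x)) -> coboundary f) /\
  (forall g : 'Hom(res P k.+1, res_to B1 (tens N)), cocycle g ->
     exists2 f : 'Hom(res P k.+1, N), cocycle f &
     exists2 h : 'Hom(res P k, res_to B1 (tens N)), mhom h &
       forall x, g x - pure 1 (f x) = h (res_d P k x)).

Lemma tens_map_cocycle M N (P : resolution M) k (f : 'Hom(res P k, N)) :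
  cocycle f -> cocycle (P := tens_resolution P) (tens_map f).
Proof.
case=> hf f0; split; first exact: tens_map_mhom.
rewrite -tens_map_comp //; last exact: res_d_hom.
by rewrite f0 tens_map0.
Qed.

(** By [ext_compare] any [R] may be replaced by [tens_resolution P], and maps from its terms to
    [tens N] are the [B]-maps from the terms of [P]. *)
Lemma ext_map_iso_unit k M N :
  (forall P : resolution M, ext_unit_iso k N P) -> ext_map_iso k M N.
Proof.
move=> core P R c hc c0 cd; have [inj sur] := core P.
have dP j : mhom (res_d P j) by apply: res_d_hom.
have c0' x : tens_map (res_aug P) (c 0%N x) = res_aug R x.
  by rewrite -c0 [RHS]comp_lfunE.
have cd' j x : tens_map (res_d P j) (c j.+1 x) = c j (res_d R j x).
  by have /lfunP/(_ x) := cd j; rewrite comp_lfunE [RHS]comp_lfunE.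
have [cinj csur] := @ext_compare _ _ _ R (tens_resolution P) c (tens N) k hc c0' cd'.
split=> [f hf /cinj|G /csur[G' [hg' g'0] cob]].
  case; first exact: tens_map_cocycle.
  move=> G hG /lfunP GE; have [g hg gE] := tens_coadj B1 hG.
  apply: (inj f hf g hg) => x; have [mf _] := hf.
  rewrite gE -tens_map_pure // -tens_map_pure //.
  by have := GE (pure 1 x); rewrite [in X in _ = X -> _]comp_lfunE.
have [g hg gE] := tens_coadj B1 hg'.
have [|f hf [h hh hE]] := sur g.
  split=> //; apply/lfunP => x; rewrite comp_lfunE zero_lfunE gE.
  rewrite -tens_map_pure //; have /lfunP/(_ (pure 1 x)) := g'0.
  by rewrite [in X in X -> _]comp_lfunE zero_lfunE.
exists f => //; apply: cob; have [H hH HE] := tens_adj hh.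
exists H => //; have [mf _] := hf.
apply: tens_mhom_ext => [||x].
- by apply: mhomB => //; apply: tens_map_mhom.
- by apply: mhom_comp => //; apply: tens_map_mhom.
- rewrite [RHS]comp_lfunE /= tens_map_pure // HE act1E -hE gE.
  by rewrite add_lfunE opp_lfunE tens_map_pure.
Qed.

(** The case of [tens_resolution P] and the identity chain map, read through adjunction. *)
Lemma ext_unit_iso_of k M N (P : resolution M) :
  ext_map_iso k M N -> ext_unit_iso k N P.
Proof.
move=> iso; have dP j : mhom (res_d P j) by apply: res_d_hom.
have [|||inj sur] := iso P (tens_resolution P) (fun k => \1%VF).
- by move=> j; apply: mhom_id.
- by rewrite comp_lfun1r.
- by move=> j; rewrite comp_lfun1r comp_lfun1l.
split=> [f hf g hg gE|g [hg /lfunP g0]].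
  apply: (inj f hf); rewrite comp_lfun1r; have [G hG GE] := tens_adj hg; exists G => //.
  have [mf _] := hf; apply: tens_mhom_ext; first exact: tens_map_mhom.
    by apply: mhom_comp => //; apply: tens_map_mhom.
  by move=> x; rewrite [RHS]comp_lfunE !tens_map_pure // GE act1E gE.
have [G hG GE] := tens_adj hg.
have [|f hf] := sur G; last rewrite comp_lfun1r => -[H hH /lfunP HE].
  split=> //; apply: tens_mhom_ext; [|exact: mhom0|].
    by apply: mhom_comp => //; apply: tens_map_mhom.
  move=> x; rewrite comp_lfunE zero_lfunE /= tens_map_pure // GE act1E.
  by have := g0 x; rewrite comp_lfunE zero_lfunE.
exists f => //; have [h hh hE] := tens_coadj B1 hH; exists h => // x.
have [mf _] := hf; rewrite hE -tens_map_pure // -tens_map_pure //.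
have := HE (pure 1 x); rewrite [in X in _ = X -> _]comp_lfunE => <-.
by rewrite add_lfunE opp_lfunE GE act1E.
Qed.

End ExtAdjunction.

(** * Gluing along a character *)

(* B acts on the part of a module cut out by the central idempotent c of B
   through phi; the elements of A agree on it with those of the subalgebra
   sigma A'. *)
Section Corner.
Variables (K : fieldType) (A A' : falgType K) (B : {aspace A}) (B' : {aspace A'}).
Variables (phi : A -> A') (sigma : A' -> A) (c : A).
Hypotheses (hphi : alghom phi) (hsigma : alghom sigma) (sigmaK : cancel sigma phi).
Hypotheses (B1 : 1 \in B) (B'1 : 1 \in B').
Hypotheses (phiB : forall b, b \in B -> phi b \in B').
Hypotheses (sigmaB : forall b, b \in B' -> sigma b \in B).
Hypotheses (cB : c \in B) (cC : forall b, b \in B -> b * c = c * b) (cc : c * c = c).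
Hypothesis hc : forall a, sigma (phi a) * c = a * c.

Local Notation Bt := (subvs_of B).
Local Notation Bt' := (subvs_of B').

Definition corner_phi (b : Bt) : Bt' := Subvs (phiB (subvsP b)).
Definition corner_sigma (b : Bt') : Bt := Subvs (sigmaB (subvsP b)).
Definition corner_c : Bt := Subvs cB.

Lemma alghom_corner_phi : alghom corner_phi.
Proof.
split=> [k a b||a b]; apply: val_inj => /=.
- by rewrite (alghomD hphi) (alghomZ hphi).
- have [_ v1 _] := alghom_vsval B1; have [_ v1' _] := alghom_vsval B'1.
  by rewrite [LHS](congr1 phi v1) (alghom1 hphi); apply/esym/v1'.
- exact: alghomM.
Qed.

Lemma alghom_corner_sigma : alghom corner_sigma.
Proof.
split=> [k a b||a b]; apply: val_inj => /=.
- by rewrite (alghomD hsigma) (alghomZ hsigma).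
- have [_ v1 _] := alghom_vsval B1; have [_ v1' _] := alghom_vsval B'1.
  by rewrite [LHS](congr1 sigma v1') (alghom1 hsigma); apply/esym/v1.
- exact: alghomM.
Qed.

Lemma corner_sigmaK : cancel corner_sigma corner_phi.
Proof. by move=> b; apply: val_inj; apply: sigmaK. Qed.

Lemma corner_cC b : corner_c * b = b * corner_c.
Proof. by apply: val_inj => /=; rewrite cC ?subvsP. Qed.

Lemma corner_hc b : corner_sigma (corner_phi b) * corner_c = b * corner_c.
Proof. by apply: val_inj => /=; apply: hc. Qed.

Local Notation res_sigma := (pull alghom_corner_sigma).
Implicit Types (M N : fdmod Bt).

Lemma corner_theta M : exists th : 'Hom(tens M, tens (res_sigma M)),
  forall a x, th (pure a x) = pure (M := res_sigma M) (phi a) (act M corner_c x).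
Proof.
apply: tens_lift => [x k a b|a k x y|a b x].
- by rewrite (alghomD hphi) (alghomZ hphi) pure_linearl.
- by rewrite linearP pure_is_linear.
- rewrite (alghomM hphi) -[phi (vsval b)]/(vsval (corner_phi b)) pure_balanced /=.
  congr pure; rewrite -[LHS](actME (M := M)) corner_hc -corner_cC.
  by rewrite -(actME (M := M)).
Qed.

Lemma corner_psi M : exists ps : 'Hom(tens (res_sigma M), tens M),
  forall a (x : M), ps (pure (M := res_sigma M) a x) = pure (sigma a) (act M corner_c x).
Proof.
apply: tens_lift => [x k a b|a k x y|a b x].
- by rewrite (alghomD hsigma) (alghomZ hsigma) pure_linearl.
- by rewrite linearP pure_is_linear.
- rewrite (alghomM hsigma) -[sigma (vsval b)]/(vsval (corner_sigma b)) pure_balanced.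
  by congr pure; rewrite /= -!actME corner_cC.
Qed.

(** The round trip is the projection to the [c]-part and not the identity: this part of [tens M] is
    a natural retract of a module induced from [B']. *)
Lemma corner_retract M (th : 'Hom(tens M, tens (res_sigma M)))
    (ps : 'Hom(tens (res_sigma M), tens M)) :
    (forall a x, th (pure a x) = pure (M := res_sigma M) (phi a) (act M corner_c x)) ->
    (forall a (x : M), ps (pure (M := res_sigma M) a x) = pure (sigma a) (act M corner_c x)) ->
  forall a x, ps (th (pure a x)) = pure a (act M corner_c x).
Proof.
move=> thE psE a x; have cc' : corner_c * corner_c = corner_c by apply: val_inj.
by rewrite thE psE -actME cc' -!pure_balanced /= hc.
Qed.

Lemma corner_theta_nat M N (f : 'Hom(M, N))
    (thM : 'Hom(tens M, tens (res_sigma M))) (thN : 'Hom(tens N, tens (res_sigma N))) :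
    (forall a x, thM (pure a x) = pure (M := res_sigma M) (phi a) (act M corner_c x)) ->
    (forall a x, thN (pure a x) = pure (M := res_sigma N) (phi a) (act N corner_c x)) ->
    mhom f ->
  forall x, @tens_map _ _ _ (res_sigma M) (res_sigma N) f (thM x) = thN (tens_map f x).
Proof.
move=> thME thNE hf x; rewrite -[LHS]comp_lfunE -[RHS]comp_lfunE.
congr (fun_of_lfun _ x); apply: tens_ext => a y.
rewrite comp_lfunE [RHS]comp_lfunE thME !tens_map_pure // ?thNE ?hf //.
exact: (mhom_pull (hf := alghom_corner_sigma) hf).
Qed.

Lemma corner_psi_nat M N (f : 'Hom(M, N))
    (psM : 'Hom(tens (res_sigma M), tens M)) (psN : 'Hom(tens (res_sigma N), tens N)) :
    (forall a (x : M), psM (pure (M := res_sigma M) a x) = pure (sigma a) (act M corner_c x)) ->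
    (forall a (x : N), psN (pure (M := res_sigma N) a x) = pure (sigma a) (act N corner_c x)) ->
    mhom f ->
  forall x, tens_map f (psM x) = psN (@tens_map _ _ _ (res_sigma M) (res_sigma N) f x).
Proof.
move=> psME psNE hf x; rewrite -[LHS]comp_lfunE -[RHS]comp_lfunE.
congr (fun_of_lfun _ x); apply: tens_ext => a y.
rewrite comp_lfunE [RHS]comp_lfunE psME !tens_map_pure // ?psNE ?hf //.
exact: (mhom_pull (hf := alghom_corner_sigma) hf).
Qed.

Lemma mhom_corner_c M : mhom (act M corner_c).
Proof. by move=> b x; rewrite -!actME corner_cC. Qed.

(** A chase through the exact functor of [B'] by means of [corner_theta] and [corner_psi]. It serves
    for [c = 1 - f2] and for [c = f1], with [phi c] equal to [1] and [1 - F1] respectively. *)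
Lemma corner_exact (M' M M'' : fdmod Bt) (f : 'Hom(M', M)) (g : 'Hom(M, M'')) :
    tens_exact B' -> mhom f -> mhom g -> lker f = 0%VS -> limg f = lker g ->
  (forall x, tens_map f x = 0 -> tens_map (act M' corner_c) x = 0) /\
  (forall y, tens_map g y = 0 -> exists z, tens_map f z = tens_map (act M corner_c) y).
Proof.
move=> hex' hf hg f0 fg.
have hf1 : @mhom _ _ (res_sigma M') (res_sigma M) f.
  exact: (mhom_pull (hf := alghom_corner_sigma) hf).
have hg1 : @mhom _ _ (res_sigma M) (res_sigma M'') g.
  exact: (mhom_pull (hf := alghom_corner_sigma) hg).
have /lker_eq0P t0 := tens_map_inj hex' hf1 f0.
have [_ te] := (exactP _ _).1 (tens_map_exact hex' hf1 hg1 fg).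
have psth N (th : 'Hom(tens N, tens (res_sigma N))) (ps : 'Hom(tens (res_sigma N), tens N))
:
    (forall a x, th (pure a x) = pure (M := res_sigma N) (phi a) (act N corner_c x)) ->
    (forall a (x : N), ps (pure (M := res_sigma N) a x) = pure (sigma a) (act N corner_c x)) ->
    forall x, ps (th x) = tens_map (act N corner_c) x.
  move=> thE psE x; rewrite -[LHS]comp_lfunE; congr (fun_of_lfun _ x); apply: tens_ext => a y.
  rewrite comp_lfunE (@corner_retract N th ps thE psE) tens_map_pure //.
  exact: mhom_corner_c.
have [th' th'E] := corner_theta M'; have [ps' ps'E] := corner_psi M'.
have [th thE] := corner_theta M; have [ps psE] := corner_psi M.
have [th'' th''E] := corner_theta M''.
split=> [x fx|y gy].
  rewrite -(psth _ _ _ th'E ps'E).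
  have := corner_theta_nat th'E thE hf x; rewrite fx linear0 => /t0 ->.
  exact: linear0.
have := corner_theta_nat thE th''E hg y; rewrite gy linear0 => /te[z zE].
exists (ps' z); rewrite (corner_psi_nat ps'E psE hf).
by rewrite -(psth _ _ _ thE psE) -zE.
Qed.

Hypothesis phic : phi c = 1.

Lemma corner_phi_c : corner_phi corner_c = 1.
Proof.
apply: val_inj => /=; have [_ v1' _] := alghom_vsval B'1.
by rewrite phic; apply/esym/v1'.
Qed.

Section Semilinear.
Variables (M : fdmod Bt) (M' : fdmod Bt') (u : 'Hom(M, M')).
Hypotheses (hu : forall b x, u (act M b x) = act M' (corner_phi b) (u x)).
Hypotheses (u0 : lker u = 0%VS) (uf : limg u = fullv).

Lemma semilinear_c x : act M corner_c x = x.
Proof.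
apply/eqP; rewrite -subr_eq0; apply/eqP/((lker_eq0P _).1 u0).
by rewrite linearB /= hu corner_phi_c act1E subrr.
Qed.

Lemma semilinear_inv : exists2 u' : 'Hom(M', M), cancel u u' & cancel u' u.
Proof.
exists (u^-1)%VF; first by move=> x; rewrite lker0_lfunK //; apply/eqP.
by move=> y; rewrite limg_lfunVK // uf memvf.
Qed.

(** Because of [u] the idempotent [c] acts on [M] as 1, so the retraction onto the corner becomes an
    isomorphism. *)
Lemma corner_semilinear : exists th : 'Hom(tens M, tens M'),
  [/\ forall a x, th (pure a x) = pure (phi a) (u x),
      forall a z, th (act (tens M) a z) = act (tens M') (phi a) (th z),
      lker th = 0%VS & limg th = fullv].
Proof.
have [u' uK u'K] := semilinear_inv.
have [|||th thE] := @tens_lift _ _ _ M (tens M') (fun a x => pure (phi a) (u x)).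
- by move=> x k a b; rewrite (alghomD hphi) (alghomZ hphi) pure_linearl.
- by move=> a k x y; rewrite linearP pure_is_linear.
- move=> a b x; rewrite (alghomM hphi) -[phi (vsval b)]/(vsval (corner_phi b)).
  by rewrite pure_balanced hu.
have [|||ps psE] := @tens_lift _ _ _ M' (tens M) (fun a x => pure (sigma a) (u' x)).
- by move=> x k a b; rewrite (alghomD hsigma) (alghomZ hsigma) pure_linearl.
- by move=> a k x y; rewrite linearP pure_is_linear.
- move=> a b x; rewrite (alghomM hsigma) -[sigma (vsval b)]/(vsval (corner_sigma b)).
  rewrite pure_balanced; congr pure; rewrite -[LHS]uK hu u'K.
  by rewrite [corner_phi _]corner_sigmaK.
have psth z : ps (th z) = z.
  rewrite -[LHS]comp_lfunE -[RHS]id_lfunE; congr (fun_of_lfun _ z).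
  apply: tens_ext => a x; rewrite comp_lfunE thE psE uK id_lfunE.
  by rewrite -[x]semilinear_c -!pure_balanced /= hc.
have thps z : th (ps z) = z.
  rewrite -[LHS]comp_lfunE -[RHS]id_lfunE; congr (fun_of_lfun _ z).
  by apply: tens_ext => a x; rewrite comp_lfunE psE thE u'K id_lfunE sigmaK.
exists th; split=> //.
- move=> a z; rewrite -[LHS]comp_lfunE -[RHS]comp_lfunE; congr (fun_of_lfun _ z).
  apply: tens_ext => b x; rewrite comp_lfunE [RHS]comp_lfunE tens_act_pureE.
  by rewrite !thE (alghomM hphi) tens_act_pureE.
- by apply/lker_eq0P => z tz; rewrite -[z]psth tz linear0.
- by apply/limg_fullP => z; exists (ps z); rewrite thps.
Qed.

Lemma corner_misom : misom (tens M) (pull hphi (tens M')).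
Proof.
have [th [_ thA th0 thf]] := corner_semilinear.
by exists th; split.
Qed.

Lemma semilinear_down (P : fdmod Bt) (f : 'Hom(P, M)) : mhom f ->
  @mhom _ _ (res_sigma P) M' (u \o f)%VF.
Proof. by move=> hf b x; rewrite !comp_lfunE /= hf hu [corner_phi _]corner_sigmaK. Qed.

Lemma semilinear_up (P : fdmod Bt) (f : 'Hom(P, M')) :
  @mhom _ _ (res_sigma P) M' f ->
  exists2 g : 'Hom(P, M), mhom g & forall x, u (g x) = f (act P corner_c x).
Proof.
have [u' uK u'K] := semilinear_inv; move=> hf.
exists (u' \o f \o act P corner_c)%VF; last by move=> x; rewrite !comp_lfunE u'K.
move=> b x; rewrite !comp_lfunE -actME corner_cC -corner_hc actME.
by rewrite [f _]hf -[RHS]uK hu u'K.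
Qed.

End Semilinear.

Variables (chi : A' -> K) (F : A').
Hypotheses (FB : F \in B') (chiF : chi F = 1).
Hypothesis Fl : forall b, b \in B' -> b * F = chi b *: F.
Hypothesis chic : forall b, b \in B' -> sigma b * (1 - c) = chi b *: (1 - c).

Let c1E : vsval (1 - corner_c) = 1 - c.
Proof. by have [_ v1 _] := alghom_vsval B1; rewrite -[in RHS]v1. Qed.

Let F' : Bt' := Subvs FB.

(** A lifting problem is solved on the two parts of [P] separately. On [c P] the action comes
    through [phi], and projectivity over [B] applies; on [(1 - c) P] the algebra [B'] acts through
    [chi], and multiplying a linear lift by [F] makes it [B']-linear. *)
Lemma corner_projective (P : fdmod Bt) : projective P -> projective (res_sigma P).
Proof.
move=> hP M N g f hg gf hf.
have hf1 : @mhom _ _ P (pull alghom_corner_phi N) (f \o act P corner_c)%VF.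
  move=> b x; rewrite !comp_lfunE -actME corner_cC -corner_hc actME.
  by rewrite [f _]hf.
have [h1 hh1 h1E] := hP _ _ _ _ (mhom_pull (hf := alghom_corner_phi) hg) gf hf1.
have scal b x : act P (corner_sigma b) (act P (1 - corner_c) x)
    = chi (vsval b) *: act P (1 - corner_c) x.
  rewrite -actME -actZ; congr (act P _ x); apply: val_inj.
  change (sigma (vsval b) * vsval (1 - corner_c) = chi (vsval b) *: vsval (1 - corner_c)).
  by rewrite c1E chic ?subvsP.
pose h2 : 'Hom(P, M) := (act M F' \o g^-1 \o f \o act P (1 - corner_c))%VF.
have h2E x : h2 x = act M F' ((g^-1)%VF (f (act P (1 - corner_c) x))).
  by rewrite /h2 !comp_lfunE.
have hh2 : @mhom _ _ (res_sigma P) M h2.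
  move=> b x; rewrite !h2E /= -[in LHS]actME.
  have -> : (1 - corner_c) * corner_sigma b = corner_sigma b * (1 - corner_c).
    by rewrite mulrBl mulrBr mul1r mulr1 corner_cC.
  rewrite actME scal !linearZ /= -actME -actZ; congr (act M _ _).
  by apply: val_inj => /=; rewrite Fl ?subvsP.
exists (h1 + h2).
  apply: mhomD => // b x; rewrite [LHS]hh1 /=.
  by rewrite [corner_phi _]corner_sigmaK.
apply/lfunP => x; rewrite comp_lfunE add_lfunE linearD /=.
have -> : g (h1 x) = f (act P corner_c x) by rewrite -comp_lfunE h1E comp_lfunE.
rewrite h2E hg limg_lfunVK ?gf ?memvf //.
rewrite -[X in _ + X](hf F') /= scal chiF scale1r -linearD /= -actD.
by rewrite addrC subrK act1E.
Qed.

(** Restriction along [sigma] turns [P] into a resolution of [M']. Cocycles are pushed down by [w]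
    and [th] and pulled back after multiplication by [c], which is harmless because [c] acts as 1 on
    [N] and [tens N]. *)
Lemma corner_ext_unit_iso k (M N : fdmod Bt) (M' N' : fdmod Bt')
    (u : 'Hom(M, M')) (w : 'Hom(N, N')) (hex' : tens_exact B') :
    (forall b x, u (act M b x) = act M' (corner_phi b) (u x)) ->
    lker u = 0%VS -> limg u = fullv ->
    (forall b x, w (act N b x) = act N' (corner_phi b) (w x)) ->
    lker w = 0%VS -> limg w = fullv ->
    ext_map_iso k M' N' ->
  forall P : resolution M, ext_unit_iso B1 k N P.
Proof.
move=> hu u0 uf hw w0 wf iso P.
have dP j : mhom (res_d P j) by apply: res_d_hom.
have dP' j : @mhom _ _ (res_sigma (res P j.+1)) (res_sigma (res P j)) (res_d P j).
  exact: (mhom_pull (hf := alghom_corner_sigma) (dP j)).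
have aP : mhom (res_aug P) by apply: res_aug_hom.
have pP j : projective (res_sigma (res P j)) by apply/corner_projective/res_projective.
have hua : @mhom _ _ (res_sigma (res P 0)) M' (u \o res_aug P)%VF by apply: semilinear_down.
have uaf : limg (u \o res_aug P) = fullv by rewrite limg_comp res_aug_onto.
have uae : limg (res_d P 0) = lker (u \o res_aug P).
  by rewrite lker_comp_inj // res_exact0.
pose P' : resolution M' := @Resolution K Bt' M' (fun j => res_sigma (res P j))
  (res_d P) (u \o res_aug P)%VF pP dP' hua uaf uae (@res_exactS _ _ _ P).
have [inj sur] := ext_unit_iso_of B'1 hex' P' iso.
have [th [thE thA th0 thf]] := corner_semilinear hw w0 wf.
have hth b (x : res_to B1 (tens N)) : th (act (res_to B1 (tens N)) b x)
    = act (res_to B'1 (tens N')) (corner_phi b) (th x).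
  exact: thA.
have thc z : th z = th (act (tens N) c z) by rewrite thA phic act1E.
have down j (g : 'Hom(res P j, res_to B1 (tens N))) (hg : mhom g) :
  @mhom _ _ (res_sigma (res P j)) (res_to B'1 (tens N')) (th \o g)%VF :=
  @semilinear_down (res_to B1 (tens N)) (res_to B'1 (tens N')) th hth _ g hg.
split=> [f [hf /lfunP f0] g hg gE|g [hg /lfunP g0]].
  have [h hh /lfunP hE] : @coboundary _ _ _ P' N' k (w \o f)%VF.
    apply: (inj _ _ (th \o g)%VF).
    - split; first exact: (semilinear_down hw).
      apply/lfunP => x; rewrite comp_lfunE zero_lfunE [LHS]comp_lfunE.
      by have := f0 x; rewrite comp_lfunE zero_lfunE => ->; rewrite linear0.
    - exact: down.
    - by move=> x; rewrite !comp_lfunE -gE thE (alghom1 hphi).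
  have [h' hh' h'E] := semilinear_up hw w0 wf hh.
  exists h' => //; apply/lfunP => x; rewrite comp_lfunE.
  apply/eqP; rewrite -subr_eq0; apply/eqP/((lker_eq0P _).1 w0).
  rewrite linearB /= h'E -dP.
  have := hE (act (res P k.+1) corner_c x); rewrite !comp_lfunE => <-.
  by rewrite hf (semilinear_c hw w0) subrr.
have [|f' [hf' /lfunP f'0] [h' hh' h'E]] := sur (th \o g)%VF.
  split; first exact: down.
  apply/lfunP => x; rewrite comp_lfunE zero_lfunE [LHS]comp_lfunE.
  by have := g0 x; rewrite comp_lfunE zero_lfunE => ->; rewrite linear0.
have [f hf fE] := semilinear_up hw w0 wf hf'.
have [h hh hE] := @semilinear_up (res_to B1 (tens N)) (res_to B'1 (tens N'))
  th hth th0 thf _ _ hh'.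
exists f.
  split=> //; apply/lfunP => x; rewrite comp_lfunE zero_lfunE.
  apply/((lker_eq0P _).1 w0); rewrite fE -dP.
  by have := f'0 (act (res P k.+2) corner_c x); rewrite comp_lfunE zero_lfunE.
exists h => // x; apply/eqP; rewrite -subr_eq0; apply/eqP/((lker_eq0P _).1 th0).
rewrite !linearB /= hE -dP -h'E thE (alghom1 hphi) fE comp_lfunE hg /=.
by rewrite -thc subrr.
Qed.

End Corner.

(** By balancing, [c1] and [c2] split every tensor naturally into two summands, on which exactness
    is tested. *)
Lemma tens_exact_corners (K : fieldType) (A : falgType K) (B : {aspace A})
    (c1 c2 : A) (c1B : c1 \in B) (c2B : c2 \in B) : c1 + c2 = 1 -> 1 \in B ->
    (forall b, b \in B -> b * c1 = c1 * b) -> (forall b, b \in B -> b * c2 = c2 * b) ->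
    (forall (M' M M'' : fdmod (subvs_of B)) (f : 'Hom(M', M)) (g : 'Hom(M, M'')),
       mhom f -> mhom g -> lker f = 0%VS -> limg f = lker g ->
     forall c (cB : c \in B), c = c1 \/ c = c2 ->
     (forall x, tens_map f x = 0 -> tens_map (act M' (Subvs cB)) x = 0) /\
     (forall y, tens_map g y = 0 -> exists z, tens_map f z = tens_map (act M (Subvs cB)) y)) ->
  tens_exact B.
Proof.
move=> c12 B1 cC1 cC2 hc M' M M'' f g hf hg f0 fg gf.
have [inj1 ex1] := hc _ _ _ f g hf hg f0 fg _ c1B (or_introl erefl).
have [inj2 ex2] := hc _ _ _ f g hf hg f0 fg _ c2B (or_intror erefl).
have hC c (cB : c \in B) (N : fdmod (subvs_of B)) :
    (forall b, b \in B -> b * c = c * b) -> mhom (act N (Subvs cB)).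
  move=> cC b x; rewrite -!actME; congr (act N _ x); apply: val_inj => /=.
  by rewrite cC ?subvsP.
have split N (x : tens N) :
    x = tens_map (act N (Subvs c1B)) x + tens_map (act N (Subvs c2B)) x.
  rewrite -add_lfunE -[LHS]id_lfunE; congr (fun_of_lfun _ x).
  apply: tens_ext => a y; rewrite id_lfunE add_lfunE !tens_map_pure; try exact: hC.
  by rewrite -!pure_balanced /= -pureDl -mulrDr c12 mulr1.
split.
- by apply/lker_eq0P => x fx; rewrite [x]split inj1 // inj2 // addr0.
- apply/exactP; split=> [x|y gy].
    rewrite -[LHS]comp_lfunE -tens_map_comp // (_ : (g \o f)%VF = 0).
      by rewrite tens_map0 zero_lfunE.
    apply/lfunP => y; rewrite comp_lfunE zero_lfunE.
    by have [h _] := (exactP _ _).1 fg; apply: h.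
  have [z1 e1] := ex1 _ gy; have [z2 e2] := ex2 _ gy.
  by exists (z1 + z2); rewrite linearD /= e1 e2 -split.
- exact: tens_map_onto.
Qed.

(* A is the fibre product of A1 and A2 over K, where chi is the common
   character, B that of B1 and B2, and F1, F2 span the factors of B1 and B2 on
   which chi lives; s1 a is the element (a, chi a). *)
Record gluing (K : fieldType) (A A1 A2 : falgType K) (p1 : A -> A1) (p2 : A -> A2)
    (s1 : A1 -> A) (s2 : A2 -> A) (chi : A -> K)
    (B : {aspace A}) (B1 : {aspace A1}) (B2 : {aspace A2}) (F1 : A1) (F2 : A2) : Prop :=
  Gluing {
    gl_p1 : alghom p1; gl_p2 : alghom p2;
    gl_s1 : alghom s1; gl_s2 : alghom s2;
    gl_s1K : cancel s1 p1; gl_s2K : cancel s2 p2;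
    gl_s1p2 : forall a, p2 (s1 a) = chi (s1 a) *: 1;
    gl_s2p1 : forall a, p1 (s2 a) = chi (s2 a) *: 1;
    gl_chi1 : forall a, chi (s1 (p1 a)) = chi a;
    gl_chi2 : forall a, chi (s2 (p2 a)) = chi a;
    gl_inj : forall a b, p1 a = p1 b -> p2 a = p2 b -> a = b;
    gl_B : forall a, (a \in B) = (p1 a \in B1) && (p2 a \in B2);
    gl_1B1 : 1 \in B1; gl_1B2 : 1 \in B2;
    gl_F1B : F1 \in B1; gl_F2B : F2 \in B2;
    gl_F1l : forall a, a * F1 = chi (s1 a) *: F1;
    gl_F2l : forall a, a * F2 = chi (s2 a) *: F2;
    gl_F1r : forall b, b \in B1 -> F1 * b = chi (s1 b) *: F1;
    gl_F2r : forall b, b \in B2 -> F2 * b = chi (s2 b) *: F2;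
    gl_chiF1 : chi (s1 F1) = 1; gl_chiF2 : chi (s2 F2) = 1;
    gl_chi_lin : forall k a b, chi (k *: a + b) = k * chi a + chi b;
    gl_chi_1 : chi 1 = 1
  }.

Lemma gluing_sym (K : fieldType) (A A1 A2 : falgType K) (p1 : A -> A1) (p2 : A -> A2)
    (s1 : A1 -> A) (s2 : A2 -> A) (chi : A -> K)
    (B : {aspace A}) (B1 : {aspace A1}) (B2 : {aspace A2}) (F1 : A1) (F2 : A2) :
  gluing p1 p2 s1 s2 chi B B1 B2 F1 F2 -> gluing p2 p1 s2 s1 chi B B2 B1 F2 F1.
Proof.
by case=> *; split=> // => [a b e1 e2|a]; [eauto | rewrite andbC; eauto].
Qed.

(** * One side of the glued algebra *)

Section Side.
Variables (K : fieldType) (A A1 A2 : falgType K) (p1 : A -> A1) (p2 : A -> A2).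
Variables (s1 : A1 -> A) (s2 : A2 -> A) (chiv : A -> K).
Variables (B : {aspace A}) (B1 : {aspace A1}) (B2 : {aspace A2}) (F1 : A1) (F2 : A2).
Hypothesis G : gluing p1 p2 s1 s2 chiv B B1 B2 F1 F2.

Let hp1 := gl_p1 G.
Let hp2 := gl_p2 G.
Let hs1 := gl_s1 G.
Let hs2 := gl_s2 G.

Lemma gl_chi0 : chiv 0 = 0.
Proof.
by have := gl_chi_lin G (-1) 1 1; rewrite scaleN1r addNr => ->; rewrite mulN1r addNr.
Qed.

Lemma gl_chiB a b : chiv (a - b) = chiv a - chiv b.
Proof. by rewrite addrC -scaleN1r (gl_chi_lin G) mulN1r addrC. Qed.

Lemma gl_1B : 1 \in B.
Proof. by rewrite (gl_B G) (alghom1 hp1) (alghom1 hp2) (gl_1B1 G) (gl_1B2 G). Qed.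

Lemma gl_F1F1 : F1 * F1 = F1.
Proof. by rewrite (gl_F1l G) (gl_chiF1 G) scale1r. Qed.

Lemma gl_p1B b : b \in B -> p1 b \in B1.
Proof. by rewrite (gl_B G) => /andP[]. Qed.

Lemma gl_s1B b : b \in B1 -> s1 b \in B.
Proof. by move=> bB; rewrite (gl_B G) (gl_s1K G) bB (gl_s1p2 G) memvZ // (gl_1B2 G). Qed.

(* The idempotents f1 = (1 - F1, 0) and f2 = (0, 1 - F2) of B. *)
Definition gl_f1 : A := s1 (1 - F1).
Definition gl_f2 : A := s2 (1 - F2).

Lemma p1f1 : p1 gl_f1 = 1 - F1. Proof. exact: (gl_s1K G). Qed.
Lemma p2f1 : p2 gl_f1 = 0.
Proof.
rewrite (gl_s1p2 G) (alghomB hs1) gl_chiB (alghom1 hs1) (gl_chi_1 G) (gl_chiF1 G).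
by rewrite subrr scale0r.
Qed.
Lemma p2f2 : p2 gl_f2 = 1 - F2. Proof. exact: (gl_s2K G). Qed.
Lemma p1f2 : p1 gl_f2 = 0.
Proof.
rewrite (gl_s2p1 G) (alghomB hs2) gl_chiB (alghom1 hs2) (gl_chi_1 G) (gl_chiF2 G).
by rewrite subrr scale0r.
Qed.

Lemma f1B : gl_f1 \in B.
Proof. by apply: gl_s1B; rewrite memvB ?(gl_1B1 G) ?(gl_F1B G). Qed.

Lemma f2B : gl_f2 \in B.
Proof.
by rewrite (gl_B G) p1f2 mem0v p2f2 memvB ?(gl_1B2 G) ?(gl_F2B G).
Qed.

Lemma f1C b : b \in B -> b * gl_f1 = gl_f1 * b.
Proof.
move=> bB; apply: (gl_inj G); rewrite !alghomM // ?p1f1 ?p2f1 ?mulr0 ?mul0r //.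
by rewrite mulrBr mulrBl mulr1 mul1r (gl_F1l G) (gl_F1r G) ?gl_p1B.
Qed.

Lemma f1f1 : gl_f1 * gl_f1 = gl_f1.
Proof. by rewrite -(alghomM hs1) mulrBr mulr1 mulrBl mul1r gl_F1F1 subrr subr0. Qed.

Lemma f1f2 : gl_f1 * gl_f2 = 0.
Proof.
apply: (gl_inj G); rewrite alghomM // ?p1f2 ?p2f1 ?mulr0 ?mul0r ?alghom0 //.
Qed.

End Side.

Lemma gl_f2C (K : fieldType) (A A1 A2 : falgType K) p1 p2 s1 s2 chiv
    (B : {aspace A}) (B1 : {aspace A1}) (B2 : {aspace A2}) F1 F2 :
  gluing p1 p2 s1 s2 chiv B B1 B2 F1 F2 ->
  forall b, b \in B -> b * gl_f2 s2 F2 = gl_f2 s2 F2 * b.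
Proof. by move=> G b; apply: (f1C (gluing_sym G)). Qed.

Lemma split_basic_misom (K : fieldType) (A A1 : falgType K) (p : A -> A1) (hp : alghom p)
    (I J : finType) (L : I -> fdmod A) chi e rad (hA : split_basic L chi e rad)
    (L1 : J -> fdmod A1) chi1 e1 rad1 (hA1 : split_basic L1 chi1 e1 rad1) i j :
  (forall a, chi i a = chi1 j (p a)) -> misom (pull hp (L1 j)) (L i).
Proof.
move=> chiE; have [x xn0] := L_neq0 hA1 j; have [y yn0] := L_neq0 hA i.
have [||u [u0 uf]] := line_iso xn0 yn0.
- by move=> z; apply: (L_line hA1).
- by move=> z; apply: (L_line hA).
exists u; split=> // a z.
by rewrite /= (chi_act hA1) (chi_act hA) chiE linearZ.
Qed.

Section SideModules.
Variables (K : fieldType) (A A1 A2 : falgType K) (p1 : A -> A1) (p2 : A -> A2).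
Variables (s1 : A1 -> A) (s2 : A2 -> A) (chiv : A -> K).
Variables (B : {aspace A}) (B1 : {aspace A1}) (B2 : {aspace A2}) (F1 : A1) (F2 : A2).
Hypothesis G : gluing p1 p2 s1 s2 chiv B B1 B2 F1 F2.

Let hp1 := gl_p1 G.
Let hp2 := gl_p2 G.
Let hs1 := gl_s1 G.
Let hs2 := gl_s2 G.
Local Notation f1 := (gl_f1 s1 F1).
Local Notation f2 := (gl_f2 s2 F2).
(** Its components are [1] and [F2]: the first side, with [v] included. *)
Let c1 := 1 - f2.
Variable iB : 1 \in B.

Let p1c : p1 c1 = 1.
Proof. by rewrite (alghomB hp1) (alghom1 hp1) (p1f2 G) subr0. Qed.

Let p2c : p2 c1 = F2.
Proof. by rewrite (alghomB hp2) (alghom1 hp2) (p2f2 G) opprB addrC subrK. Qed.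

Let c1B : c1 \in B.
Proof. by rewrite memvB ?iB ?(f2B G). Qed.

Let c1C b : b \in B -> b * c1 = c1 * b.
Proof. by move=> bB; rewrite mulrBl mulrBr mulr1 mul1r (gl_f2C G). Qed.

Let f2f2 : f2 * f2 = f2. Proof. exact: (f1f1 (gluing_sym G)). Qed.

Let c1c1 : c1 * c1 = c1.
Proof. by rewrite mulrBl mul1r mulrBr mulr1 f2f2 subrr subr0. Qed.

Let hc1 a : s1 (p1 a) * c1 = a * c1.
Proof.
(* In the second component both sides equal [chiv a *: F2]; this is where the whole of [A2] has to
   act on [F2] by scalars. *)
apply: (gl_inj G); rewrite !alghomM // ?p1c ?p2c ?(gl_s1K G) //.
by rewrite (gl_s1p2 G) (gl_chi1 G) -scalerAl mul1r (gl_F2l G) (gl_chi2 G).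
Qed.

Let chic1 b : b \in B1 -> s1 b * (1 - c1) = chiv (s1 b) *: (1 - c1).
Proof.
move=> _; rewrite subKr; apply: (gl_inj G).
  by rewrite alghomM // alghomZ // (p1f2 G) mulr0 scaler0.
by rewrite alghomM // alghomZ // (gl_s1p2 G) -scalerAl mul1r.
Qed.

Lemma side_exact1 (M' M M'' : fdmod (subvs_of B)) (f : 'Hom(M', M)) (g : 'Hom(M, M''))
    c (cB : c \in B) :
    c = 1 - f2 -> tens_exact B1 -> mhom f -> mhom g -> lker f = 0%VS -> limg f = lker g ->
  (forall x, tens_map f x = 0 -> tens_map (act M' (Subvs cB)) x = 0) /\
  (forall y, tens_map g y = 0 -> exists z, tens_map f z = tens_map (act M (Subvs cB)) y).
Proof.
move=> ce; subst c.
exact: (corner_exact hp1 hs1 iB (gl_1B1 G) (gl_p1B G) (gl_s1B G) cB c1C c1c1 hc1).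
Qed.

Lemma side_exact2 (M' M M'' : fdmod (subvs_of B)) (f : 'Hom(M', M)) (g : 'Hom(M, M''))
    (cB : f1 \in B) :
    tens_exact B1 -> mhom f -> mhom g -> lker f = 0%VS -> limg f = lker g ->
  (forall x, tens_map f x = 0 -> tens_map (act M' (Subvs cB)) x = 0) /\
  (forall y, tens_map g y = 0 -> exists z, tens_map f z = tens_map (act M (Subvs cB)) y).
Proof.
apply: (corner_exact hp1 hs1 iB (gl_1B1 G) (gl_p1B G) (gl_s1B G) cB (f1C G) (f1f1 G)).
move=> a; apply: (gl_inj G); rewrite !alghomM // ?(p1f1 G) ?(p2f1 G) ?mulr0 //.
by rewrite (gl_s1K G).
Qed.

Variables (I J : finType) (L : I -> fdmod A) (chi : I -> A -> K) (e : I -> A).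
Variables (rad : {vspace A}) (hA : split_basic L chi e rad).
Variables (L1 : J -> fdmod A1) (chi1 : J -> A1 -> K) (e1 : J -> A1).
Variables (rad1 : {vspace A1}) (hA1 : split_basic L1 chi1 e1 rad1).
Variables (vJ : J -> I) (vJ_inj : injective vJ).
Variables (le : rel I).
Hypothesis le_refl : reflexive le.
Hypothesis chiE : forall j a, chi (vJ j) a = chi1 j (p1 a).
Hypothesis Lout : forall i, (exists j, vJ j = i) \/ chi i f2 = 1.
Hypothesis LoutA : forall i, (exists j, vJ j = i) \/ exists2 a, p1 a = 0 & chi i a != 0.
Variable cA : A.
Hypotheses (p1cA : p1 cA = 1) (hcA : forall a, cA * s1 (p1 a) = a * cA).
Local Notation le1 := (relpre vJ le).
Let le1_refl : reflexive le1. Proof. by move=> j; apply: le_refl. Qed.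
Variables (LB1 : J -> fdmod (subvs_of B1)) (hB1 : exact_borel L1 le1 LB1).

Local Notation bp := (corner_phi (gl_p1B G)).
Local Notation bs := (corner_sigma (gl_s1B G)).
Let hbp : alghom bp := alghom_corner_phi hp1 iB (gl_1B1 G) (gl_p1B G).
Let hbs : alghom bs := alghom_corner_sigma hs1 iB (gl_1B1 G) (gl_s1B G).
Let bsK : cancel bs bp. Proof. by move=> b; apply: val_inj; apply: (gl_s1K G). Qed.

Definition LB (i : I) : fdmod (subvs_of B) := res_to iB (L i).

Lemma LB_act i b x : act (LB i) b x = chi i (vsval b) *: x.
Proof. exact: (chi_act hA). Qed.

Lemma LB_simple i : simple (LB i).
Proof.
have [dL hL] := simple_split hA i; split=> // U _; apply: hL; apply/submodP => a x xU.
by rewrite (chi_act hA) memvZ.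
Qed.

Lemma side_semilinear j : exists u : 'Hom(LB (vJ j), LB1 j),
  [/\ forall b x, u (act (LB (vJ j)) b x) = act (LB1 j) (bp b) (u x),
      lker u = 0%VS & limg u = fullv].
Proof.
have [w [wn0 [lam lamE] actw]] := borel_line hA1 le1_refl hB1 j.
have [x xn0] := L_neq0 hA (vJ j).
have [||u [u0 uf]] := line_iso xn0 wn0.
- by move=> z; apply: (L_line hA).
- by move=> z; exists (lam z); apply: lamE.
by exists u; split=> // b z; rewrite LB_act chiE linearZ actw.
Qed.

Lemma LB1_misom j : misom (pull hbp (LB1 j)) (LB (vJ j)).
Proof.
by have [u [hu u0 uf]] := side_semilinear j; apply: misom_sym; exists u; split.
Qed.

(** If [p1 b = 0], then [chiv b = 0] and [p2 b] annihilates [F2], so [b = b * f2]. *)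
Lemma killed_of_f2 (M : fdmod (subvs_of B)) (fB : f2 \in B) :
  (forall x, act M (Subvs fB) x = 0) -> killed bp M.
Proof.
move=> h b hb x.
have p1b : p1 (vsval b) = 0 by have := congr1 vsval hb.
have -> : b = b * Subvs fB.
  apply: val_inj => /=; apply: (gl_inj G); rewrite alghomM // ?p1b ?mul0r //.
  rewrite (p2f2 G) mulrBr mulr1 (gl_F2l G) (gl_chi2 G) -(gl_chi1 G) p1b.
  by rewrite alghom0 // (gl_chi0 G) scale0r subr0.
by rewrite actME h linear0.
Qed.

Lemma f2_side j : chi (vJ j) f2 = 0.
Proof. by rewrite chiE (p1f2 G) (chi0 hA1). Qed.

Lemma side_simples (S : fdmod (subvs_of B)) (fB : f2 \in B) : simple S ->
  (forall x, act S (Subvs fB) x = 0) -> exists j, misom S (LB (vJ j)).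
Proof.
move=> hS h; have kS := killed_of_f2 h.
have [_ [[_ _ comp] _ _] _ _] := hB1.
have [j hj] := comp _ (simple_down hbp hbs bsK kS hS).
exists j; apply: misom_trans (LB1_misom j).
exact: (misom_up hbp bsK kS hj).
Qed.

Let LBout i : (exists j, vJ j = i) \/
  (exists2 a, bp a = 0 & exists x, act (LB i) a x != 0).
Proof.
have [|f2i] := Lout i; [by left|right; exists (Subvs (f2B G))].
  by apply: val_inj; apply: (p1f2 G).
have [x xn0] := L_neq0 hA i; exists x.
by rewrite LB_act /= f2i scale1r.
Qed.

Let bc := corner_c c1B.
Let bpc : bp bc = 1. Proof. exact: (corner_phi_c (gl_1B1 G) (gl_p1B G) c1B p1c). Qed.

Let hbc b : bc * bs (bp b) = b * bc.
Proof.
rewrite (corner_cC c1B c1C).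
exact: (corner_hc (gl_p1B G) (gl_s1B G) c1B hc1).
Qed.

(** The central idempotent [f2] kills the simple module, hence its projective cover. *)
Let cover_killed j (P : fdmod (subvs_of B)) (p : 'Hom(P, LB (vJ j))) :
  proj_cover p -> killed bp P.
Proof.
move=> hp; apply: (killed_of_f2 (fB := f2B G)); apply: proj_cover_central hp => [b||x].
- by apply: val_inj => /=; rewrite (gl_f2C G) ?subvsP.
- exact: val_inj.
- by rewrite LB_act f2_side scale0r.
Qed.

Lemma side_quasi_hereditary j (P D : fdmod (subvs_of B)) (p : 'Hom(P, LB (vJ j)))
    (q : 'Hom(P, D)) (r : 'Hom(D, LB (vJ j))) :
    proj_cover p -> largest_quotient LB le (vJ j) q -> mhom r -> p = (r \o q)%VF ->
  (exists2 s, filtration (is_standard LB le) (lker q) s & all (slt le (vJ j)) s) /\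
  (exists2 s, filtration (is_simple_at LB) (lker r) s
            & all (fun k => slt le k (vJ j)) s).
Proof.
move=> hp hq hr pE; have [_ [_ qh1 _] _ _] := hB1.
exact: (quasi_hereditary_up hbs bsK bpc hbc LB1_misom LBout qh1 (cover_killed hp)
  hp hq hr pE vJ_inj).
Qed.

Lemma side_standard_simple j D : is_standard LB le (vJ j) D -> simple D.
Proof.
case=> P [q [[p hp] hq]]; have [_ [_ _ ss1] _ _] := hB1.
exact: (standard_simple_up hbs bsK LB1_misom LBout ss1 (cover_killed hp) hp hq).
Qed.

Lemma pull_standard j (D : fdmod A1) :
  is_standard L1 le1 j D -> is_standard L le (vJ j) (pull hp1 D).
Proof.
move=> hD; apply: (is_standard_pull hs1 (gl_s1K G) p1cA hcA (fun j => split_basic_misom hp1 hA hA1 (chiE j)) _ hD).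
move=> i; have [|[a ha hi]] := LoutA i; [by left|right; exists a => //].
have [x xn0] := L_neq0 hA i; exists x.
by rewrite (chi_act hA) scaler_eq0 (negbTE xn0) orbF.
Qed.

Lemma side_standard j : is_standard L le (vJ j) (tens (LB (vJ j))).
Proof.
have [_ _ _ st1] := hB1; have [u [hu u0 uf]] := side_semilinear j.
apply: is_standard_iso (pull_standard (st1 j)); apply: misom_sym.
exact: (corner_misom hp1 hs1 (gl_s1K G) (gl_1B1 G) (gl_s1B G) c1B hc1 p1c hu u0 uf).
Qed.

Lemma side_ext k j j' : ext_map_iso k (LB1 j) (LB1 j') ->
  forall P : resolution (LB (vJ j)), ext_unit_iso iB k (LB (vJ j')) P.
Proof.
have [u [hu u0 uf]] := side_semilinear j; have [w [hw w0 wf]] := side_semilinear j'.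
have [_ _ hex _] := hB1 => iso P.
have F1l b : b \in B1 -> b * F1 = chiv (s1 b) *: F1 by rewrite (gl_F1l G).
exact: (corner_ext_unit_iso hp1 hs1 (gl_s1K G) iB (gl_1B1 G) (gl_s1B G) c1B c1C hc1
  p1c (gl_F1B G) (gl_chiF1 G) F1l chic1 hex hu u0 uf hw w0 wf iso).
Qed.

Lemma side_tens_f2 j z : act (tens (LB (vJ j))) f2 z = 0.
Proof.
have [u [hu u0 uf]] := side_semilinear j.
have [th [_ thA /lker_eq0P th0 _]] := corner_semilinear hp1 hs1 (gl_s1K G) (gl_1B1 G)
  (gl_s1B G) c1B hc1 p1c hu u0 uf.
by apply: th0; rewrite thA (p1f2 G) act0.
Qed.

Lemma side_separating j j' : j != j' ->
  exists2 b, b \in B & chi (vJ j) b != chi (vJ j') b.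
Proof.
move=> jj'; have [b bB hb] := borel_separating hA1 le1_refl hB1 jj'.
by exists (s1 b); [apply: (gl_s1B G)|rewrite !chiE (gl_s1K G)].
Qed.

End SideModules.

(** * Gluing the two exact Borel subalgebras *)

Section Glue.
Variables (K : fieldType) (A A1 A2 : falgType K) (p1 : A -> A1) (p2 : A -> A2).
Variables (s1 : A1 -> A) (s2 : A2 -> A) (chiv : A -> K).
Variables (B : {aspace A}) (B1 : {aspace A1}) (B2 : {aspace A2}) (F1 : A1) (F2 : A2).
Hypothesis G : gluing p1 p2 s1 s2 chiv B B1 B2 F1 F2.
Variables (I J1 J2 : finType) (L : I -> fdmod A) (chi : I -> A -> K) (e : I -> A).
Variables (rad : {vspace A}) (hA : split_basic L chi e rad).
Variables (L1 : J1 -> fdmod A1) (chi1 : J1 -> A1 -> K) (e1 : J1 -> A1).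
Variables (rad1 : {vspace A1}) (hA1 : split_basic L1 chi1 e1 rad1).
Variables (L2 : J2 -> fdmod A2) (chi2 : J2 -> A2 -> K) (e2 : J2 -> A2).
Variables (rad2 : {vspace A2}) (hA2 : split_basic L2 chi2 e2 rad2).
Variables (v1 : J1 -> I) (v1_inj : injective v1) (v2 : J2 -> I) (v2_inj : injective v2).
Variables (le : rel I).
Hypothesis le_refl : reflexive le.
Hypotheses (chi1E : forall j a, chi (v1 j) a = chi1 j (p1 a)).
Hypotheses (chi2E : forall j a, chi (v2 j) a = chi2 j (p2 a)).
Hypothesis cover : forall i, (exists j, v1 j = i) \/ (exists j, v2 j = i).
Hypothesis Lout1 : forall i, (exists j, v1 j = i) \/ chi i (gl_f2 s2 F2) = 1.
Hypothesis Lout2 : forall i, (exists j, v2 j = i) \/ chi i (gl_f2 s1 F1) = 1.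
Hypothesis LoutA1 : forall i, (exists j, v1 j = i) \/ exists2 a, p1 a = 0 & chi i a != 0.
Hypothesis LoutA2 : forall i, (exists j, v2 j = i) \/ exists2 a, p2 a = 0 & chi i a != 0.
Variables c1 c2 : A.
Hypotheses (p1c : p1 c1 = 1) (hc1 : forall a, c1 * s1 (p1 a) = a * c1).
Hypotheses (p2c : p2 c2 = 1) (hc2 : forall a, c2 * s2 (p2 a) = a * c2).
Variables (LB1 : J1 -> fdmod (subvs_of B1)) (LB2 : J2 -> fdmod (subvs_of B2)).
Hypotheses (hB1 : exact_borel L1 (relpre v1 le) LB1).
Hypotheses (hB2 : exact_borel L2 (relpre v2 le) LB2).

Let iB : 1 \in B := gl_1B G.
Let G' := gluing_sym G.
Local Notation LBg := (LB iB L).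
Local Notation f1 := (gl_f1 s1 F1).
Local Notation f2 := (gl_f2 s2 F2).

Let separated i k : i != k -> exists2 b, b \in B & chi i b != chi k b.
Proof.
have f2n j i' : v1 j = i' -> chi i' f2 = 0 by move=> <-; apply: (f2_side G hA1 chi1E).
have in2 i' : chi i' f2 = 1 -> exists j, v2 j = i'.
  by move=> h; have [[j /f2n]|//] := cover i'; rewrite h => /eqP; rewrite oner_eq0.
move=> ik; have [[j ji]|fi] := Lout1 i; have [[j' jk]|fk] := Lout1 k.
- subst i k; apply: (side_separating G hA1 le_refl chi1E hB1).
  by apply: contraNneq ik => ->.
- exists f2; first exact: (f2B G).
  by rewrite (f2n j) // fk eq_sym oner_eq0.
- exists f2; first exact: (f2B G).
  by rewrite (f2n j' k) // fi oner_eq0.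
- have [j ji] := in2 _ fi; have [j' jk] := in2 _ fk; subst i k.
  apply: (side_separating G' hA2 le_refl chi2E hB2).
  by apply: contraNneq ik => ->.
Qed.

Let glued_simples : complete_simples LBg.
Proof.
split=> [i|i k [g [hg g0 gf]]|S hS]; first exact: (LB_simple iB hA).
  apply/eqP; apply: contraT => /separated[b bB /eqP[]].
  have [x xn0] := L_neq0 hA i.
  have gx : g x != 0 by apply: contraNneq xn0 => /((lker_eq0P _).1 g0) ->.
  apply: (scaler_neq0_inj gx).
  have := hg (Subvs bB) x; rewrite !(LB_act hA) linearZ /=; exact.
(* As [f2 * f1 = 0], the kernel of the action of [f2] leaves two cases: [f2] acts injectively and
   then [f1] by 0, or [f2] acts by 0. *)
have hmul x : act S (Subvs (f2B G)) (act S (Subvs (f1B G)) x) = 0.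
  rewrite -actME -(act0 (M := S) x); congr (act S _ x); apply: val_inj => /=.
  by rewrite -(gl_f2C G) ?(f1B G) // (f1f2 G).
have hm : mhom (act S (Subvs (f2B G))).
  move=> b x; rewrite -!actME; congr (act S _ x); apply: val_inj => /=.
  by rewrite (gl_f2C G) ?subvsP.
have [_ hSU] := hS; have [/lker_eq0P h|h] := hSU _ (submod_ker hm).
  have [j hj] : exists j, misom S (LB iB L (v2 j)).
    apply: (side_simples G' iB hA hA2 le_refl chi2E hB2 (fB := f1B G) hS) => x.
    exact/h/hmul.
  by exists (v2 j).
have [j hj] : exists j, misom S (LB iB L (v1 j)).
  apply: (side_simples G iB hA hA1 le_refl chi1E hB1 (fB := f2B G) hS) => x.
  by apply/eqP; rewrite -memv_ker h memvf.
by exists (v1 j).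
Qed.

Let glued_exact : tens_exact B.
Proof.
have [_ _ hex1 _] := hB1; have [_ _ hex2 _] := hB2.
have c1B : 1 - f2 \in B by rewrite memvB ?iB ?(f2B G).
(* The part at [v] is counted with the first side only, so that the two central idempotents add up
   to 1. *)
apply: (@tens_exact_corners _ _ _ (1 - f2) f2) => //; try exact: (f2B G).
- exact: subrK.
- by move=> b bB; rewrite mulrBl mulrBr mulr1 mul1r (gl_f2C G).
- exact: (gl_f2C G).
- move=> M' M M'' f g hf hg f0 fg c cB [ce|ce].
    exact: (side_exact1 G iB cB ce hex1 hf hg f0 fg).
  by subst c; apply: (side_exact2 G' iB cB hex2 hf hg f0 fg).
Qed.

(** The central [f] acts as 1 on [LBg i] and as 0 on [LBg i'] and on its induced module, so both Ext
    groups to be compared vanish. *)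
Let mixed_ext k i i' f : f \in B -> (forall b, b \in B -> b * f = f * b) ->
    chi i f = 1 -> chi i' f = 0 -> (forall z, act (tens (LBg i')) f z = 0) ->
  forall P : resolution (LBg i), ext_unit_iso iB k (LBg i') P.
Proof.
move=> fB fC hi hi' ht P; pose a : subvs_of B := Subvs fB.
have aC b : a * b = b * a by apply: val_inj => /=; rewrite fC ?subvsP.
have aM x : act (LBg i) a x = x by rewrite (LB_act hA) /= hi scale1r.
split=> [g hg _ _ _|g hg].
  by apply: (coboundary_of_null aC aM _ hg) => x; rewrite (LB_act hA) /= hi' scale0r.
have [|h hh /lfunP hE] := coboundary_of_null aC aM _ hg; first exact: ht.
exists 0; first by split; [exact: mhom0|rewrite comp_lfun0l].
by exists h => // x; rewrite zero_lfunE pure0r subr0 hE comp_lfunE.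
Qed.

Theorem glued_regular_exact_borel :
    (forall k i j, ext_map_iso k (LB1 i) (LB1 j)) ->
    (forall k i j, ext_map_iso k (LB2 i) (LB2 j)) ->
  regular_exact_borel L le B.
Proof.
move=> iso1 iso2; exists LBg; split.
  split=> //; last first.
    move=> i; have [[j <-]|[j <-]] := cover i.
      exact: (side_standard G iB hA hA1 le_refl chi1E LoutA1 p1c hc1 hB1).
    exact: (side_standard G' iB hA hA2 le_refl chi2E LoutA2 p2c hc2 hB2).
  split=> [||i D hD]; first exact: glued_simples.
    move=> i P D p q r hp hq hr pE; have [[j ji]|[j ji]] := cover i; subst i.
      exact: (side_quasi_hereditary G (iB := iB) hA hA1 v1_inj le_refl chi1E Lout1 hB1 hp hq hr pE).
    exact: (side_quasi_hereditary G' (iB := iB) hA hA2 v2_inj le_refl chi2E Lout2 hB2 hp hq hr pE).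
  have [[j ji]|[j ji]] := cover i; subst i.
    exact: (side_standard_simple G (iB := iB) hA hA1 le_refl chi1E Lout1 hB1 hD).
  exact: (side_standard_simple G' (iB := iB) hA hA2 le_refl chi2E Lout2 hB2 hD).
move=> k i i'; apply: (ext_map_iso_unit (B1 := iB) glued_exact) => P.
have [[j' ji']|[j' ji']] := cover i'; subst i'.
  have [[j ji]|fi] := Lout1 i.
    by subst i; apply: (side_ext G hA hA1 le_refl chi1E hB1 (iso1 k j j')).
  apply: (@mixed_ext k i (v1 j') _ (f2B G) (gl_f2C G) fi (f2_side G hA1 chi1E _)) => z.
  exact: (side_tens_f2 G (iB := iB) hA hA1 le_refl chi1E hB1).
have [[j ji]|fi] := Lout2 i.
  by subst i; apply: (side_ext G' hA hA2 le_refl chi2E hB2 (iso2 k j j')).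
apply: (@mixed_ext k i (v2 j') _ (f1B G) (f1C G) fi (f2_side G' hA2 chi2E _)) => z.
exact: (side_tens_f2 G' (iB := iB) hA hA2 le_refl chi2E hB2).
Qed.
End Glue.

(** * Bound quiver algebras *)

Section PathAlgebraFacts.
Variables (K : fieldType) (Q : quiver).
Local Notation KQ := (path_algebra K Q).
Implicit Types (f g : KQ) (x y : vert Q).

Definition mono (c : K) (p : qpath Q) : KQ := << c *g p >>.
Definition pcoef (p : qpath Q) (f : KQ) : K := f@_p.

Lemma pcoef_lin p c f g : pcoef p (c *: f + g) = c * pcoef p f + pcoef p g.
Proof. by rewrite /pcoef mcoeffD mcoeffZ. Qed.

Lemma pcoefD p f g : pcoef p (f + g) = pcoef p f + pcoef p g.
Proof. exact: mcoeffD. Qed.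

Lemma pcoef_mono p c q : pcoef p (mono c q) = c *+ (q == p).
Proof. exact: mcoeffU. Qed.

Lemma path_algebra_ind (P : KQ -> Prop) :
  P 0 -> (forall f g, P f -> P g -> P (f + g)) -> (forall c p, P (mono c p)) ->
  forall f, P f.
Proof.
move=> P0 PD Pm f; have [s ->] := pmono_expand f.
by elim/big_rec: _ => [|i h _ Ph]; [exact: P0 | apply: PD => //; apply: Pm].
Qed.

Lemma monoM c d p q : mono c p * mono d q = pmono (c * d) (Defs.pcomp p q) :> KQ.
Proof. exact: pamulUU. Qed.

Lemma triv_mono x c p : triv_path x * mono c p = if x == ptgt p then mono c p else 0.
Proof.
by rewrite -[triv_path x]/(mono 1 (pvert x)) monoM mul1r pcomp1p; case: ifP.
Qed.

Lemma mono_triv c p x : mono c p * triv_path x = if x == psrc p then mono c p else 0.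
Proof.
by rewrite -[triv_path x]/(mono 1 (pvert x)) monoM mulr1 pcompp1; case: ifP.
Qed.

Lemma triv_trivE x y : triv_path x * triv_path y = if x == y then triv_path y else 0 :> KQ.
Proof. exact: triv_mono. Qed.

Lemma sum_triv : \sum_x triv_path x = 1 :> KQ.
Proof. by []. Qed.

(** The only path starting at a sink is the trivial one. *)
Lemma sink_triv v f : sink v -> f * triv_path v = pcoef (pvert v) f *: triv_path v.
Proof.
move=> hv; elim/path_algebra_ind: f => [|f g hf hg|c p].
- by rewrite mul0r /pcoef mcoeff0 scale0r.
- by rewrite mulrDl hf hg pcoefD [RHS]scalerDl.
- rewrite mono_triv; case: eqP => [vp|vp].
    have -> : p = pvert v.
      apply: qpath_eq => //; have := path_dataP p; rewrite -/(psrc p) -vp.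
      by case: (path_data p).2 => //= a s; rewrite (negbTE (hv a)).
    by rewrite /pcoef mcoeffU eqxx mulr1n -malgUZ mulr1.
  rewrite /pcoef mcoeffU; case: eqP => [pv|_]; last by rewrite scale0r.
  by case: vp; rewrite pv.
Qed.

Lemma walk_end_closed (V : {set vert Q}) : (forall a, src a \in V -> tgt a \in V) ->
  forall s x, x \in V -> walk x s -> walk_end x s \in V.
Proof.
move=> hV; elim=> [|a s IH] x xV //= /andP[/eqP ax ws].
by apply: IH => //; apply: hV; rewrite ax.
Qed.

Lemma closed_triv (V : {set vert Q}) x u f : (forall a, src a \in V -> tgt a \in V) ->
  x \in V -> u \notin V -> triv_path u * f * triv_path x = 0.
Proof.
move=> hV xV uV; elim/path_algebra_ind: f => [|f g hf hg|c p].
- by rewrite mulr0 mul0r.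
- by rewrite mulrDr mulrDl hf hg addr0.
- rewrite triv_mono; case: eqP => [up|_]; last by rewrite mul0r.
  rewrite mono_triv; case: eqP => [xp|//]; case/negP: uV.
  rewrite up; apply: walk_end_closed => //; first by rewrite -/(psrc p) -xp.
  exact: path_dataP.
Qed.

(** A composite of paths is trivial only if both factors are. This coefficient becomes the character
    of the simple module at [i]. *)
Lemma pcoef_mul i f g : pcoef (pvert i) (f * g) = pcoef (pvert i) f * pcoef (pvert i) g.
Proof.
elim/path_algebra_ind: f => [|f f' hf hf'|c p].
- by rewrite mul0r /pcoef mcoeff0 mul0r.
- by rewrite mulrDl /pcoef !mcoeffD mulrDl -/(pcoef _ _) hf -/(pcoef _ _) hf'.
elim/path_algebra_ind: g => [|g g' hg hg'|d q].
- by rewrite mulr0 /pcoef mcoeff0 mulr0.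
- by rewrite mulrDr /pcoef !mcoeffD mulrDr -/(pcoef _ _) hg -/(pcoef _ _) hg'.
rewrite monoM [X in _ = X * _]pcoef_mono [X in _ = _ * X]pcoef_mono; case: pcompP => [r e1 e2 e3 e4|ne]; last first.
  rewrite [LHS]mcoeff0; case: eqP => [pi|_]; last by rewrite mul0r.
  by case: eqP => [qi|_]; [case: ne; rewrite pi qi | rewrite mulr0].
rewrite [LHS]pcoef_mono; case: (eqVneq r (pvert i)) => [ri|ri].
  move: e4; rewrite ri /= => /esym/eqP.
  rewrite -size_eq0 size_cat addn_eq0 !size_eq0 => /andP[/eqP q0 /eqP p0].
  have qi : q = pvert i by apply: qpath_eq; rewrite // -e2 ri.
  have pi : p = pvert i by apply: qpath_eq; rewrite // e1 qi.
  by rewrite pi qi eqxx !mulr1n.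
case: eqP => [pi|_]; last by rewrite mul0r.
case: eqP => [qi|_]; last by rewrite mulr0.
case/eqP: ri; apply: qpath_eq; first by rewrite e2 qi.
by rewrite e4 pi qi.
Qed.

Lemma arrow_powP m f :
  arrow_ideal_pow m f <-> forall p, (plen p < m)%N -> pcoef p f = 0.
Proof.
split=> [h p pm|h p].
  by apply/eqP; apply: contraTT pm => pf; rewrite -leqNgt; apply: h; rewrite -mcoeff_neq0.
by rewrite -mcoeff_neq0 leqNgt; apply: contra => /h /eqP.
Qed.

Lemma arrow_pow_mul m n f g :
  arrow_ideal_pow m f -> arrow_ideal_pow n g -> arrow_ideal_pow (m + n) (f * g).
Proof.
move=> hf hg; apply/arrow_powP => r hr.
have -> : f * g = \sum_(p <- msupp f) \sum_(q <- msupp g) pmono (f@_p * g@_q) (Defs.pcomp p q) :> KQ.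
  exact: (pamulw (fsubset_refl _) (fsubset_refl _)).
rewrite /pcoef raddf_sum /= big_seq big1 // => p pf.
rewrite raddf_sum /= big_seq big1 // => q qg.
case: pcompP => [s e1 e2 e3 e4|_] /=; last by rewrite mcoeff0.
rewrite mcoeffU; case: eqP => [sr|_ //]; move: hr.
rewrite /plen -sr e4 size_cat ltnNge addnC leq_add //; [exact: hg | exact: hf].
Qed.

Lemma arrow_pow1P f : arrow_ideal_pow 1 f <-> forall i, pcoef (pvert i) f = 0.
Proof.
split=> [/arrow_powP h i|h]; first exact: h.
apply/arrow_powP => p; rewrite ltnS leqn0 size_eq0 => /eqP p0.
by rewrite -[p](_ : pvert (psrc p) = p) //; apply: qpath_eq.
Qed.

End PathAlgebraFacts.

Section BoundQuiver.
Variables (K : fieldType) (Q : quiver) (J : path_algebra K Q -> Prop).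
Variables (A : falgType K) (pi : {lrmorphism path_algebra K Q -> A}).
Hypothesis AE : bound_quiver_algebra J pi.
Local Notation KQ := (path_algebra K Q).
Local Notation I := (vert Q).

Definition bq_e (x : I) : A := pi (triv_path x).

Let pi_onto a : exists f, pi f = a. Proof. by case: AE. Qed.

(** Elements of [J] have no terms of length below 2, so coefficients at trivial paths descend to
    [A]. *)
Lemma pcoef_pi i (f g : KQ) : pi f = pi g -> pcoef (pvert i) f = pcoef (pvert i) g.
Proof.
move=> fg; have [[_ _ J2] _ piJ] := AE.
have /J2/arrow_powP/(_ (pvert i) isT) : J (f - g) by apply/piJ; rewrite raddfB /= fg subrr.
by rewrite -scaleN1r addrC pcoef_lin mulN1r addrC => /eqP; rewrite subr_eq0 => /eqP.
Qed.

Definition bq_chi (i : I) (a : A) : K :=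
  pcoef (pvert i) (proj1_sig (constructive_indefinite_description _ (pi_onto a))).

Lemma bq_chiE i f : bq_chi i (pi f) = pcoef (pvert i) f.
Proof.
by rewrite /bq_chi; case: (constructive_indefinite_description _ _) => g /= /pcoef_pi.
Qed.

Lemma bq_chi_lin i k a b : bq_chi i (k *: a + b) = k * bq_chi i a + bq_chi i b.
Proof.
have [f <-] := pi_onto a; have [g <-] := pi_onto b.
by rewrite -linearP !bq_chiE pcoef_lin.
Qed.

Lemma bq_chiM i a b : bq_chi i (a * b) = bq_chi i a * bq_chi i b.
Proof.
have [f <-] := pi_onto a; have [g <-] := pi_onto b.
by rewrite -rmorphM !bq_chiE pcoef_mul.
Qed.

Lemma bq_chi_e i j : bq_chi i (bq_e j) = (i == j)%:R.
Proof.
rewrite bq_chiE -[triv_path j]/(mono 1 (pvert j)) pcoef_mono.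
case: (eqVneq i j) => [->|ij]; first by rewrite eqxx.
by case: eqP => // -[ji]; rewrite ji eqxx in ij.
Qed.

Lemma bq_sum_e : \sum_x bq_e x = 1.
Proof. by rewrite -[LHS](raddf_sum pi) -[RHS](rmorph1 pi); congr (pi _); apply: sum_triv. Qed.

Lemma bq_ee x y : bq_e x * bq_e y = if x == y then bq_e y else 0.
Proof. by rewrite -[LHS]rmorphM /= triv_trivE; case: ifP; rewrite ?raddf0. Qed.

Lemma bq_chi1 i : bq_chi i 1 = 1.
Proof.
have chi0 : bq_chi i 0 = 0 by rewrite -(raddf0 pi) bq_chiE; apply: mcoeff0.
have chiD a b : bq_chi i (a + b) = bq_chi i a + bq_chi i b.
  by have := bq_chi_lin i 1 a b; rewrite scale1r mul1r.
rewrite -bq_sum_e (big_morph _ chiD chi0) (bigD1 i) //= bq_chi_e eqxx.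
by rewrite big1 ?addr0 // => x xi; rewrite bq_chi_e eq_sym (negbTE xi).
Qed.

Lemma bq_sink v a : sink v -> a * bq_e v = bq_chi v a *: bq_e v.
Proof.
move=> hv; have [f <-] := pi_onto a.
by rewrite -[LHS]rmorphM /= sink_triv // linearZ /= bq_chiE.
Qed.

Lemma bq_closed (V : {set I}) x u a : (forall b : arr Q, src b \in V -> tgt b \in V) ->
  x \in V -> u \notin V -> bq_e u * a * bq_e x = 0.
Proof.
move=> hV xV uV; have [f <-] := pi_onto a.
by rewrite -!rmorphM /= (closed_triv f hV) // raddf0.
Qed.

(** The common kernel of the characters is the image of the arrow ideal, and [J] contains a power of
    that ideal. *)
Lemma bq_radical : exists rad : {vspace A},
  (forall a, a \in rad <-> forall i, bq_chi i a = 0) /\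
  exists m, (rad ^+ m)%VS = 0%VS.
Proof.
have chiH i : exists F : 'Hom(A, K^o), forall a, F a = bq_chi i a.
  by apply: linear_hom => k a b; apply: bq_chi_lin.
have [F FE] := fin_all_exists chiH.
pose rad := (\bigcap_i lker (F i))%VS.
have radP a : a \in rad <-> forall i, bq_chi i a = 0.
  rewrite memvE; split=> [/subv_bigcapP h i|h].
    by have := h i isT; rewrite -memvE memv_ker FE => /eqP.
  by apply/subv_bigcapP => i _; rewrite -memvE memv_ker FE h.
exists rad; split=> //; have [[_ [m _ Jm] _] _ piJ] := AE; exists m.
(* Radical factors are traded one by one for path length; at [n = m] no length is required, and
   [f = 1] gives the claim. *)
have kill n : (n <= m)%N -> forall a f, a \in (rad ^+ n)%VS ->
    arrow_ideal_pow (m - n) f -> a * pi f = 0.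
  elim: n => [|n IH] nm a f; first by rewrite subn0 => _ /Jm/piJ ->; rewrite mulr0.
  move=> aR hf; have [M ME] : exists M : 'Hom(A, A), forall x, M x = x * pi f.
    by apply: linear_hom => k x y; rewrite mulrDl scalerAl.
  suff : (rad ^+ n.+1 <= lker M)%VS by move/subvP/(_ a aR); rewrite memv_ker ME => /eqP.
  rewrite expvSr; apply/prodvP => x y xR yR; rewrite memv_ker ME -mulrA.
  have [g gy] := pi_onto y; rewrite -gy -rmorphM; apply/eqP/IH => //; first exact: ltnW.
  rewrite -(subnSK nm) -add1n; apply: arrow_pow_mul hf.
  apply/arrow_pow1P => i; rewrite -bq_chiE gy; exact: (radP y).1.
apply/eqP; rewrite -subv0; apply/subvP => a aR; rewrite memv0 -[a]mulr1 -(rmorph1 pi).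
by apply/eqP/(kill m) => //; rewrite subnn.
Qed.

(** From a nonzero vector, apply radical elements as long as the result is nonzero; nilpotency stops
    this. *)
Lemma radical_socle (rad : {vspace A}) (S : fdmod A) m :
    (rad ^+ m)%VS = 0%VS -> (0 < \dim {:S})%N ->
  exists2 y : S, y != 0 & forall a, a \in rad -> act S a y = 0.
Proof.
move=> radm dS; have [x0 x0n] : exists x : S, x != 0.
  by exists (vpick {:S}); rewrite vpick0; apply: contraTneq dS => ->; rewrite dimv0.
have : forall a, a \in (rad ^+ m)%VS -> act S a x0 = 0.
  by move=> a; rewrite radm memv0 => /eqP ->; apply: act0.
elim: m {radm} x0 x0n => [|n IH] x xn h.
  by case/eqP: xn; rewrite -(act1E (M := S) x) h // expv0 memv_line.
case: (classic (exists2 a, a \in rad & act S a x <> 0)) => [[a aR ax]|hn].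
  apply: (IH (act S a x)); first exact/eqP.
  by move=> b bR; rewrite -actME h // expvSr memv_mul.
exists x => // a aR; apply: NNPP => ax; apply: hn; by exists a.
Qed.

(** A vector [y] killed by the radical has a nonzero component [e j y]; its span is a submodule,
    hence all of [S], and the action of [e i] forces [j = i]. *)
Lemma bq_simple_line (S : fdmod A) i : simple S -> act S (bq_e i) != 0 ->
  (forall a x, act S a x = bq_chi i a *: x) /\
  (exists2 z : S, z != 0 & forall x, exists k, x = k *: z).
Proof.
move=> [dS hS] ei; have [rad [radP [m radm]]] := bq_radical.
have [y yn yr] := radical_socle radm dS.
have [j zn] : exists j, act S (bq_e j) y != 0.
  apply: NNPP => h; case/eqP: yn; rewrite -[y]act1E -bq_sum_e act_sum big1 // => j _.
  by apply/eqP; apply: contraT => hj; case: h; exists j.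
set z := act S (bq_e j) y in zn.
have za a : act S a z = bq_chi j a *: z.
  apply/eqP; rewrite -subr_eq0 /z -actZ -actME -actB; apply/eqP/yr/radP => k.
  rewrite addrC -scaleN1r bq_chi_lin -[_ *: bq_e j]addr0 bq_chi_lin bq_chiM bq_chi_e.
  have -> : bq_chi k 0 = 0 by rewrite -(raddf0 pi) bq_chiE; apply: mcoeff0.
  by case: (eqVneq k j) => [->|_]; rewrite ?mulr0 ?addr0 ?mulr0 // !mulr1 mulN1r addNr.
have line x : exists k, x = k *: z.
  have hz : submod <[z]>.
    by apply/submodP => a _ /vlineP[k ->]; rewrite linearZ /= za !memvZ ?memv_line.
  have [h|h] := hS _ hz.
    by case/eqP: zn; apply/eqP; rewrite -memv0 -h memv_line.
  by apply/vlineP; rewrite h memvf.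
have aS a x : act S a x = bq_chi j a *: x.
  by have [k ->] := line x; rewrite linearZ /= za !scalerA mulrC.
have ij : j = i.
  apply/eqP; apply: contraNT ei => ji; apply/eqP/lfunP => x.
  by rewrite aS bq_chi_e (negbTE ji) scale0r zero_lfunE.
by subst j; split=> //; exists z.
Qed.

Lemma bq_split_basic (L : I -> fdmod A) : vertex_simples bq_e L ->
  exists rad, split_basic L bq_chi bq_e rad.
Proof.
move=> hL; have [rad [radP radm]] := bq_radical; exists rad.
have line i := bq_simple_line (hL i).1 (hL i).2.
split=> //; [exact: bq_chi_lin|exact: bq_chi1|exact: bq_chiM|..].
- by move=> i; case: (line i).
- exact: bq_chi_e.
- by move=> i; have [_ [z zn _]] := line i; exists z.
- move=> i x y xn; have [_ [z zn lz]] := line i.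
  have [k xk] := lz x; have [l yl] := lz y.
  have kn : k != 0 by apply: contraNneq xn => k0; rewrite xk k0 scale0r.
  by exists (l / k); rewrite yl xk scalerA divfK.
Qed.

End BoundQuiver.

Lemma alghom_ahom (K : fieldType) (A A' : falgType K) (f : 'AHom(A, A')) : alghom f.
Proof. by split=> [k a b||a b]; rewrite ?linearP ?rmorph1 ?rmorphM. Qed.

(** * The quotient at a set of vertices closed under successors *)

Section QuotientSide.
Variables (K : fieldType) (Q : quiver) (J : path_algebra K Q -> Prop).
Variables (A : falgType K) (pi : {lrmorphism path_algebra K Q -> A}).
Hypothesis AE : bound_quiver_algebra J pi.
Local Notation I := (vert Q).
Local Notation e := (bq_e pi).
Local Notation chi := (bq_chi AE).
Variables (V : {set I}) (v : I) (vV : v \in V).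
Hypothesis V_closed : forall b : arr Q, src b \in V -> tgt b \in V.
Hypothesis v_sink : sink v.
Variables (A' : falgType K) (pr : 'AHom(A, A')).
Hypothesis A'E : vertex_quotient e V pr.

Definition out_idem : A := \sum_(u | u \notin V) e u.
Local Notation E := out_idem.

Lemma out_idem_e u : u \notin V -> e u * E = e u.
Proof.
move=> uV; rewrite mulr_sumr (bigD1 u) //= (bq_ee pi) eqxx big1 ?addr0 //.
by move=> x /andP[_ xu]; rewrite (bq_ee pi) eq_sym (negbTE xu).
Qed.

Lemma out_idem_compl : 1 - E = \sum_(x | x \in V) e x.
Proof.
by rewrite -(bq_sum_e pi) (bigID (mem V)) /= addrK.
Qed.

Lemma out_idemM a : E * a * (1 - E) = 0.
Proof.
rewrite out_idem_compl mulr_sumr big1 // => x xV; rewrite !mulr_suml big1 // => u uV.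
exact: (bq_closed AE a V_closed xV uV).
Qed.

Lemma out_idem_idem : E * E = E.
Proof. by have /eqP := out_idemM 1; rewrite mulr1 mulrBr mulr1 subr_eq0 => /eqP. Qed.

Lemma out_idemMr a : E * a * E = E * a.
Proof. by have /eqP := out_idemM a; rewrite mulrBr mulr1 subr_eq0 => /eqP. Qed.

Lemma out_idem_chi i : chi i E = (i \notin V)%:R.
Proof.
have chi0 : chi i 0 = 0.
  by have := bq_chi_lin AE i (-1) 1 1; rewrite scaleN1r addNr => ->; rewrite mulN1r addNr.
have chiD a b : chi i (a + b) = chi i a + chi i b.
  by have := bq_chi_lin AE i 1 a b; rewrite scale1r mul1r.
rewrite /E (big_morph _ chiD chi0); case: (boolP (i \in V)) => iV /=.
  rewrite big1 // => u uV; rewrite bq_chi_e.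
  by case: eqVneq => // iu; rewrite -iu iV in uV.
rewrite (bigD1 i) //= bq_chi_e eqxx big1 ?addr0 // => u /andP[_ ui].
by rewrite bq_chi_e eq_sym (negbTE ui).
Qed.

(** No path leads from [V] to its complement, so [E * a = E * a * E], and the left ideal [A E] is
    already two-sided. *)
Lemma pr_eq0 a : pr a = 0 <-> a = a * E.
Proof.
have [_ prE] := A'E; rewrite prE; split=> [h|->].
  apply: (h (fun x => x = x * E)); last by move=> y [u uV ->]; rewrite out_idem_e.
  split=> [|x y hx hy|b c x hx]; first by rewrite mul0r.
    by rewrite mulrDl -hx -hy.
  by rewrite hx -!mulrA [E * (c * E)]mulrA out_idemMr.
move=> P [P0 PD PM] hP; rewrite -[a * E]mulr1; apply: PM.
rewrite /out_idem; elim/big_rec: _ => // u x uV Px; apply: PD => //; apply: hP; by exists u.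
Qed.

Lemma pr_out_idem : pr E = 0.
Proof. by apply/pr_eq0; rewrite out_idem_idem. Qed.

Let pr_alghom : alghom pr := alghom_ahom pr.

(* ker pr = A E, so a |-> a (1 - E) factors through pr; the second term makes it
   a unital section, which the other quotient sends to the scalars chi v a. *)
Definition qs_lift (a : A) : A := a * (1 - E) + chi v a *: E.
Definition qs_sigma (a : A') : A := qs_lift ((pr^-1)%VF a).

Let lift_lin k a b : qs_lift (k *: a + b) = k *: qs_lift a + qs_lift b.
Proof.
rewrite /qs_lift bq_chi_lin mulrDl scalerDl scalerDr -scalerAl scalerA.
by rewrite addrACA.
Qed.

Lemma qs_sigmaE a : qs_sigma (pr a) = qs_lift a.
Proof.
have [prf _] := A'E; set b := (pr^-1)%VF (pr a).
have /pr_eq0 h : pr ((-1) *: b + a) = 0.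
  by rewrite linearP /= limg_lfunVK ?prf ?memvf // scaleN1r addNr.
have : qs_lift ((-1) *: b + a) = 0.
  rewrite h /qs_lift bq_chiM out_idem_chi vV mulr0 scale0r addr0 -mulrA.
  by rewrite mulrBr mulr1 out_idem_idem subrr mulr0.
by rewrite lift_lin scaleN1r => /eqP; rewrite addrC subr_eq0 => /eqP h1; apply: esym.
Qed.

Let pr_onto a' : exists a, pr a = a'.
Proof. by have [prf _] := A'E; apply: (limg_fullP _).1. Qed.

Lemma alghom_qs_sigma : alghom qs_sigma.
Proof.
split=> [k a b||a b].
- have [x <-] := pr_onto a; have [y <-] := pr_onto b.
  by rewrite -linearP /= !qs_sigmaE lift_lin.
- by rewrite -(rmorph1 pr) qs_sigmaE /qs_lift bq_chi1 mul1r scale1r subrK.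
- have [x <-] := pr_onto a; have [y <-] := pr_onto b.
  rewrite -rmorphM /= !qs_sigmaE /qs_lift bq_chiM; set P := 1 - E.
  have PE : P * E = 0 by rewrite mulrBl mul1r out_idem_idem subrr.
  have e1 : x * P * (y * P) = x * y * P.
    by rewrite -[x * P * _]mulrA [P * _]mulrBl mul1r [E * _]mulrA out_idemM subr0 mulrA.
  have e2 : x * P * (chi v y *: E) = 0 by rewrite -scalerAr -mulrA PE mulr0 scaler0.
  have e3 : chi v x *: E * (y * P) = 0 by rewrite -scalerAl mulrA out_idemM scaler0.
  clearbody P; rewrite mulrDl !mulrDr e1 e2 e3 addr0 add0r -scalerAl -scalerAr out_idem_idem.
  by rewrite scalerA.
Qed.

Lemma qs_sigmaK : cancel qs_sigma pr.
Proof.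
move=> a'; have [a <-] := pr_onto a'; rewrite qs_sigmaE /qs_lift.
rewrite (alghomD pr_alghom) (alghomZ pr_alghom) (alghomM pr_alghom) (alghomB pr_alghom).
by rewrite (alghom1 pr_alghom) pr_out_idem subr0 mulr1 scaler0 addr0.
Qed.

Lemma qs_hc a : (1 - E) * qs_sigma (pr a) = a * (1 - E).
Proof.
rewrite qs_sigmaE /qs_lift mulrDr -scalerAr [(1 - E) * E]mulrBl mul1r out_idem_idem.
by rewrite subrr scaler0 addr0 mulrA mulrBl mul1r mulrBl out_idemM subr0.
Qed.

Lemma qs_prc : pr (1 - E) = 1.
Proof. by rewrite (alghomB pr_alghom) (alghom1 pr_alghom) pr_out_idem subr0. Qed.

Local Notation chi' j := (fun a' => chi (val (j : sub_vertex V)) (qs_sigma a')).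
Local Notation e' := (fun j : sub_vertex V => pr (e (val j))).

(** The section collapses the vertices outside [V] to [v], since it replaces their part by the
    scalar [chi v a]. *)
Lemma qs_chi i a : chi i (qs_sigma (pr a)) = chi (if i \in V then i else v) a.
Proof.
rewrite qs_sigmaE /qs_lift addrC bq_chi_lin bq_chiM.
have -> : chi i (1 - E) = (i \in V)%:R.
  rewrite -[1 - E]addrC -scaleN1r bq_chi_lin bq_chi1 out_idem_chi mulN1r.
  by case: (i \in V); rewrite ?oppr0 ?add0r ?addNr.
by rewrite out_idem_chi; case: (i \in V); rewrite /= ?mulr0 ?mulr1 ?add0r ?addr0.
Qed.

Lemma qs_chi_val (j : sub_vertex V) a : chi' j (pr a) = chi (val j) a.
Proof. by have := qs_chi (val j) a; rewrite (valP j). Qed.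

(** The simple modules are inflated to [A], and the radical is the preimage of that of [A] under the
    section; by [qs_chi] a vertex outside [V] imposes the same condition as [v]. *)
Lemma qs_split_basic (L' : sub_vertex V -> fdmod A') : vertex_simples e' L' ->
  exists rad', split_basic L' (fun j => chi' j) e' rad'.
Proof.
move=> hL'; have [rad [radP [m radm]]] := bq_radical AE.
have [S SE] := linear_hom (fun k a b => let: And3 h _ _ := alghom_qs_sigma in h k a b).
pose rad' := (S @^-1: rad)%VS; exists rad'.
have line j := @bq_simple_line K Q J A pi AE (pull pr_alghom (L' j)) (val j)
  (simple_pull pr_alghom qs_sigmaK (hL' j).1) (hL' j).2.
split=> //.
- by move=> j k a b; have [h _ _] := alghom_qs_sigma; rewrite h bq_chi_lin.
- by move=> j; rewrite (alghom1 alghom_qs_sigma) bq_chi1.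
- by move=> j a b; rewrite (alghomM alghom_qs_sigma) bq_chiM.
- move=> j a x; have [h _] := line j.
  by have := h (qs_sigma a) x; rewrite /= qs_sigmaK.
- by move=> i j; rewrite qs_chi_val bq_chi_e (inj_eq val_inj).
- by move=> j; have [_ [z zn _]] := line j; exists z.
- move=> j x y xn; have [_ [z zn lz]] := line j.
  have [k xk] := lz x; have [l yl] := lz y.
  have kn : k != 0 by apply: contraNneq xn => k0; rewrite xk k0 scale0r.
  by exists (l / k); rewrite yl xk scalerA divfK.
- move=> a; rewrite -memv_preim SE radP; split=> [h j|h i]; first exact: h.
  have [b ab] := pr_onto a; subst a; rewrite qs_chi.
  case: ifP => iV; first by have := h (exist _ i iV); rewrite qs_chi_val.
  by have := h (exist _ v vV); rewrite qs_chi_val.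
- exists m; have sub n : (rad' ^+ n <= S @^-1: (rad ^+ n))%VS.
    elim: n => [|n IH].
      apply/subvP => _ /vlineP[k ->]; rewrite -memv_preim linearZ /= SE.
      by rewrite (alghom1 alghom_qs_sigma) memvZ // memv_line.
    rewrite !expvSl; apply/prodvP => x y xR yR.
    rewrite -memv_preim SE (alghomM alghom_qs_sigma) -!SE memv_mul //.
      by rewrite memv_preim.
    by rewrite memv_preim (subvP IH).
  apply/eqP; rewrite -subv0; apply: subv_trans (sub m) _; rewrite radm.
  apply/subvP => a; rewrite -memv_preim memv0 SE memv0 => /eqP h.
  by rewrite -[a]qs_sigmaK h linear0.
Qed.

Lemma qs_sink a' : a' * pr (e v) = chi v (qs_sigma a') *: pr (e v).
Proof.
have [a <-] := pr_onto a'; rewrite qs_chi vV.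
by rewrite -[LHS]rmorphM /= (bq_sink AE a v_sink) linearZ.
Qed.

Lemma pr_e u : u \notin V -> pr (e u) = 0.
Proof. by move=> uV; apply/pr_eq0; rewrite out_idem_e. Qed.

Variables (L : I -> fdmod A) (L' : sub_vertex V -> fdmod A') (le : rel I).
Hypotheses (LE : vertex_simples e L) (L'E : vertex_simples e' L').
Hypothesis le_refl : reflexive le.
Variables (B' : {aspace A'}) (LB' : sub_vertex V -> fdmod (subvs_of B')).
Hypothesis hB' : exact_borel L' (relpre val le) LB'.
Hypothesis qh' : quasi_hereditary L' (relpre val le).
Hypothesis v_min : forall u, essential_le L le u v -> u = v.

(* Standard filtrations of projective A'-modules inflate to A, so minimality of
   v in the essential order of A bounds those of A'. *)
Lemma qs_idempotent : exists F : A', [/\ F \in B',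
    forall b, b \in B' -> F * b = chi v (qs_sigma b) *: F,
    forall a, a * F = chi v (qs_sigma a) *: F,
    chi v (qs_sigma F) = 1
  & forall u : sub_vertex V, val u != v -> chi (val u) (qs_sigma F) = 0].
Proof.
have [rad hA] := bq_split_basic AE LE; have [rad' hA'] := qs_split_basic L'E.
pose v' : sub_vertex V := exist _ v vV.
have hL j : misom (pull pr_alghom (L' j)) (L (val j)).
  by apply: (split_basic_misom pr_alghom hA hA') => a; rewrite qs_chi_val.
have Lout i : (exists j : sub_vertex V, val j = i) \/
    (exists2 a, pr a = 0 & exists x, act (L i) a x != 0).
  case: (boolP (i \in V)) => iV; [by left; exists (exist _ i iV)|right].
  exists (e i); first exact: pr_e.
  have [x xn] := L_neq0 hA i; exists x.
  by rewrite (chi_act hA) bq_chi_e eqxx scale1r.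
have [||F [FB Fb Fa F1 F0]] := @borel_central_idempotent K A' _ L' _ e' rad' hA'
    (relpre val le) _ v' qs_sink _ qh' B' LB' hB'.
- by move=> j; apply: le_refl.
- move=> u P m [p hp] [s fs <-] m0; apply: val_inj; apply: v_min.
  apply: rt_step; right; exists (pull pr_alghom P), (count_mem v' s); split=> //.
    exact: (proj_cover_pull alghom_qs_sigma qs_sigmaK qs_prc qs_hc hL hp).
  exists (map val s); last by rewrite count_map; apply: eq_count => x; rewrite /= -(inj_eq val_inj).
  apply: filtration_pull fs => j X.
  exact: (is_standard_pull alghom_qs_sigma qs_sigmaK qs_prc qs_hc hL Lout).
exists F; split=> // b bB; by case: (Fb b bB).
Qed.

End QuotientSide.

(** * The algebra as a fibre product of its two quotients *)

Section TwoSides.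
Variables (K : fieldType) (Q : quiver) (J : path_algebra K Q -> Prop).
Variables (A : falgType K) (pi : {lrmorphism path_algebra K Q -> A}).
Hypothesis AE : bound_quiver_algebra J pi.
Local Notation I := (vert Q).
Local Notation e := (bq_e pi).
Local Notation chi := (bq_chi AE).
Variables (V W : {set I}) (v : I).
Hypotheses (VUW : V :|: W = [set: I]) (VIW : V :&: W = [set v]).
Hypothesis V_closed : forall b : arr Q, src b \in V -> tgt b \in V.
Hypothesis W_closed : forall b : arr Q, src b \in W -> tgt b \in W.
Hypothesis v_sink : sink v.
Variables (A1 A2 : falgType K) (pr1 : 'AHom(A, A1)) (pr2 : 'AHom(A, A2)).
Hypotheses (A1E : vertex_quotient e V pr1) (A2E : vertex_quotient e W pr2).

Let vV : v \in V. Proof. by have := set11 v; rewrite -VIW inE => /andP[]. Qed.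

Let inVW x : x \notin V -> x \in W.
Proof. by have := in_setT x; rewrite -VUW inE => /orP[->|]. Qed.

Lemma out_idem_sum : 1 - out_idem pi V = e v + out_idem pi W.
Proof.
rewrite out_idem_compl (bigD1 v) //=; congr (_ + _); apply: eq_bigl => x.
have := in_setT x; rewrite -VUW inE; have := erefl (x \in [set v]).
rewrite -{1}VIW !inE; case: (x \in V); case: (x \in W) => //=; case: eqP => //.
Qed.

(** Since [V] and the complement of [W] differ exactly by [v], [pr2] sends [x * (1 - E)] to the
    image of [x * e v], which is a scalar multiple of that of [e v] at a sink. *)
Lemma cross_sigma a :
  pr2 (qs_sigma AE V v pr1 a) = chi v (qs_sigma AE V v pr1 a) *: 1.
Proof.
have [prf _] := A1E; have [x <-] := (limg_fullP _).1 prf a.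
rewrite (qs_chi AE vV V_closed A1E) vV (qs_sigmaE AE vV V_closed A1E) /qs_lift.
have hp := alghom_ahom pr2; have W0 := pr_out_idem AE W_closed A2E.
rewrite (alghomD hp) (alghomZ hp) [pr2 (x * _)](congr1 (fun y => pr2 (x * y)) out_idem_sum).
rewrite mulrDr (alghomD hp) (bq_sink AE x v_sink) (alghomM hp) W0 mulr0 addr0.
rewrite (alghomZ hp) -scalerDr; congr (_ *: _).
have /(congr1 pr2) := out_idem_sum; rewrite (alghomB hp) (alghomD hp) (alghom1 hp) W0 addr0.
by move=> <-; rewrite subrK.
Qed.

(** An element of both kernels is fixed by right multiplication with both [out_idem]; their product
    is 0, as no vertex lies outside both sets. *)
Lemma pr_joint_inj a b : pr1 a = pr1 b -> pr2 a = pr2 b -> a = b.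
Proof.
move=> e1 e2; apply/eqP; rewrite -subr_eq0.
have /(pr_eq0 AE V_closed A1E) h1 : pr1 (a - b) = 0.
  by rewrite (alghomB (alghom_ahom pr1)) e1 subrr.
have /(pr_eq0 AE W_closed A2E) h2 : pr2 (a - b) = 0.
  by rewrite (alghomB (alghom_ahom pr2)) e2 subrr.
rewrite h2 h1 -mulrA.
have -> : out_idem pi V * out_idem pi W = 0.
  rewrite mulr_suml big1 // => u uV; rewrite mulr_sumr big1 // => w wW.
  rewrite (bq_ee pi); case: eqP => // uw; case/negP: wW.
  by rewrite -uw inVW.
by rewrite mulr0.
Qed.

End TwoSides.


(** * Assembly for a deconcatenation at a sink *)

Lemma glue_aspace (K : fieldType) (A A1 A2 : falgType K) (f1 : 'AHom(A, A1))
    (f2 : 'AHom(A, A2)) (B1 : {aspace A1}) (B2 : {aspace A2}) : 1 \in B1 -> 1 \in B2 ->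
  exists B : {aspace A}, forall a, (a \in B) = (f1 a \in B1) && (f2 a \in B2).
Proof.
move=> i1 i2; pose U : {vspace A} := (f1 @^-1: B1 :&: f2 @^-1: B2)%VS.
have UE a : (a \in U) = (f1 a \in B1) && (f2 a \in B2) by rewrite memv_cap -!memv_preim.
have hU : is_aspace U.
  apply/andP; split; first by apply: has_algid1; rewrite UE !rmorph1 i1.
  apply/prodvP => a b; rewrite !UE => /andP[a1 a2] /andP[b1 b2].
  by rewrite !rmorphM /= !memvM.
by exists (ASpace hU).
Qed.

(** An arrow leaving [V] would start away from the sink [v] and end in [W] away from [v]. *)
Lemma deconcatenation_closed (Q : quiver) (V W : {set vert Q}) v :
  deconcatenation V W v -> sink v -> forall b : arr Q, src b \in V -> tgt b \in V.
Proof.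
case=> _ _ VUW VIW hadj hv b bV; apply: contraT => tV.
have vV : v \in V by have := set11 v; rewrite -VIW inE => /andP[].
have tW : tgt b \in W by have := in_setT (tgt b); rewrite -VUW inE (negbTE tV).
have h1 : src b \in V :\ v by rewrite !inE (hv b) bV.
have h2 : tgt b \in W :\ v by rewrite !inE tW andbT; apply: contraNneq tV => ->.
case/negP: (hadj _ _ h1 h2); apply/existsP; exists b; by rewrite !eqxx.
Qed.

Lemma deconcatenation_sym (Q : quiver) (V W : {set vert Q}) v :
  deconcatenation V W v -> deconcatenation W V v.
Proof.
case=> hV hW VUW VIW hadj; split=> //; [by rewrite setUC|by rewrite setIC|].
move=> x y xW yV; have := hadj y x yV xW; apply: contra => /existsP[a ha].
by apply/existsP; exists a; rewrite orbC.
Qed.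

Theorem proposition55
  (K : closedFieldType) (Q : quiver)
  (J : path_algebra K Q -> Prop)
  (A : falgType K) (pi : {lrmorphism path_algebra K Q -> A})
  (V1 V2 : {set vert Q}) (v : vert Q)
  (A1 A2 : falgType K) (pr1 : 'AHom(A, A1)) (pr2 : 'AHom(A, A2))
  (le : rel (vert Q))
  (L : vert Q -> fdmod A)
  (L1 : sub_vertex V1 -> fdmod A1) (L2 : sub_vertex V2 -> fdmod A2)
  (Qconn : connected_on [set: vert Q])
  (AE : bound_quiver_algebra J pi)
  (A1E : vertex_quotient (fun x => pi (triv_path x)) V1 pr1)
  (A2E : vertex_quotient (fun x => pi (triv_path x)) V2 pr2)
  (LE : vertex_simples (fun x => pi (triv_path x)) L)
  (L1E : vertex_simples
           (fun x : sub_vertex V1 => pr1 (pi (triv_path (val x)))) L1)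
  (L2E : vertex_simples
           (fun x : sub_vertex V2 => pr2 (pi (triv_path (val x)))) L2)
  (le_order : partial_order le)
  (qhA : quasi_hereditary L le)
  (qhA1 : quasi_hereditary L1 (relpre val le))
  (qhA2 : quasi_hereditary L2 (relpre val le))
  (Qdec : deconcatenation V1 V2 v)
  (v_sink : sink v)
  (B1E : exists B1 : {aspace A1}, regular_exact_borel L1 (relpre val le) B1)
  (B2E : exists B2 : {aspace A2}, regular_exact_borel L2 (relpre val le) B2)
  (v_min : forall u : vert Q, essential_le L le u v -> u = v) :
  exists B : {aspace A}, regular_exact_borel L le B.
Proof.
have [B1 [LB1 [hB1 iso1]]] := B1E; have [B2 [LB2 [hB2 iso2]]] := B2E.
have [le_refl _ _] := le_order.
have cl1 := deconcatenation_closed Qdec v_sink.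
have cl2 := deconcatenation_closed (deconcatenation_sym Qdec) v_sink.
have [_ _ V1UV2 V1IV2 _] := Qdec.
have V2UV1 : V2 :|: V1 = [set: vert Q] by rewrite setUC.
have V2IV1 : V2 :&: V1 = [set v] by rewrite setIC.
have /andP[vV1 vV2] : (v \in V1) && (v \in V2) by have := set11 v; rewrite -V1IV2 inE.
have [rad hA] := bq_split_basic AE LE.
have [rad1 hA1] := qs_split_basic AE vV1 cl1 A1E L1E.
have [rad2 hA2] := qs_split_basic AE vV2 cl2 A2E L2E.
have [F1 [F1B F1r F1l chiF1 F1_0]] :=
  qs_idempotent AE vV1 cl1 v_sink A1E LE L1E le_refl hB1 qhA1 v_min.
have [F2 [F2B F2r F2l chiF2 F2_0]] :=
  qs_idempotent AE vV2 cl2 v_sink A2E LE L2E le_refl hB2 qhA2 v_min.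
have [i1 _ _ _] := hB1; have [i2 _ _ _] := hB2.
have [B BE] := glue_aspace pr1 pr2 i1 i2; exists B.
have hs1 := alghom_qs_sigma AE vV1 cl1 A1E; have hs2 := alghom_qs_sigma AE vV2 cl2 A2E.
have G : gluing pr1 pr2 (qs_sigma AE V1 v pr1) (qs_sigma AE V2 v pr2) (bq_chi AE v)
    B B1 B2 F1 F2.
  split=> //; try exact: alghom_ahom.
  - exact: (qs_sigmaK AE vV1 cl1 A1E).
  - exact: (qs_sigmaK AE vV2 cl2 A2E).
  - exact: (cross_sigma AE V1UV2 V1IV2 cl1 cl2 v_sink A1E A2E).
  - exact: (cross_sigma AE V2UV1 V2IV1 cl2 cl1 v_sink A2E A1E).
  - by move=> a; rewrite (qs_chi AE vV1 cl1 A1E) vV1.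
  - by move=> a; rewrite (qs_chi AE vV2 cl2 A2E) vV2.
  - exact: (pr_joint_inj AE V1UV2 cl1 cl2 A1E A2E).
  - exact: bq_chi_lin.
  - exact: bq_chi1.
have chi_idem (V : {set vert Q}) A' (p' : 'AHom(A, A')) (F : A') i (s := qs_sigma AE V v p') :
    alghom s -> bq_chi AE i (s F) = 0 -> bq_chi AE i (s (1 - F)) = 1.
  move=> hs h; rewrite (alghomB hs) (alghom1 hs) addrC -scaleN1r bq_chi_lin h bq_chi1.
  by rewrite mulr0 add0r.
have in1 i (iV : i \in V1) : exists j : sub_vertex V1, val j = i by exists (exist _ i iV).
have in2 i (iV : i \in V2) : exists j : sub_vertex V2, val j = i by exists (exist _ i iV).
have out1 i : i \notin V1 -> i \in V2.
  by have := in_setT i; rewrite -V1UV2 inE => /orP[->|].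
have out2 i : i \notin V2 -> i \in V1.
  by have := in_setT i; rewrite -V2UV1 inE => /orP[->|].
(* The elements [1 - out_idem] provide the right adjoints of inflation from [A1] and [A2] to [A];
   they are distinct in role from the central idempotents of [B]. *)
apply: (@glued_regular_exact_borel _ _ _ _ _ _ _ _ _ _ _ _ _ _ G _ _ _ _ _ _ _ hA
  _ _ _ _ hA1 _ _ _ _ hA2 val val_inj val val_inj le le_refl _ _ _ _ _ _ _
  (1 - out_idem pi V1) (1 - out_idem pi V2) _ _ _ _ LB1 LB2 hB1 hB2 iso1 iso2).
- by move=> j a; rewrite (qs_chi_val AE vV1 cl1 A1E).
- by move=> j a; rewrite (qs_chi_val AE vV2 cl2 A2E).
- by move=> i; case: (boolP (i \in V1)) => iV; [left; apply: in1|right; apply/in2/out1].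
- move=> i; case: (boolP (i \in V1)) => iV; [by left; apply: in1|right].
  (* A vertex outside [V1] lies in [V2] and differs from [v], so [F2] has value 0 there. *)
  apply: chi_idem => //; apply: (F2_0 (exist _ i (out1 i iV))).
  by rewrite /=; apply: contraNneq iV => ->.
- move=> i; case: (boolP (i \in V2)) => iV; [by left; apply: in2|right].
  apply: chi_idem => //; apply: (F1_0 (exist _ i (out2 i iV))).
  by rewrite /=; apply: contraNneq iV => ->.
- move=> i; case: (boolP (i \in V1)) => iV; [by left; apply: in1|right].
  exists (bq_e pi i); first exact: (pr_e AE cl1 A1E).
  by rewrite bq_chi_e eqxx oner_eq0.
- move=> i; case: (boolP (i \in V2)) => iV; [by left; apply: in2|right].
  exists (bq_e pi i); first exact: (pr_e AE cl2 A2E).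
  by rewrite bq_chi_e eqxx oner_eq0.
- exact: (qs_prc AE cl1 A1E).
- exact: (qs_hc AE vV1 cl1 A1E).
- exact: (qs_prc AE cl2 A2E).
- exact: (qs_hc AE vV2 cl2 A2E).
Qed.
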